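(* Let $0<p\le\infty$, and let $s>1/4$ if $p\le4$ and $s>1/2-1/p$ if $p>4$ (with $1/\infty=0$). Let $R_s(x)=\sum_{n=1}^\infty n^{-2s}e^{2\pi i n^2x}$ and, for $N\in\mathbb N$, $(R_s)_{\ge N}(x)=\sum_{n\ge1,\,n^2\ge N}n^{-2s}e^{2\pi i n^2x}$. Then for all sufficiently large $N$, \[ \|(R_s)_{\ge N}\|_{L^p(\mathbb T)}\simeq_{s,p}\begin{cases}N^{1/4-s}, & p<4,\\ N^{1/4-s}(\log N)^{1/4}, & p=4,\\ N^{1/2-1/p-s}, & p>4,\end{cases} \] interpreting $1/p=0$ when $p=\infty$.
   Context: $\mathbb T=\mathbb R/\mathbb Z$. The series are understood as limits in $L^p(\mathbb T)$ of their partial sums. $\simeq_{s,p}$ means two-sided bounds with constants depending only on $s,p$ (not on $N$). *)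

(* Defs.v *)
From HB Require Import structures.
From mathcomp Require Import all_boot all_order all_algebra.
From mathcomp Require Import all_classical all_reals all_analysis.
Set Implicit Arguments. Unset Strict Implicit. Unset Printing Implicit Defensive.
Import Order.TTheory GRing.Theory Num.Theory.
Import numFieldNormedType.Exports.
Local Open Scope classical_set_scope.
Local Open Scope ring_scope.

Section Defs.
Variable R : realType.

Definition coef (s : R) (n : nat) : R := powR (n%:R) (- (2 * s)).

Definition tailRe (s : R) (N M : nat) (x : R) : R :=
  \sum_(1 <= n < M.+1 | (N <= n ^ 2)%N) coef s n * cos (2 * pi * (n ^ 2)%:R * x).
Definition tailIm (s : R) (N M : nat) (x : R) : R :=
  \sum_(1 <= n < M.+1 | (N <= n ^ 2)%N) coef s n * sin (2 * pi * (n ^ 2)%:R * x).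

Definition cmod (a b : R) : R := Num.sqrt (a ^+ 2 + b ^+ 2).

Lemma measurable_unit_itv : measurable (`[0%R, 1%R]%classic : set R).
Proof. exact: measurable_itv. Qed.

(* Lebesgue measure on [0,1] (a model of T = R/Z) *)
Definition muT := mrestr (@lebesgue_measure R) measurable_unit_itv.

Definition LpT (p : \bar R) (fr fi : R -> R) : \bar R :=
  Lnorm muT p (fun x => (cmod (fr x) (fi x))%:E).

Definition invp (p : \bar R) : R :=
  match p with r%:E => r^-1 | _ => 0 end.

Definition rate (p : \bar R) (s : R) (N : nat) : R :=
  if (p < 4%:E)%E then powR N%:R (1/4 - s)
  else if p == 4%:E then powR N%:R (1/4 - s) * powR (ln N%:R) (1/4)
  else powR N%:R (1/2 - invp p - s).

End Defs.

(* Main.v *)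
(** Write [X] for the least integer with [N <= X ^ 2], so that the tail runs over
    [n >= X].

    Upper bounds.  Let [P] be a block of the series with [n ^ (- 2 s)] replaced
    by a tent-shaped weight of height and width about [l].  Weyl differencing
    and two summations by parts bound [|P| ^ 2] by
    [sum_h min (l ^ 3, l / |1 - e (2 h x)| ^ 2)], and a pigeonhole argument shows
    that this is [O (l ^ 3 T)] unless [x] is within [1 / (8 l T q)] of a fraction
    [a / q] with [q T <= 4 l].  These arcs have total length [O (T ^ -2)],
    uniformly in [l].  Summing over the dyadic levels of [T] bounds every moment
    of [P]; at [p = 4] all the levels contribute equally, whence the logarithm.
    A ramp of length [2 l] is twice a ramp of length [l] plus a tent, so tents
    give ramps, then sharp cut-offs; Abel summation restores the coefficients,
    the dyadic blocks are summed geometrically, and Fatou's lemma passes to the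
    limit.

    Lower bounds.  By Parseval the second moment of a block is known, which for
    [p < 4] is interpolated against a higher moment.  For [p = 4] the fourth
    moment counts the solutions of [a^2 + b^2 = c^2 + d^2], and these are
    numerous enough because the sum of [gcd (u, v)] over [X < u, v <= 2 X] is at
    least of order [X^2 log X].  For [p > 4] the second moment is taken with
    respect to a Fejer kernel of degree about [X^2]. *)

Require Import Defs.
From HB Require Import structures.
From mathcomp Require Import all_boot all_order all_algebra.
From mathcomp Require Import all_classical all_reals all_analysis.
From mathcomp Require Import ess_sup_inf measurable_realfun complex ring lra zify.
Import Order.TTheory GRing.Theory Num.Theory.
Import numFieldNormedType.Exports.
Local Open Scope classical_set_scope.
Local Open Scope ring_scope.

Set Implicit Arguments.
Unset Strict Implicit.
Unset Printing Implicit Defensive.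

(** The weights are tents because two summations by parts then give decay like the inverse square of
    the distance from [2 h x] to the integers, which is summable over bins of length [1 / (8 l)].
    With a sharp cut-off only one summation by parts is available, and its harmonic sum over the
    bins would cost a logarithm in every range of [p]. Returning from tents to sharp cut-offs loses
    only a constant, because the expected norm of a block grows by a fixed factor greater than [1]
    whenever its length doubles.

    For [p < 1] the triangle inequality fails. Upper bounds are therefore proved for [1 <= p], and
    every exponent below [3] inherits the bound at [3], where the rate is the same. The tail is
    built once, as an almost everywhere limit controlled in [L^1], hence independently of [p]; lower
    bounds pass from partial sums to the tail by a quasi-triangle inequality for [r]-th powers.

    For [p > 4] the norm is large because all the phases nearly agree within distance about [X ^ -2]
    of [0]; the Fejer weight isolates that neighbourhood. *)

(** * Rational approximation by pigeonhole *)

Section RationalApproximation.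
Variable R : realType.
Implicit Types x : R.

Lemma dist_nat_lt1 (m n : nat) : `|m%:R - n%:R : R| < 1 -> m = n.
Proof.
move=> h; have : (`|(m%:Z - n%:Z)%:~R : R| < 1).
  by rewrite rmorphB /= -!pmulrn.
by rewrite -intr_norm (_ : 1 = 1%:~R) // ltr_int; lia.
Qed.

(** Cross-multiplying two of the fractions [b d / d] gives integers that differ by less than
    [(d + d') / Q <= 1], so all the fractions equal one reduced [a / q]. Then [q] divides every [d],
    and the largest of [T] distinct positive multiples of [q] is at least [T q]; that [d] gives the
    stated quality of approximation. *)
Lemma common_fraction x (Q M T : nat) (D : seq nat) (b : nat -> nat) :
  0 <= x <= 1 -> (2 * M <= Q)%N -> (0 < T)%N -> (T <= size D)%N -> uniq D ->
  (forall d, d \in D -> 0 < d < M)%N ->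
  (forall d, d \in D -> `|d%:R * x - (b d)%:R| < Q%:R^-1) ->
  exists q a : nat, [/\ (0 < q)%N, (a <= q)%N, (q * T <= M)%N &
    `|x - a%:R / q%:R| <= (Q%:R * T%:R * q%:R)^-1].
Proof.
move=> /andP[x0 x1] MQ T0 TD uD D0 Db.
have cross d d' : d \in D -> d' \in D -> (b d * d' = b d' * d)%N.
  move=> dD d'D; apply: dist_nat_lt1.
  have /andP[d0 dM] := D0 _ dD; have /andP[d'0 d'M] := D0 _ d'D.
  have Q0 : 0 < Q%:R :> R by rewrite ltr0n; lia.
  have -> : (b d * d')%:R - (b d' * d)%:R
     = d%:R * (d'%:R * x - (b d')%:R) - d'%:R * (d%:R * x - (b d)%:R) :> R.
    by rewrite !natrM; ring.
  apply: le_lt_trans (ler_normB _ _) _; rewrite !normrM !normr_nat.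
  apply: (@lt_le_trans _ _ (d%:R * Q%:R^-1 + d'%:R * Q%:R^-1)).
    by apply: ltrD; rewrite ltr_pM2l ?ltr0n //; apply: Db.
  rewrite -mulrDl ler_pdivrMr // mul1r -natrD ler_nat; lia.
case: D TD uD D0 Db cross => [|d0 D']; first by rewrite leqn0 => /eqP T0'; rewrite T0' in T0.
set D := d0 :: D' => TD uD D0 Db cross.
have d0D : d0 \in D by rewrite mem_head.
have /andP[d00 d0M] := D0 _ d0D.
pose g := gcdn d0 (b d0); pose q := (d0 %/ g)%N; pose a := (b d0 %/ g)%N.
have g0 : (0 < g)%N by rewrite gcdn_gt0 d00.
have dE : d0 = (q * g)%N by rewrite divnK // dvdn_gcdl.
have bE : b d0 = (a * g)%N by rewrite divnK // dvdn_gcdr.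
have q0 : (0 < q)%N by rewrite divn_gt0 // dvdn_leq // dvdn_gcdl.
have cqa : coprime q a.
  by rewrite /coprime -(eqn_pmul2r g0) muln_gcdl mul1n -dE -bE.
have bq d : d \in D -> (b d * q = a * d)%N.
  move=> dD; have := cross _ _ dD d0D; rewrite [in LHS]dE bE => h.
  by apply/eqP; rewrite -(eqn_pmul2r g0); apply/eqP; rewrite -mulnA h mulnAC.
have qd d : d \in D -> (q %| d)%N.
  by move=> dD; rewrite -(Gauss_dvdr _ cqa) -(bq _ dD) dvdn_mull.
have [d1 d1D d1T] : exists2 d, d \in D & (T * q <= d)%N.
  apply: contrapT => /forall2NP h.
  have lt d : d \in D -> (d < T * q)%N.
    by move=> dD; have [//|/negP] := h d; rewrite -ltnNge.
  suff : (size D <= T.-1)%N by lia.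
  rewrite -(size_map (fun d => d %/ q)%N) -(size_iota 1 T.-1).
  apply: uniq_leq_size.
    rewrite map_inj_in_uniq // => u v uD' vD' huv.
    by rewrite -(divnK (qd _ uD')) -(divnK (qd _ vD')) huv.
  move=> _ /mapP[d dD ->]; rewrite mem_iota.
  have /andP[dp _] := D0 _ dD; have := lt _ dD.
  have := divnK (qd _ dD); set e := (d %/ q)%N => ee.
  rewrite -ee ltn_mul2r q0 /= => eT.
  have : (0 < e)%N by move: dp; rewrite -ee muln_gt0 => /andP[].
  by lia.
have /andP[d10 d1M] := D0 _ d1D.
have Q0 : 0 < Q%:R :> R by rewrite ltr0n; lia.
have qR : 0 < q%:R :> R by rewrite ltr0n.
have d1R : 0 < d1%:R :> R by rewrite ltr0n.
have TR : 0 < T%:R :> R by rewrite ltr0n.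
have frac : a%:R / q%:R = (b d1)%:R / d1%:R :> R.
  apply/eqP; rewrite eqr_div ?lt0r_neq0 //.
  by rewrite -!natrM eqr_nat -(bq _ d1D) mulnC.
have main : `|x - a%:R / q%:R| <= (Q%:R * T%:R * q%:R)^-1.
  have -> : x - a%:R / q%:R = (d1%:R * x - (b d1)%:R) / d1%:R.
    by rewrite frac; field; rewrite gt_eqF.
  rewrite normrM normfV normr_nat -mulrA invfM.
  apply: ler_pM => //.
    by apply/ltW/Db.
  by rewrite lef_pV2 ?posrE ?mulr_gt0 // -natrM ler_nat.
exists q, a; split=> //; last by rewrite mulnC (leq_trans d1T) // ltnW.
(* If [a > q], then [a / q] exceeds [1] by at least [1 / q], more than the error just bounded. *)
rewrite leqNgt; apply/negP => aq.
have : a%:R / q%:R - x <= (Q%:R * T%:R * q%:R)^-1.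
  by rewrite (le_trans _ main) // distrC ler_norm.
have h1 : (q%:R + 1) / q%:R <= a%:R / q%:R :> R.
  by rewrite ler_pM2r ?invr_gt0 // natr1 ler_nat.
have h2 : (Q%:R * T%:R * q%:R)^-1 < q%:R^-1 :> R.
  rewrite ltf_pV2 ?posrE ?mulr_gt0 // -natrM -natrM ltr_nat.
  have : (1 < Q)%N by move: d00 d0M MQ; clear; lia.
  by move=> Q1; rewrite -{1}(mul1n q) ltn_mul2r q0 (leq_trans Q1) // leq_pmulr.
have h3 : (q%:R + 1) / q%:R = 1 + q%:R^-1 :> R by field; rewrite gt_eqF.
by move: h1 h2 x1; rewrite h3; clear; set u := _^-1; set v := _^-1; set w := _ / _; lra.
Qed.

(** Subtracting the least element [h0] turns more than [T] multiples of [x] in one bin into at least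
    [T] positive differences whose multiples of [x] lie within [1 / Q] of an integer. *)
Lemma same_bin_fraction x (Q M T : nat) (k : R) (H : seq nat) (c : nat -> nat) :
  0 <= x <= 1 -> (2 * M <= Q)%N -> (0 < T)%N -> (T < size H)%N -> uniq H ->
  (forall h, h \in H -> h < M)%N ->
  (forall h, h \in H ->
     (c h)%:R + k / Q%:R <= h%:R * x < (c h)%:R + (k + 1) / Q%:R) ->
  exists q a : nat, [/\ (0 < q)%N, (a <= q)%N, (q * T <= M)%N &
    `|x - a%:R / q%:R| <= (Q%:R * T%:R * q%:R)^-1].
Proof.
move=> x01 MQ T0 TH uH HM Hc.
have M0 : (0 < M)%N.
  case: H TH HM {uH Hc} => // h H _ HM.
  by rewrite (leq_trans _ (HM h (mem_head _ _))).
have Q0 : 0 < Q%:R :> R by rewrite ltr0n; lia.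
have Q1 : Q%:R^-1 <= 1 :> R by rewrite invf_le1 // ler1n; lia.
pose h0 := head 0%N (sort leq H).
have h0H : h0 \in H.
  rewrite -(mem_sort leq) /h0 -nth0 mem_nth // size_sort.
  exact: leq_ltn_trans TH.
have h0min h : h \in H -> (h0 <= h)%N.
  rewrite -(mem_sort leq) /h0; have := sort_sorted leq_total H.
  case: (sort leq H) => //= y s ys; rewrite inE => /predU1P[-> //|hs].
  by move: ys; rewrite path_sortedE; [move=> /andP[/allP/(_ _ hs)]|exact: leq_trans].
pose D := [seq (h - h0)%N | h <- rem h0 H].
have remP h : h \in rem h0 H -> (h \in H) /\ (h0 < h)%N.
  rewrite mem_rem_uniq // inE => /andP[hh0 hH]; split=> //.
  by rewrite ltn_neqAle eq_sym hh0 h0min.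
apply: (@common_fraction x Q M T D (fun d => c (d + h0) - c h0)%N) => //.
- by rewrite size_map size_rem // -ltnS (ltn_predK TH).
- rewrite map_inj_in_uniq ?rem_uniq // => u v /remP[_ u0] /remP[_ v0]; lia.
- by move=> d /mapP[h /remP[hH h0h] ->]; have := HM _ hH; lia.
- move=> d /mapP[h /remP[hH h0h] ->]; rewrite subnK ?(ltnW h0h) //.
  have /andP[l1 u1] := Hc _ hH; have /andP[l0 u0] := Hc _ h0H.
  have kE : (k + 1) / Q%:R = k / Q%:R + Q%:R^-1 by rewrite mulrDl mul1r.
  have x0 : 0 <= x by case/andP: x01.
  have hx : h0%:R * x <= h%:R * x by rewrite ler_wpM2r // ler_nat ltnW.
  have cc : (c h0 <= c h)%N.
    rewrite -ltnS -(ltr_nat R) -natr1; rewrite kE in u1; lra.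
  rewrite !natrB ?(ltnW h0h) // ltr_norml mulrBl; rewrite !kE in u0 u1.
  by apply/andP; split; lra.
Qed.

End RationalApproximation.

Local Open Scope complex_scope.

(** * The modulus and the characters *)

Section ComplexModulus.
Variable R : realType.
Implicit Types (z w : R[i]) (t x : R).

(** Real-valued, unlike the norm of [R[i]], and written with [cmod] so that [LpT] of the two parts
    of a function is by definition the norm of its modulus. *)
Definition modc z : R := cmod (complex.Re z) (complex.Im z).

Lemma modcE z : modc z = Normc.normc z. Proof. by case: z. Qed.

Lemma modc_ge0 z : 0 <= modc z. Proof. exact: sqrtr_ge0. Qed.

Lemma modcM z w : modc (z * w) = modc z * modc w.
Proof. by rewrite !modcE Normc.normcM. Qed.

Lemma modcD z w : modc (z + w) <= modc z + modc w.
Proof. by rewrite !modcE le_normcD. Qed.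

Lemma modcN z : modc (- z) = modc z.
Proof. by rewrite !modcE normcN. Qed.

Lemma modcB z w : modc (z - w) <= modc z + modc w.
Proof. by rewrite (le_trans (modcD _ _)) // modcN. Qed.

Lemma modc_real t : modc t%:C = `|t|.
Proof. by rewrite /modc /cmod /= expr0n addr0 sqrtr_sqr. Qed.

Lemma modc0 : modc 0 = 0. Proof. by rewrite modc_real normr0. Qed.

Lemma modc1 : modc 1 = 1. Proof. by rewrite modc_real normr1. Qed.

Lemma modcX z n : modc (z ^+ n) = modc z ^+ n.
Proof. by elim: n => [|n IH]; rewrite ?expr0 ?modc1 // !exprS modcM IH. Qed.

Lemma sqr_modc z : modc z ^+ 2 = complex.Re z ^+ 2 + complex.Im z ^+ 2.
Proof. by rewrite sqr_sqrtr // addr_ge0 ?sqr_ge0. Qed.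

Lemma Re_le_modc z : `|complex.Re z| <= modc z.
Proof. by rewrite -sqrtr_sqr ler_wsqrtr // lerDl sqr_ge0. Qed.

Lemma modc_sum I (s : seq I) (P : pred I) (F : I -> R[i]) :
  modc (\sum_(i <- s | P i) F i) <= \sum_(i <- s | P i) modc (F i).
Proof.
elim/big_ind2: _ => [|z a w b za wb|//]; first by rewrite modc0.
by rewrite (le_trans (modcD _ _)) // lerD.
Qed.

Lemma modc_conj z : modc (conjc z) = modc z.
Proof. by case: z => a b; rewrite /modc /cmod /= sqrrN. Qed.

Lemma ReB z w : complex.Re (z - w) = complex.Re z - complex.Re w.
Proof. by case: z w => [a b] [c d]. Qed.

Lemma ReD z w : complex.Re (z + w) = complex.Re z + complex.Re w.
Proof. by case: z w => [a b] [c d]. Qed.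

Lemma ImD z w : complex.Im (z + w) = complex.Im z + complex.Im w.
Proof. by case: z w => [a b] [c d]. Qed.

Lemma sqr_modcD z w :
  modc (z + w) ^+ 2 = modc z ^+ 2 + modc w ^+ 2 + 2 * complex.Re (w * conjc z).
Proof. by rewrite !sqr_modc; case: z w => [a b] [c d] /=; ring. Qed.

Lemma conjcM z w : conjc (z * w) = conjc z * conjc w.
Proof. exact: (rmorphM (@conjc R : {rmorphism R[i] -> R[i]})). Qed.

Lemma conjc_sum I (s : seq I) (P : pred I) (F : I -> R[i]) :
  conjc (\sum_(i <- s | P i) F i) = \sum_(i <- s | P i) conjc (F i).
Proof. exact: (raddf_sum (@conjc R : {additive R[i] -> R[i]})). Qed.

Definition expi t : R[i] := cos (2 * pi * t) +i* sin (2 * pi * t).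

Lemma expiD t x : expi (t + x) = expi t * expi x.
Proof.
by rewrite /expi mulrDr cosD sinD; apply/eqP; rewrite eq_complex /=; apply/andP; split; apply/eqP;
  ring.
Qed.

Lemma expi0 : expi 0 = 1.
Proof. by rewrite /expi mulr0 cos0 sin0. Qed.

Lemma expi_nat n : expi n%:R = 1.
Proof.
elim: n => [|n IH]; first exact: expi0.
rewrite -natr1 expiD IH mul1r /expi mulr1 mulr_natl cos2pi sin2pi //.
Qed.

Lemma expi_muln n t : expi (n%:R * t) = expi t ^+ n.
Proof.
elim: n => [|n IH]; first by rewrite mul0r expi0.
by rewrite -natr1 mulrDl mul1r expiD IH exprSr.
Qed.

Lemma modc_expi t : modc (expi t) = 1.
Proof.
by rewrite /modc /cmod /= cos2Dsin2 sqrtr1.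
Qed.

Lemma modc_rot t z : modc (expi t * z) = modc z.
Proof. by rewrite modcM modc_expi mul1r. Qed.

Lemma expi_conj t : conjc (expi t) = expi (- t).
Proof. by rewrite /expi /= mulrN cosN sinN. Qed.

Lemma modc_subX_le z n : modc z = 1 -> modc (1 - z ^+ n) <= n%:R * modc (1 - z).
Proof.
move=> z1; elim: n => [|n IH]; first by rewrite expr0 subrr modc0 mul0r.
have -> : 1 - z ^+ n.+1 = (1 - z ^+ n) + z ^+ n * (1 - z) by rewrite exprSr; ring.
rewrite (le_trans (modcD _ _)) // modcM modcX z1 expr1n mul1r -natr1 mulrDl mul1r.
by rewrite lerD2r.
Qed.

(* If [y] is tiny, some multiple [m * y] lies in [[1/4, 1/2]], where
   [1 - expi (m * y)] has modulus at least [sqrt 2]. *)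
Lemma modc_1Bexpi_ge_half y : 0 <= y <= 2^-1 ->
  8 * y ^+ 2 <= modc (1 - expi y) ^+ 2.
Proof.
move=> /andP[]; rewrite le_eqVlt => /predU1P[<- _|y0 y2].
  by rewrite expr0n mulr0 sqr_ge0.
pose m := Num.truncn (2 * y)^-1.
have y20 : 0 < (2 * y)^-1 by rewrite invr_gt0 mulr_gt0.
have /andP[mle mgt] := truncn_itv (ltW y20).
have m1 : (0 < m)%N.
  by rewrite truncn_gt0 invf_ge1 ?mulr_gt0 // -ler_pdivlMl ?mulr1.
have my : m%:R * y <= 2^-1.
  by move: mle; rewrite -/m -[leRHS]div1r ler_pdivlMr ?mulr_gt0 //; lra.
have my1 : 2^-1 < m%:R * y + y.
  by move: mgt; rewrite -/m -[ltLHS]div1r ltr_pdivrMr ?mulr_gt0 // -natr1; lra.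
have y_my : y <= m%:R * y by rewrite ler_peMl ?ler1n // ltW.
have c0 : cos (2 * pi * (m%:R * y)) <= 0.
  have := sin_ge0_pi (x := 2 * pi * (m%:R * y) - pi / 2).
  rewrite sinBpihalf oppr_ge0; apply.
  have := pi_ge0 R; set P := pi; set u := m%:R * y.
  have u1 : 4^-1 <= u by rewrite /u; lra.
  have u2 : u <= 2^-1 by [].
  move=> P0.
  have h1 : P * 4^-1 <= P * u by rewrite ler_wpM2l.
  have h2 : P * u <= P * 2^-1 by rewrite ler_wpM2l.
  by rewrite -!mulrA; apply/andP; split; lra.
have h2 : 2 <= modc (1 - expi (m%:R * y)) ^+ 2.
  rewrite sqr_modc /=; set c := cos _; set s := sin _.
  have cs : c ^+ 2 + s ^+ 2 = 1 by rewrite cos2Dsin2.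
  have -> : (1 - c) ^+ 2 + (0 - s) ^+ 2 = 1 - 2 * c + (c ^+ 2 + s ^+ 2) by ring.
  by rewrite cs; move: c0; rewrite -/c; lra.
have h3 : modc (1 - expi (m%:R * y)) ^+ 2 <= m%:R ^+ 2 * modc (1 - expi y) ^+ 2.
  rewrite -exprMn lerXn2r ?nnegrE ?mulr_ge0 ?modc_ge0 //.
  by rewrite expi_muln modc_subX_le // modc_expi.
have h4 : (m%:R * y) ^+ 2 <= 4^-1.
  rewrite (_ : 4^-1 = 2^-1 ^+ 2); last by rewrite exprVn; congr (_^-1); ring.
  by rewrite lerXn2r ?nnegrE ?mulr_ge0 // ltW.
have m0 : 0 < m%:R ^+ 2 :> R by rewrite exprn_gt0 // ltr0n.
rewrite -(ler_pM2l m0); move: h2 h3 h4; rewrite exprMn; lra.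
Qed.

Lemma modc_1BexpiN t : modc (1 - expi (1 - t)) = modc (1 - expi t).
Proof.
rewrite expiD (expi_nat 1) mul1r -expi_conj -[in RHS]modc_conj; congr modc.
by apply/eqP; rewrite eq_complex /=; apply/andP; split; apply/eqP; ring.
Qed.

Lemma modc_1Bexpi_ge_dist y d : 0 <= d -> d <= y -> d <= 1 - y ->
  8 * d ^+ 2 <= modc (1 - expi y) ^+ 2.
Proof.
move=> d0 dy d1y; have [y2|/ltW y2] := leP y 2^-1.
  apply: le_trans (modc_1Bexpi_ge_half _); last by lra.
  by rewrite ler_pM2l // lerXn2r ?nnegrE //; lra.
rewrite -modc_1BexpiN; apply: le_trans (modc_1Bexpi_ge_half _); last by lra.
by rewrite ler_pM2l // lerXn2r ?nnegrE //; lra.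
Qed.

End ComplexModulus.

(** * Weyl differencing and summation by parts *)

Section WeylDifferencing.
Variable R : realType.

(** The pairs [i < j] are arranged by their lag [h = j - i]; the pairs gained in passing from [L] to
    [L.+1] are the [(L, i)]. *)
Lemma sum_lag_recr (V : zmodType) (F : nat -> nat -> V) L :
  \sum_(1 <= h < L.+1) \sum_(0 <= i < L.+1 - h) F (i + h)%N i =
  \sum_(1 <= h < L) \sum_(0 <= i < L - h) F (i + h)%N i + \sum_(0 <= i < L) F L i.
Proof.
have -> : \sum_(1 <= h < L.+1) \sum_(0 <= i < L.+1 - h) F (i + h)%N i =
   \sum_(1 <= h < L.+1) (\sum_(0 <= i < L - h) F (i + h)%N i + F L (L - h)%N).
  apply: eq_big_nat => h /andP[h1 hL].
  by rewrite subSn // big_nat_recr //= subnK.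
rewrite big_split /=; congr (_ + _).
  case: L => [|L]; first by rewrite !big_geq.
  by rewrite big_nat_recr //= subnn (big_geq (leqnn 0)) addr0.
rewrite big_nat_rev /= big_add1 /=; apply: eq_big_nat => i /andP[_ iL].
by congr F; lia.
Qed.

Lemma sqr_modc_sum (z : nat -> R[i]) L :
  modc (\sum_(0 <= i < L) z i) ^+ 2 = \sum_(0 <= i < L) modc (z i) ^+ 2 +
  2 * complex.Re (\sum_(1 <= h < L) \sum_(0 <= i < L - h) z (i + h)%N * conjc (z i)).
Proof.
elim: L => [|L IH].
  by rewrite !big_geq // modc0 expr0n mulr0 addr0.
rewrite big_nat_recr //= sqr_modcD IH (sum_lag_recr (fun j i => z j * conjc (z i))).
rewrite conjc_sum mulr_sumr ReD [X in _ = X + _]big_nat_recr //=; ring.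
Qed.

Lemma weyl_differencing (z : nat -> R[i]) L :
  modc (\sum_(0 <= i < L) z i) ^+ 2 <= \sum_(0 <= i < L) modc (z i) ^+ 2 +
  2 * \sum_(1 <= h < L) modc (\sum_(0 <= i < L - h) z (i + h)%N * conjc (z i)).
Proof.
rewrite sqr_modc_sum lerD2l ler_pM2l //.
by rewrite (le_trans (ler_norm _)) // (le_trans (Re_le_modc _)) // modc_sum.
Qed.

Lemma abel_diff (C : comNzRingType) (g : nat -> C) (z : C) K :
  (1 - z) * \sum_(0 <= i < K) g i * z ^+ i =
  g 0%N - g K * z ^+ K + z * \sum_(0 <= i < K) (g i.+1 - g i) * z ^+ i.
Proof.
elim: K => [|K IH]; first by rewrite !big_geq // expr0; ring.
by rewrite !big_nat_recr //= mulrDr IH mulrDr exprS; ring.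
Qed.

(** The three vanishing values remove every boundary term of two applications of [abel_diff], except
    the first difference at [0], which is [g 1]. *)
Lemma abel_diff2 (g : nat -> R) (z : R[i]) K :
  modc z = 1 -> g 0%N = 0 -> g K = 0 -> g K.+1 = 0 ->
  modc (1 - z) ^+ 2 * modc (\sum_(0 <= i < K) (g i)%:C * z ^+ i) <=
  `|g 1%N| + \sum_(0 <= i < K) `|g i.+2 - 2 * g i.+1 + g i|.
Proof.
move=> z1 g0 gK gK1.
rewrite expr2 -mulrA -modcM abel_diff g0 gK mul0r subr0 add0r modcM z1 mul1r.
have -> : \sum_(0 <= i < K) ((g i.+1)%:C - (g i)%:C) * z ^+ i =
          \sum_(0 <= i < K) (fun i => (g i.+1)%:C - (g i)%:C) i * z ^+ i by [].
rewrite -modcM abel_diff g0 gK gK1 !subr0 mul0r subr0.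
rewrite (le_trans (modcD _ _)) // modc_real lerD2l modcM z1 mul1r.
rewrite (le_trans (modc_sum _ _ _)) // ler_sum // => i _.
rewrite modcM modcX z1 expr1n mulr1 -!rmorphB /= modc_real le_eqVlt.
by apply/orP; left; apply/eqP; congr (`| _ |); ring.
Qed.

End WeylDifferencing.

(** * Pointwise bounds for tent sums off the major arcs *)

Section TentSums.
Variable R : realType.
Implicit Types (x : R) (l A T : nat).

Definition tent l i : nat := minn i (2 * l - i).

(** [4 * l] bounds the differenced frequencies [2 h], and [8 * l] is the number of bins for their
    fractional parts; they play [M] and [Q] in [same_bin_fraction]. *)
Definition major_arc l T x := exists q a : nat,
  [/\ (0 < q)%N, (a <= q)%N, (q * T <= 4 * l)%N &
      `|x - a%:R / q%:R| <= ((8 * l)%:R * T%:R * q%:R)^-1].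

Lemma tent_le l i : (tent l i <= l)%N.
Proof. by rewrite /tent; lia. Qed.

Lemma tent_diff1 l i : `|(tent l i.+1)%:R - (tent l i)%:R : R| <= 1.
Proof.
have h1 : (tent l i.+1 <= tent l i + 1)%N by rewrite /tent; lia.
have h2 : (tent l i <= tent l i.+1 + 1)%N by rewrite /tent; lia.
rewrite -(ler_nat R) natrD in h1; rewrite -(ler_nat R) natrD in h2.
by rewrite ler_norml; apply/andP; split; lra.
Qed.

(** The exceptional indices are the left neighbours of the kinks: the peak at [l], where the slope
    drops by [2], and the foot at [2 * l]. The foot at [0] is never the middle index. *)
Lemma tent_diff2 l i : (0 < l)%N ->
  `|(tent l i.+2)%:R - 2 * (tent l i.+1)%:R + (tent l i)%:R : R| <=
  (i == l.-1)%:R * 2 + (i == (2 * l).-1)%:R.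
Proof.
move=> l0; have [->|il] := eqVneq i l.-1.
  have -> : tent l l.-1.+2 = l.-1 by rewrite /tent; lia.
  have -> : tent l l.-1.+1 = l.-1.+1 by rewrite /tent; lia.
  have -> : tent l l.-1 = l.-1 by rewrite /tent; lia.
  have -> : l.-1 == (2 * l).-1 = false by apply/eqP; lia.
  by rewrite -natr1 ler_norml; apply/andP; split; rewrite /=; lra.
have [->|il2] := eqVneq i (2 * l).-1.
  have -> : tent l (2 * l).-1.+2 = 0%N by rewrite /tent; lia.
  have -> : tent l (2 * l).-1.+1 = 0%N by rewrite /tent; lia.
  have -> : tent l (2 * l).-1 = 1%N by rewrite /tent; lia.
  by rewrite ler_norml; apply/andP; split; rewrite /=; lra.
have : (tent l i.+2 + tent l i = 2 * tent l i.+1)%N.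
  by move/eqP: il; move/eqP: il2; rewrite /tent; lia.
move=> /(congr1 (fun n => n%:R : R)); rewrite natrD natrM => e.
by rewrite ler_norml; apply/andP; split; rewrite /=; lra.
Qed.

(** Leibniz rule for second differences; the two products of first differences give the [2]. *)
Lemma prod_diff2 (u v : nat -> R) (l : R) i (a b : R) : 0 <= l ->
  (forall i, `|u i| <= l) -> (forall i, `|v i| <= l) ->
  (forall i, `|u i.+1 - u i| <= 1) -> (forall i, `|v i.+1 - v i| <= 1) ->
  `|u i.+2 - 2 * u i.+1 + u i| <= a -> `|v i.+2 - 2 * v i.+1 + v i| <= b ->
  `|u i.+2 * v i.+2 - 2 * (u i.+1 * v i.+1) + u i * v i| <= l * a + l * b + 2.
Proof.
move=> l0 ul vl u1 v1 ua vb.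
have -> : u i.+2 * v i.+2 - 2 * (u i.+1 * v i.+1) + u i * v i =
   (v i.+1 * (u i.+2 - 2 * u i.+1 + u i) + u i.+1 * (v i.+2 - 2 * v i.+1 + v i))
   + ((u i.+2 - u i.+1) * (v i.+2 - v i.+1) + (u i.+1 - u i) * (v i.+1 - v i)).
  by ring.
rewrite (le_trans (ler_normD _ _)) // lerD //.
  by rewrite (le_trans (ler_normD _ _)) // lerD // normrM ler_pM.
have -> : 2 = 1 * 1 + 1 * 1 :> R by ring.
by rewrite (le_trans (ler_normD _ _)) // lerD // normrM ler_pM.
Qed.

Lemma sum_delta_le1 K (f : nat -> nat) c : injective f ->
  \sum_(0 <= i < K) (f i == c)%:R <= 1 :> R.
Proof.
move=> finj; rewrite -natr_sum -[leRHS]/(1%:R) ler_nat big_mkord.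
have [/existsP[j /eqP jc]|/existsPn no] := boolP [exists j : 'I_K, f j == c].
  rewrite (bigD1 j) //= jc eqxx big1 // => i ij.
  by apply/eqP; rewrite eqb0 -jc; apply: contraNN ij => /eqP/finj/val_inj ->.
by rewrite big1 // => i _; apply/eqP; rewrite eqb0 no.
Qed.

(** The first bound is the trivial one. In the second, [11] is [1] for [g 1], [3] for the kinks of
    each of the two tents, and [4] for the mixed terms, which are at most [2] at each of at most
    [2 l] indices. *)
Lemma lag_bound l h z : (0 < l)%N -> (0 < h < 2 * l)%N -> modc z = 1 ->
  let g i : R := (tent l i)%:R * (tent l (i + h))%:R in
  let M := modc (\sum_(0 <= i < 2 * l - h) (g i)%:C * z ^+ i) in
  M <= 2 * l%:R ^+ 3 /\ modc (1 - z) ^+ 2 * M <= 11 * l%:R.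
Proof.
move=> l0 /andP[h0 hl] z1 g M.
have lR : 0 <= l%:R :> R by [].
have wl i : `|(tent l i)%:R : R| <= l%:R by rewrite normr_nat ler_nat tent_le.
split.
  rewrite /M (le_trans (modc_sum _ _ _)) //.
  apply: (@le_trans _ _ (\sum_(0 <= i < 2 * l - h) l%:R ^+ 2)).
    apply: ler_sum => i _; rewrite modcM modcX z1 expr1n mulr1 modc_real normrM.
    by rewrite expr2 ler_pM.
  have -> : 2 * l%:R ^+ 3 = l%:R ^+ 2 * (2 * l%:R) :> R by ring.
  rewrite sumr_const_nat subn0 -[leLHS]mulr_natr ler_wpM2l ?sqr_ge0 //.
  by rewrite -natrM ler_nat; lia.
rewrite /M; apply: le_trans (abel_diff2 _ _ _ _) _ => //.
- by rewrite /g /tent min0n mul0r.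
- by rewrite /g subnK ?(ltnW hl) // {2}/tent subnn minn0 mulr0.
- rewrite /g (_ : tent l (_ + h) = 0%N) ?mulr0 //.
  by rewrite /tent; lia.
have g1 : `|g 1%N| <= l%:R.
  rewrite /g normrM -[leRHS]mul1r ler_pM // normr_nat.
  by rewrite -[leRHS]/(1%:R) ler_nat /tent; lia.
pose d i : R := (i == l.-1)%:R * 2 + (i == (2 * l).-1)%:R.
have step i : `|g i.+2 - 2 * g i.+1 + g i| <= l%:R * d i + l%:R * d (i + h)%N + 2.
  apply: (@prod_diff2 (fun i => (tent l i)%:R) (fun i => (tent l (i + h))%:R) l%:R i
    (d i) (d (i + h)%N)) => // => [j|j||].
  - exact: tent_diff1.
  - exact: tent_diff1.
  - exact: tent_diff2.
  - exact: tent_diff2.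
have dsum (f : nat -> nat) K : injective f -> \sum_(0 <= i < K) d (f i) <= 3.
  move=> finj; rewrite big_split /= -mulr_suml.
  have := sum_delta_le1 K l.-1 finj; have := sum_delta_le1 K (2 * l).-1 finj.
  by lra.
have : \sum_(0 <= i < 2 * l - h) `|g i.+2 - 2 * g i.+1 + g i| <= 3 * l%:R + 3 * l%:R + 4 * l%:R.
  apply: (@le_trans _ _ (\sum_(0 <= i < 2 * l - h) (l%:R * d i + l%:R * d (i + h)%N + 2))).
    exact: ler_sum.
  rewrite !big_split /= -!mulr_sumr lerD // ?lerD //.
  - by rewrite mulrC ler_wpM2r // (dsum id).
  - by rewrite mulrC ler_wpM2r // (dsum (addn^~ h)) //; exact: addIn.
  - by rewrite sumr_const_nat subn0 -natrD -natrM ler_nat; lia.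
by move: g1; lra.
Qed.

(** The value [1] at [0] stands for the trivial bound in the bins next to an integer. *)
Definition invsq (k : nat) : R := ((maxn 1 k)%:R ^+ 2)^-1.

Lemma invsq_ge0 k : 0 <= invsq k. Proof. by rewrite invr_ge0 sqr_ge0. Qed.

Lemma sum_invsq n : \sum_(0 <= k < n) invsq k <= 3.
Proof.
case: n => [|n]; first by rewrite big_geq.
suff : \sum_(0 <= k < n.+1) invsq k <= 3 - (maxn 1 n)%:R^-1.
  by move=> h; rewrite (le_trans h) // gerBl invr_ge0.
elim: n => [|[|n] IH].
- by rewrite big_nat1 /invsq /= expr1n invr1; lra.
- by rewrite !big_nat_recr // big_geq //= /invsq /= expr1n invr1; lra.
rewrite big_nat_recr //= (le_trans (lerD IH (lexx _))) //.
have e1 : maxn 1 n.+1 = n.+1 by apply/maxn_idPr.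
have e2 : maxn 1 n.+2 = n.+2 by apply/maxn_idPr.
rewrite /invsq e1 e2.
have n0 : 0 < n.+1%:R :> R by rewrite ltr0n.
rewrite -(@natr1 _ n.+1); set u := n.+1%:R : R in n0 *.
suff : (u + 1) ^- 2 <= u^-1 - (u + 1)^-1.
  by move: (u^-1) ((u + 1)^-1) ((u + 1) ^- 2) => a b c; lra.
have -> : u^-1 - (u + 1)^-1 = (u * (u + 1))^-1 by field; rewrite !lt0r_neq0 //; lra.
rewrite lef_pV2 ?posrE ?mulr_gt0 ?exprn_gt0 //; try lra.
Qed.

(** [k] numbers the bin of the fractional part of [2 h x], and [minn k (8 l - k.+1)] whole bins
    separate that bin from the integers. Adding the two [invsq] instead of taking this minimum lets
    the bins be summed from either end. The constant is [88 = 11 * 8 ^ 2 / 8]. *)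
Lemma lag_bin_bound l h x : (0 < l)%N -> (0 < h < 2 * l)%N -> 0 <= x ->
  let k := Num.truncn ((8 * l)%:R * ((2 * h)%:R * x - (Num.truncn ((2 * h)%:R * x))%:R)) in
  let M := modc (\sum_(0 <= i < 2 * l - h)
     ((tent l i)%:R * (tent l (i + h))%:R : R)%:C * expi ((2 * h)%:R * x) ^+ i) in
  (k < 8 * l)%N /\ M <= 88 * l%:R ^+ 3 * (invsq k + invsq (8 * l - k.+1)).
Proof.
move=> l0 hl x0; set c := Num.truncn (_ * x); set y := _ - c%:R; move=> k M.
have hx0 : 0 <= (2 * h)%:R * x by rewrite mulr_ge0.
have /andP[cle cgt] := truncn_itv hx0; rewrite -/c -natr1 in cle cgt.
have y0 : 0 <= y by rewrite subr_ge0.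
have y1 : y < 1 by rewrite /y; lra.
have Q0 : 0 < (8 * l)%:R :> R by rewrite ltr0n muln_gt0.
have Qy0 : 0 <= (8 * l)%:R * y by rewrite mulr_ge0 // ltW.
have /andP[kle kgt] := truncn_itv Qy0; rewrite -/k in kle kgt.
have kQ : (k < 8 * l)%N.
  rewrite -(ltr_nat R) (le_lt_trans kle) // -[ltRHS]mulr1 ltr_pM2l //.
split=> //.
have ey : expi ((2 * h)%:R * x) = expi y.
  by rewrite -[in LHS](subrK c%:R (_ * x)) expiD expi_nat mulr1.
have [M1 M2] := lag_bound l0 hl (modc_expi ((2 * h)%:R * x)).
rewrite -/M in M1 M2.
have M0 : 0 <= M by exact: modc_ge0.
have l3 : 0 <= l%:R ^+ 3 :> R by rewrite exprn_ge0.
pose m := minn k (8 * l - k.+1).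
have mM : M <= 88 * l%:R ^+ 3 * invsq m.
  have [m0|m0] := posnP m.
    by rewrite /invsq m0 /= expr1n invr1 mulr1; lra.
  have -> : invsq m = (m%:R ^+ 2)^-1 by rewrite /invsq (maxn_idPr m0).
  rewrite ler_pdivlMr ?exprn_gt0 ?ltr0n //.
  have d1 : m%:R / (8 * l)%:R <= y.
    by rewrite ler_pdivrMr // mulrC (le_trans _ kle) // ler_nat geq_minl.
  have d2 : m%:R / (8 * l)%:R <= 1 - y.
    have : m%:R <= (8 * l)%:R * (1 - y).
      have e1 : m%:R <= (8 * l)%:R - k.+1%:R :> R.
        by rewrite -natrB // ler_nat geq_minr.
      by rewrite (le_trans e1) // mulrBr mulr1 lerB // ltW.
    by rewrite ler_pdivrMr // mulrC.
  have := modc_1Bexpi_ge_dist _ d1 d2; rewrite -ey => /(_ _).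
  rewrite divr_ge0 // => /(_ isT) h8.
  have := le_trans (ler_wpM2r M0 h8) M2.
  rewrite expr_div_n natrM => h9.
  have lp : 0 < l%:R :> R by rewrite ltr0n.
  have : 8 * (m%:R ^+ 2 / (8 * l%:R) ^+ 2) * M * (8 * l%:R ^+ 2) <= 11 * l%:R * (8 * l%:R ^+ 2).
    by rewrite ler_wpM2r // mulr_ge0 // sqr_ge0.
  have -> : 8 * (m%:R ^+ 2 / (8 * l%:R) ^+ 2) * M * (8 * l%:R ^+ 2) = M * m%:R ^+ 2.
    by field; rewrite gt_eqF.
  by rewrite (_ : 11 * l%:R * (8 * l%:R ^+ 2) = 88 * l%:R ^+ 3) //; ring.
rewrite (le_trans mM) // ler_wpM2l ?mulr_ge0 //.
rewrite /m; have [_|_] := leqP k (8 * l - k.+1).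
  by rewrite lerDl invsq_ge0.
by rewrite lerDr invsq_ge0.
Qed.

Lemma sum_by_bins (s : seq nat) (k : nat -> nat) Q T (f : nat -> R) :
  (forall h, h \in s -> k h < Q)%N -> (forall j, 0 <= f j) ->
  (forall j, count (fun h => k h == j) s <= T)%N ->
  \sum_(h <- s) f (k h) <= T%:R * \sum_(0 <= j < Q) f j.
Proof.
move=> kQ f0 cT.
have -> : \sum_(h <- s) f (k h) = \sum_(h <- s) \sum_(0 <= j < Q) (k h == j)%:R * f j.
  apply: eq_big_seq => h hs; rewrite (bigD1_seq (k h)) ?iota_uniq //=; last first.
    by rewrite mem_index_iota kQ.
  rewrite eqxx mul1r big1 ?addr0 // => j; rewrite eq_sym => /negbTE ->.
  by rewrite mul0r.
rewrite exchange_big /= mulr_sumr; apply: ler_sum => j _.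
rewrite -mulr_suml ler_wpM2r // -natr_sum ler_nat (leq_trans _ (cT j)) //.
by rewrite -sum1_count [leqRHS]big_mkcond /= leq_sum // => i _; case: eqP.
Qed.

Definition tent_sum A l x : R[i] :=
  \sum_(0 <= i < 2 * l) (tent l i)%:R%:C * expi (((A + i) ^ 2)%:R * x).

Lemma tent_sum_bound : exists2 C : R, 0 < C & forall x A l T,
  0 <= x <= 1 -> (0 < l)%N -> (0 < T)%N -> ~ major_arc l T x ->
  modc (tent_sum A l x) ^+ 2 <= C * l%:R ^+ 3 * T%:R.
Proof.
(* [2] for the diagonal and [2 * 88 * 6] for the lags, where [6] is twice the bound of
   [sum_invsq]. *)
exists 1058 => [|x A l T x01 l0 T0 nbad]; first by rewrite ltr0n.
have /andP[x0 x1] := x01.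
apply: le_trans (weyl_differencing _ _) _.
have l3 : 0 <= l%:R ^+ 3 :> R by rewrite exprn_ge0.
have diag : \sum_(0 <= i < 2 * l)
   modc ((tent l i)%:R%:C * expi (((A + i) ^ 2)%:R * x)) ^+ 2 <= 2 * l%:R ^+ 3.
  apply: (@le_trans _ _ (\sum_(0 <= i < 2 * l) l%:R ^+ 2)).
    apply: ler_sum => i _; rewrite modcM modc_expi mulr1 modc_real normr_nat.
    by rewrite lerXn2r ?nnegrE // ler_nat tent_le.
  have -> : 2 * l%:R ^+ 3 = l%:R ^+ 2 * (2 * l%:R) :> R by ring.
  by rewrite sumr_const_nat subn0 -[leLHS]mulr_natr natrM.
pose c h := Num.truncn ((2 * h)%:R * x).
pose k h := Num.truncn ((8 * l)%:R * ((2 * h)%:R * x - (c h)%:R)).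
have lag h : (0 < h < 2 * l)%N ->
  modc (\sum_(0 <= i < 2 * l - h) (tent l (i + h))%:R%:C * expi (((A + (i + h)) ^ 2)%:R * x)
     * conjc ((tent l i)%:R%:C * expi (((A + i) ^ 2)%:R * x)))
  <= 88 * l%:R ^+ 3 * (invsq (k h) + invsq (8 * l - (k h).+1)).
  move=> hl; apply: le_trans (proj2 (lag_bin_bound l0 hl x0)).
  rewrite le_eqVlt; apply/orP; left; apply/eqP.
  (* The difference of the two squares is [2 A h + h ^ 2 + 2 h i]; its part free of [i] is a common
     rotation, and the rest makes a power sum in [expi (2 h x)]. *)
  rewrite -[RHS](modc_rot ((2 * A * h + h ^ 2)%:R * x)); congr modc.
  rewrite mulr_sumr; apply: eq_bigr => i _.
  rewrite conjcM conjc_real expi_conj -expi_muln.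
  rewrite mulrACA -expiD [RHS]mulrCA -expiD; congr (_ * expi _); last first.
    by rewrite !(natrX, natrM, natrD); ring.
  by rewrite -rmorphM /= mulrC.
have kQ h : (0 < h < 2 * l)%N -> (k h < 8 * l)%N.
  by move=> hl; exact: (proj1 (lag_bin_bound l0 hl x0)).
have binT j : (count (fun h => k h == j) (index_iota 1 (2 * l)) <= T)%N.
  (* More than [T] lags in one bin put [x] on a major arc; the doubled lags [2 h < 4 l] are the
     multipliers. *)
  rewrite leqNgt; apply/negP => hT; apply: nbad.
  pose H := [seq (2 * h)%N | h <- [seq h <- index_iota 1 (2 * l) | k h == j]].
  apply: (@same_bin_fraction R x (8 * l) (4 * l) T j%:R H (fun h => Num.truncn (h%:R * x))) => //.
  - by rewrite mulnA leq_mul2r orbT.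
  - by rewrite size_map size_filter.
  - by rewrite map_inj_uniq ?filter_uniq ?iota_uniq // => u v /eqP; rewrite eqn_mul2l => /eqP.
  - by move=> e /mapP[h]; rewrite mem_filter mem_index_iota => /andP[_ hh] ->; move: hh; clear; lia.
  move=> e /mapP[h]; rewrite mem_filter => /andP[/eqP kj _] ->.
  rewrite -/(c h).
  have Q0 : 0 < (8 * l)%:R :> R by rewrite ltr0n muln_gt0.
  have hx0 : 0 <= (2 * h)%:R * x by rewrite mulr_ge0.
  have /andP[cle _] := truncn_itv hx0; rewrite -/(c h) in cle.
  have Qy0 : 0 <= (8 * l)%:R * ((2 * h)%:R * x - (c h)%:R) by rewrite mulr_ge0 // subr_ge0.
  have /andP[] := truncn_itv Qy0; rewrite -/(k h) kj -natr1.
  by rewrite mulrC -ler_pdivrMr // -ltr_pdivlMr // => *; apply/andP; split; lra.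
have off : \sum_(1 <= h < 2 * l) modc (\sum_(0 <= i < 2 * l - h)
     (tent l (i + h))%:R%:C * expi (((A + (i + h)) ^ 2)%:R * x)
     * conjc ((tent l i)%:R%:C * expi (((A + i) ^ 2)%:R * x)))
   <= 88 * l%:R ^+ 3 * (T%:R * 6).
  apply: (@le_trans _ _ (\sum_(1 <= h < 2 * l)
      88 * l%:R ^+ 3 * (invsq (k h) + invsq (8 * l - (k h).+1)))).
    by apply: ler_sum_nat => h hl; apply: lag.
  rewrite -mulr_sumr ler_wpM2l ?mulr_ge0 //.
  apply: (@le_trans _ _ (T%:R * \sum_(0 <= j < 8 * l) (invsq j + invsq (8 * l - j.+1)))).
    apply: (@sum_by_bins _ k (8 * l) T (fun j => invsq j + invsq (8 * l - j.+1))) => //.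
      by move=> h; rewrite mem_index_iota => /kQ.
    by move=> j; rewrite addr_ge0 ?invsq_ge0.
  rewrite ler_wpM2l // big_split /=.
  rewrite (_ : \sum_(0 <= i < 8 * l) invsq (8 * l - i.+1) = \sum_(0 <= i < 8 * l) invsq i).
    by have := sum_invsq (8 * l); lra.
  by rewrite [RHS]big_nat_rev.
have T1 : 1 <= T%:R :> R by rewrite ler1n.
have : l%:R ^+ 3 <= l%:R ^+ 3 * T%:R :> R by rewrite ler_peMr.
by move: diag off; lra.
Qed.

End TentSums.

(** * Lebesgue measure on the torus *)

Section TorusMeasure.
Variable R : realType.
Implicit Types (f g : R -> R) (p : \bar R).

Definition torus : {measure set (measurableTypeR R) -> \bar R} := @muT R.

Notation mu := torus.
Notation mR := (measurable_fun [set: measurableTypeR R]).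

Lemma torusE (A : set R) : mu A = lebesgue_measure (A `&` `[0, 1]).
Proof. by []. Qed.

Lemma torusT : mu setT = 1%E.
Proof. by rewrite torusE setTI lebesgue_measure_itv /= lte01 sube0. Qed.

Lemma torus_le (A : set R) : measurable A -> (mu A <= lebesgue_measure A)%E.
Proof.
move=> mA; rewrite torusE; apply: le_measure; rewrite ?inE //.
by apply: measurableI => //; exact: measurable_itv.
Qed.

Lemma torus_ae_filter : Filter (almost_everywhere mu).
Proof. exact: ae_filter_ringOfSetsType. Qed.

Lemma torus_aeS (P Q : R -> Prop) : (forall x, P x -> Q x) ->
  (\forall x \ae mu, P x) -> \forall x \ae mu, Q x.
Proof. by move=> PQ; apply: (@filterS _ _ torus_ae_filter). Qed.

Lemma torus_aeI (P Q : R -> Prop) : (\forall x \ae mu, P x) ->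
  (\forall x \ae mu, Q x) -> \forall x \ae mu, P x /\ Q x.
Proof. exact: (@filterI _ _ torus_ae_filter). Qed.

Lemma torus_aeW (P : R -> Prop) : (forall x, P x) -> \forall x \ae mu, P x.
Proof.
move=> h; apply: (@torus_aeS setT) => [x _|]; first exact: h.
exact: (@filterT _ _ torus_ae_filter).
Qed.

Lemma torus_ae01 : \forall x \ae mu, 0 <= x <= 1.
Proof.
exists (~` `[0, 1]); split.
- by apply: measurableC; exact: measurable_itv.
- by rewrite /mu torusE setICl measure0.
- by move=> x /= nx h; apply: nx; move: h; rewrite in_itv.
Qed.

Lemma integral_torus (f : measurableTypeR R -> \bar R) : mR f ->
  mu.-integrable setT f ->
  (\int[mu]_x f x = \int[lebesgue_measure]_(x in `[0%R, 1%R]) f x)%E.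
Proof.
move=> mf fi.
have mI : measurable (`[0, 1]%classic : set R) by exact: measurable_itv.
pose N : set (measurableTypeR R) := ~` `[0, 1]%classic.
have N0 : mu N = 0%E by rewrite torusE setICl measure0.
rewrite (@negligible_integral _ _ _ _ setT N) //; last exact: measurableC.
rewrite /N setDE setCK setTI; apply: (eq_measure_integral lebesgue_measure) => A mA AI.
by rewrite torusE setIidl.
Qed.

Lemma cst_integrable (c : R) : mu.-integrable setT (EFin \o cst c).
Proof.
apply/integrableP; split; first by apply/measurable_EFinP; exact: measurable_cst.
by rewrite (integral_cst _ measurableT `|c|%:E) torusT mule1 ltry.
Qed.

Lemma bounded_integrable f (c : R) : mR f -> (forall x, `|f x| <= c) ->
  mu.-integrable setT (EFin \o f).
Proof.
move=> mf fc; apply: (le_integrable measurableT _ _ (cst_integrable c)).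
- exact/measurable_EFinP.
- by move=> x _ /=; rewrite lee_fin (le_trans (fc x)) // ler_norm.
Qed.

Lemma cos_measurable (k : R) : mR (fun x => cos (k * x)).
Proof.
apply: continuous_measurable_fun => x; apply: continuous_comp; last exact: continuous_cos.
by apply: continuousM => //; apply: cst_continuous.
Qed.

Lemma sin_measurable (k : R) : mR (fun x => sin (k * x)).
Proof.
apply: continuous_measurable_fun => x; apply: continuous_comp; last exact: continuous_sin.
by apply: continuousM => //; apply: cst_continuous.
Qed.

Lemma integral_cos (k : nat) : (0 < k)%N ->
  (\int[mu]_x (cos (2 * pi * k%:R * x))%:E = 0)%E.
Proof.
move=> k0; set w := 2 * pi * k%:R.
have w0 : w != 0 by rewrite !mulf_neq0 // ?gt_eqF ?pi_gt0 ?ltr0n.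
rewrite integral_torus; last 2 first.
- by apply/measurable_EFinP; exact: cos_measurable.
- apply: (@bounded_integrable _ 1); first exact: cos_measurable.
  by move=> x; rewrite ler_norml cos_geN1 cos_le1.
pose F x : R := w^-1 * sin (w * x).
have dF (x : R) : is_derive x 1 F (cos (w * x)).
  apply: is_derive_eq; rewrite /GRing.scale /=.
  by rewrite mulr1 mulrCA mulVf ?mulr1.
rewrite (@continuous_FTC2 _ (fun x => cos (w * x)) F) //.
- rewrite /F mulr1 mulr0 sin0 mulr0.
  have -> : sin w = 0.
    rewrite /w mulr_natl mulr_natr; have := @periodicn _ _ _ _ (@sinD2pi R) k 0.
    by rewrite add0r sin0 => <-; congr sin; rewrite mulr_natl.
  by rewrite mulr0 subee.
- apply: continuous_subspaceT => x; apply: continuous_comp; last exact: continuous_cos.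
  by apply: continuousM => //; apply: cst_continuous.
- split=> [x _||].
  + by case: (dF x).
  + apply: cvg_at_right_filter; apply: differentiable_continuous.
    by apply/derivable1_diffP; case: (dF 0).
  + apply: cvg_at_left_filter; apply: differentiable_continuous.
    by apply/derivable1_diffP; case: (dF 1).
- by move=> x _; rewrite derive1E; case: (dF x).
Qed.

End TorusMeasure.

(** * Norms, moments and Parseval *)

Section TorusNorm.
Variable R : realType.
Implicit Types (F G : R -> R[i]) (p : \bar R) (r B : R).

Notation mu := (@torus R).
Notation mR := (measurable_fun [set: measurableTypeR R]).

Definition cmeas F :=
  mR (fun x => complex.Re (F x)) /\ mR (fun x => complex.Im (F x)).

Lemma cmeasD F G : cmeas F -> cmeas G -> cmeas (fun x => (F x + G x)%R).
Proof.
move=> [F1 F2] [G1 G2]; split.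
  by under eq_fun do rewrite ReD; exact: measurable_funD.
by under eq_fun do rewrite ImD; exact: measurable_funD.
Qed.

Lemma cmeasZ (c : R) F : cmeas F -> cmeas (fun x => (c%:C * F x)%R).
Proof.
move=> [F1 F2]; split.
  have -> : (fun x => complex.Re (c%:C * F x)) = (fun x => c * complex.Re (F x)).
    by apply/funext => x; case: (F x) => a b /=; rewrite mul0r subr0.
  exact: measurable_funM.
have -> : (fun x => complex.Im (c%:C * F x)) = (fun x => c * complex.Im (F x)).
  by apply/funext => x; case: (F x) => a b /=; rewrite mul0r addr0.
exact: measurable_funM.
Qed.

Lemma cmeas0 : cmeas (fun=> 0).
Proof. by split; exact: measurable_cst. Qed.

Lemma cmeas_expi n : cmeas (fun x => expi (n%:R * x)).
Proof.
split; rewrite /expi /=; under eq_fun do rewrite mulrA.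
  exact: cos_measurable.
exact: sin_measurable.
Qed.

Lemma cmeas_sum I (s : seq I) (P : pred I) (F : I -> R -> R[i]) :
  (forall i, P i -> cmeas (F i)) -> cmeas (fun x => (\sum_(i <- s | P i) F i x)%R).
Proof.
move=> mF; elim: s => [|i s IH].
  have -> : (fun x => \sum_(i <- [::] | P i) F i x) = (fun=> 0).
    by apply/funext => x; rewrite big_nil.
  exact: cmeas0.
have -> : (fun x => \sum_(i <- i :: s | P i) F i x) =
   (fun x => if P i then F i x + \sum_(i <- s | P i) F i x else \sum_(i <- s | P i) F i x).
  by apply/funext => x; rewrite big_cons.
by case: (boolP (P i)) => // Pi; apply: cmeasD => //; apply: mF.
Qed.

Lemma cmeasB F G : cmeas F -> cmeas G -> cmeas (fun x => (F x - G x)%R).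
Proof.
move=> mF mG; have -> : (fun x => (F x - G x)%R) = (fun x => F x + (-1)%:C * G x).
  by apply/funext => x; rewrite rmorphN mulN1r.
by apply: cmeasD => //; apply: cmeasZ.
Qed.

Lemma cmeas_mod F : cmeas F -> mR (fun x => modc (F x)).
Proof.
move=> [F1 F2]; rewrite /modc /cmod; apply: (measurableT_comp (continuous_measurable_fun _)).
  exact: sqrt_continuous.
by apply: measurable_funD; exact: measurable_funX.
Qed.

Lemma cmeas_powR F r : cmeas F -> mR (fun x => modc (F x) `^ r).
Proof.
move=> /cmeas_mod mF; exact: (measurableT_comp (measurable_powR r)).
Qed.

Lemma cmeas_powRE F r : cmeas F ->
  mR (fun x => (modc (F x) `^ r)%:E).
Proof. by move=> mF; apply/measurable_EFinP; exact: cmeas_powR. Qed.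

Definition nrm p F : \bar R := LpT p (fun x => complex.Re (F x)) (fun x => complex.Im (F x)).

Lemma nrmE p F : nrm p F = Lnorm mu p (EFin \o (fun x => modc (F x))).
Proof. by []. Qed.

Lemma nrm_ge0 p F : (0 <= nrm p F)%E.
Proof. exact: Lnorm_ge0. Qed.

Definition moment r F : \bar R := (\int[mu]_x (modc (F x) `^ r)%:E)%E.

Lemma moment_ge0 r F : (0 <= moment r F)%E.
Proof. by apply: integral_ge0 => x _; rewrite lee_fin powR_ge0. Qed.

Lemma nrm_moment r F : nrm r%:E F = poweR (moment r F) r^-1.
Proof.
rewrite nrmE unlock; apply: (congr1 (fun y => poweR y r^-1)).
apply: eq_integral => x _.
by rewrite /= ger0_norm ?modc_ge0.
Qed.

Lemma poweR_leP (x : \bar R) r B : (0 <= x)%E -> 0 < r -> 0 <= B ->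
  (poweR x r^-1 <= B%:E)%E <-> (x <= (B `^ r)%:E)%E.
Proof.
move=> + r0 B0; case: x => [x| |//]; last first.
  by move=> _; rewrite /= gt_eqF ?invr_gt0 // !leye_eq.
rewrite /= !lee_fin => x0; split => h.
  have -> : x = (x `^ r^-1) `^ r by rewrite -powRrM mulVf ?gt_eqF // powRr1.
  by rewrite ge0_ler_powR ?nnegrE ?powR_ge0 // ltW.
have -> : B = (B `^ r) `^ r^-1 by rewrite -powRrM mulfV ?gt_eqF // powRr1.
by rewrite ge0_ler_powR ?nnegrE ?powR_ge0 // invr_ge0 ltW.
Qed.

Lemma poweR_geP (x : \bar R) r B : (0 <= x)%E -> 0 < r -> 0 <= B ->
  (B%:E <= poweR x r^-1)%E <-> ((B `^ r)%:E <= x)%E.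
Proof.
move=> + r0 B0; case: x => [x| |//]; last first.
  by move=> _; rewrite /= gt_eqF ?invr_gt0 // !leey.
rewrite /= !lee_fin => x0; split => h.
  have -> : x = (x `^ r^-1) `^ r by rewrite -powRrM mulVf ?gt_eqF // powRr1.
  by rewrite ge0_ler_powR ?nnegrE ?powR_ge0 // ltW.
have -> : B = (B `^ r) `^ r^-1 by rewrite -powRrM mulfV ?gt_eqF // powRr1.
by rewrite ge0_ler_powR ?nnegrE ?powR_ge0 // invr_ge0 ltW.
Qed.

Lemma nrm_leP r F B : 0 < r -> 0 <= B ->
  (nrm r%:E F <= B%:E)%E <-> (moment r F <= (B `^ r)%:E)%E.
Proof. by move=> r0 B0; rewrite nrm_moment; apply: poweR_leP => //; exact: moment_ge0. Qed.

Lemma nrm_geP r F B : 0 < r -> 0 <= B ->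
  (B%:E <= nrm r%:E F)%E <-> ((B `^ r)%:E <= moment r F)%E.
Proof. by move=> r0 B0; rewrite nrm_moment; apply: poweR_geP => //; exact: moment_ge0. Qed.

Lemma nrmy_leP F B : (nrm +oo F <= B%:E)%E <-> \forall x \ae mu, modc (F x) <= B.
Proof.
rewrite nrmE unlock torusT lte01; split.
  by move=> /ess_supP; apply: torus_aeS => x /=; rewrite lee_fin ger0_norm ?modc_ge0.
by move=> h; apply/ess_supP; apply: torus_aeS h => x /=; rewrite lee_fin ger0_norm ?modc_ge0.
Qed.

Lemma moment_le r F G : 0 <= r -> cmeas F -> cmeas G ->
  (\forall x \ae mu, modc (F x) <= modc (G x)) -> (moment r F <= moment r G)%E.
Proof.
move=> r0 mF mG FG; apply: ae_ge0_le_integral => //.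
- by move=> x _; rewrite lee_fin powR_ge0.
- exact: cmeas_powRE.
- by move=> x _; rewrite lee_fin powR_ge0.
- exact: cmeas_powRE.
by apply: torus_aeS FG => x FG _; rewrite lee_fin ge0_ler_powR ?nnegrE ?modc_ge0.
Qed.

(** Minkowski's inequality is applied to the real functions [modc (F x)] and [modc (G x)].
    Monotonicity of the norm then brings in the pointwise triangle inequality, separately for finite
    and infinite [p]. *)
Lemma nrmD p F G (B C : R) : (1 <= p)%E -> cmeas F -> cmeas G ->
  (nrm p F <= B%:E)%E -> (nrm p G <= C%:E)%E ->
  (nrm p (fun x => (F x + G x)%R) <= (B + C)%:E)%E.
Proof.
move=> p1 mF mG FB GC; rewrite EFinD; apply: le_trans (leeD FB GC).
have mod_FG : (nrm p (fun x => (modc (F x) + modc (G x))%R%:C) <= nrm p F + nrm p G)%E.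
  rewrite !nrmE; apply: le_trans (eminkowski _ (cmeas_mod mF) (cmeas_mod mG) p1).
  rewrite le_eqVlt; apply/orP; left; apply/eqP; apply: eq_Lnorm => x /=.
  by rewrite modc_real ger0_norm // addr_ge0 ?modc_ge0.
apply: le_trans mod_FG.
have mFG : cmeas (fun x => (F x + G x)%R) by exact: cmeasD.
have mm : cmeas (fun x => (modc (F x) + modc (G x))%R%:C).
  by split => /=; [apply: measurable_funD; exact: cmeas_mod|exact: measurable_cst].
have le x : modc (F x + G x) <= modc ((modc (F x) + modc (G x))%:C).
  by rewrite modc_real ger0_norm ?modcD // addr_ge0 ?modc_ge0.
case: p p1 {FB GC} => [r|_|//]; last first.
  rewrite !nrmE unlock torusT lte01; apply: le_ess_sup; apply: torus_aeW => x /=.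
  by rewrite lee_fin !(ger0_norm (modc_ge0 _)).
rewrite lee_fin => r1; have r0 : 0 < r by rewrite (lt_le_trans _ r1).
set N := nrm _ (fun x => _%:C); have [Nfin|] := boolP (N \is a fin_num); last first.
  by rewrite ge0_fin_numE ?nrm_ge0 // -leNgt leye_eq => /eqP ->; rewrite leey.
rewrite -(fineK Nfin); apply/nrm_leP => //; first by rewrite fine_ge0 ?nrm_ge0.
apply: (@le_trans _ _ (moment r (fun x => (modc (F x) + modc (G x))%R%:C))).
  by apply: moment_le => //; [exact: ltW|exact: torus_aeW].
apply/nrm_leP => //; first by rewrite fine_ge0 ?nrm_ge0.
by rewrite fineK.
Qed.

Lemma nrm0 p : (0 < p)%E -> nrm p (fun=> 0) = 0%E.
Proof.
move=> p0; rewrite nrmE -(@Lnorm0 _ _ _ mu p); last by rewrite gt_eqF.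
by apply: eq_Lnorm => x /=; rewrite modc0.
Qed.

Lemma nrmZ p F (c B : R) : (0 < p)%E -> cmeas F -> 0 <= c -> 0 <= B ->
  (nrm p F <= B%:E)%E -> (nrm p (fun x => (c%:C * F x)%R) <= (c * B)%:E)%E.
Proof.
move=> + mF c0 B0; case: p => [r||//].
  rewrite lte_fin => r0 /nrm_leP h; apply/nrm_leP; rewrite ?mulr_ge0 //.
  rewrite powRM // EFinM.
  apply: (@le_trans _ _ ((c `^ r)%:E * moment r F)%E); last first.
    by rewrite lee_wpmul2l ?lee_fin ?powR_ge0 // h.
  rewrite /moment -ge0_integralZl_EFin ?powR_ge0 //.
  - rewrite le_eqVlt; apply/orP; left; apply/eqP; apply: eq_integral => x _.
    by rewrite -EFinM -powRM ?modc_ge0 // modcM modc_real (ger0_norm c0).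
  - by move=> x _; rewrite lee_fin powR_ge0.
  - exact: cmeas_powRE.
move=> _ /nrmy_leP h; apply/nrmy_leP; apply: torus_aeS h => x h.
by rewrite modcM modc_real (ger0_norm c0) ler_wpM2l.
Qed.

Lemma nrm_sum I (s : seq I) (P : pred I) (F : I -> R -> R[i]) (B : I -> R) p :
  (1 <= p)%E -> (forall i, P i -> cmeas (F i)) ->
  (forall i, P i -> (nrm p (F i) <= (B i)%:E)%E) ->
  (nrm p (fun x => (\sum_(i <- s | P i) F i x)%R) <= (\sum_(i <- s | P i) B i)%R%:E)%E.
Proof.
move=> p1 mF FB; elim: s => [|i s IH].
  rewrite big_nil (_ : (fun x => _) = fun=> 0) ?nrm0 //.
    by rewrite (lt_le_trans _ p1).
  by apply/funext => x; rewrite big_nil.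
have -> : (fun x => \sum_(i <- i :: s | P i) F i x) =
   (fun x => if P i then F i x + \sum_(i <- s | P i) F i x else \sum_(i <- s | P i) F i x).
  by apply/funext => x; rewrite big_cons.
rewrite big_cons; case: (boolP (P i)) => // Pi; apply: nrmD => //;
  [exact: mF|exact: cmeas_sum|exact: FB].
Qed.

Lemma eq_nrm p F G : F =1 G -> nrm p F = nrm p G.
Proof. by move=> /funext ->. Qed.

(** Frequencies may repeat. With frequencies [a ^ 2 + b ^ 2] or [n ^ 2 + k] the right-hand side
    counts coincidences, which is how the fourth moment and the Fejer-weighted second moment are
    bounded below. *)
Lemma parseval I (s : seq I) (c : I -> R) (m : I -> nat) :
  (\int[mu]_x (modc (\sum_(i <- s) (c i)%:C * expi ((m i)%:R * x))%R ^+ 2)%:E =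
   (\sum_(i <- s) \sum_(j <- s) c i * c j * (m i == m j)%:R)%:E)%E.
Proof.
(* One of the truncated differences vanishes, so this is the distance of the two frequencies. *)
pose d i j : nat := ((m i - m j) + (m j - m i))%N.
have cosd i j x : complex.Re ((c i)%:C * expi ((m i)%:R * x)
     * conjc ((c j)%:C * expi ((m j)%:R * x))) =
     c i * c j * cos (2 * pi * (d i j)%:R * x).
  rewrite conjcM conjc_real expi_conj mulrACA -expiD -rmorphM /= mul0r subr0.
  congr (_ * _); rewrite /d; have [ij|/ltnW ij] := leqP (m i) (m j).
    rewrite (eqP ij) add0n natrB // -cosN; congr cos; ring.
  rewrite (eqP ij) addn0 natrB //; congr cos; ring.
have expand x : modc (\sum_(i <- s) (c i)%:C * expi ((m i)%:R * x)) ^+ 2 =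
    \sum_(i <- s) \sum_(j <- s) c i * c j * cos (2 * pi * (d i j)%:R * x).
  set S := \sum_(i <- s) _ * expi _.
  have -> : modc S ^+ 2 = complex.Re (S * conjc S).
    by rewrite sqr_modc; case: S => a b /=; ring.
  rewrite {1}/S conjc_sum mulr_suml (raddf_sum (@complex.Re R : {additive R[i] -> R})).
  apply: eq_bigr => i _.
  rewrite mulr_sumr (raddf_sum (@complex.Re R : {additive R[i] -> R})).
  by apply: eq_bigr => j _; exact: cosd.
have cint k a : mu.-integrable setT (fun x => (a * cos (2 * pi * k%:R * x))%:E).
  apply: (@bounded_integrable _ _ `|a|); first by apply: measurable_funM => //;
    exact: cos_measurable.
  by move=> x; rewrite normrM ler_piMr // ler_norml cos_geN1 cos_le1.
have sint i : mu.-integrable setT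
    (fun x => (\sum_(j <- s) c i * c j * cos (2 * pi * (d i j)%:R * x))%:E).
  have -> : (fun x => (\sum_(j <- s) c i * c j * cos (2 * pi * (d i j)%:R * x))%:E) =
      (fun x => \sum_(j <- s) (c i * c j * cos (2 * pi * (d i j)%:R * x))%:E)%E.
    by apply/funext => x; rewrite sumEFin.
  by apply: integrable_sum => // j _; exact: cint.
under eq_integral do rewrite expand -sumEFin.
rewrite (@integral_sum _ _ _ mu setT measurableT _
  (fun i x => (\sum_(j <- s) c i * c j * cos (2 * pi * (d i j)%:R * x))%:E)) //.
rewrite -sumEFin; apply: eq_bigr => i _.
under eq_integral do rewrite -sumEFin.
rewrite (@integral_sum _ _ _ mu setT measurableT _
  (fun j x => (c i * c j * cos (2 * pi * (d i j)%:R * x))%:E)) //.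
rewrite -sumEFin; apply: eq_bigr => j _.
have ci : mu.-integrable setT (fun x => (cos (2 * pi * (d i j)%:R * x))%:E).
  by have := cint (d i j) 1; under eq_fun do rewrite mul1r.
under eq_integral do rewrite EFinM.
rewrite integralZl // [in RHS]EFinM; congr (_ * _)%E.
have [eqm|neqm] := eqVneq (m i) (m j).
  rewrite /d eqm subnn /=.
  under eq_integral do rewrite mulr0 mul0r cos0.
  by rewrite (integral_cst _ measurableT 1%E) torusT mule1.
rewrite integral_cos // /d; move: neqm; clear; lia.
Qed.

End TorusNorm.

(** * Moments of tent sums *)

Section TentNorm.
Variable R : realType.
Implicit Types (x r : R) (p : \bar R) (k l A : nat).

Notation mu := (@torus R).
Notation mR := (measurable_fun [set: measurableTypeR R]).

Definition arc (d : R) (q a : nat) : set (measurableTypeR R) :=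
  `[a%:R / q%:R - d, a%:R / q%:R + d]%classic.

Lemma measurable_arc d q a : measurable (arc d q a).
Proof. exact: measurable_itv. Qed.

Lemma torus_arc d q a : 0 < d -> (mu (arc d q a) <= (2 * d)%:E)%E.
Proof.
move=> d0; apply: le_trans (torus_le (measurable_arc d q a)) _.
rewrite /arc lebesgue_measure_itv /= lte_fin; case: ifP => _; last first.
  by rewrite lee_fin mulr_ge0 // ltW.
by rewrite -EFinB lee_fin; lra.
Qed.

(** Majorant of the indicator of the major arcs. Counting overlaps reduces its integral to a sum of
    interval lengths. *)
Definition arc_count l T x : R :=
  \sum_(1 <= q < (4 * l %/ T).+1) \sum_(0 <= a < q.+1)
    \1_(arc ((8 * l)%:R * T%:R * q%:R)^-1 q a) x.

Lemma arc_count_ge0 l T x : 0 <= arc_count l T x.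
Proof. by apply: sumr_ge0 => q _; apply: sumr_ge0 => a _. Qed.

Lemma major_arc_count l T x : (0 < T)%N -> major_arc l T x -> 1 <= arc_count l T x.
Proof.
move=> T0 [q [a [q0 aq qT xa]]]; rewrite /arc_count.
have qin : (1 <= q < (4 * l %/ T).+1)%N by rewrite q0 ltnS leq_divRL.
rewrite (bigD1_seq q) ?iota_uniq ?mem_index_iota //=.
rewrite (bigD1_seq a) ?iota_uniq ?mem_index_iota ?leq0n ?ltnS //= -addrA.
rewrite indicE mem_set ?lerDl; last first.
  by rewrite /arc /= in_itv /=; move: xa; rewrite ler_norml => /andP[? ?]; apply/andP; split; lra.
by rewrite addr_ge0 //; apply: sumr_ge0 => // i _; apply: sumr_ge0.
Qed.

Lemma measurable_arc_count l T : mR (arc_count l T).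
Proof.
by apply: measurable_sum => q; apply: measurable_sum => a;
  exact: measurable_indic (measurable_arc _ _ _).
Qed.

(** A denominator [q] has [q + 1 <= 2 q] arcs of length [2 / (8 l T q)], in all at most
    [1 / (2 l T)], and there are at most [4 l / T] denominators. *)
Lemma integral_arc_count l T : (0 < l)%N -> (0 < T)%N ->
  (\int[mu]_x (arc_count l T x)%:E <= (2 / T%:R ^+ 2)%:E)%E.
Proof.
move=> l0 T0; rewrite /arc_count; under eq_integral do rewrite -sumEFin.
rewrite ge0_integral_sum //; last 2 first.
- by move=> q; apply/measurable_EFinP; apply: measurable_sum => a;
    exact: measurable_indic (measurable_arc _ _ _).
- by move=> q x _; rewrite lee_fin; apply: sumr_ge0.
have lR : 0 < l%:R :> R by rewrite ltr0n.
have TR : 0 < T%:R :> R by rewrite ltr0n.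
apply: (@le_trans _ _ (\sum_(1 <= q < (4 * l %/ T).+1) ((2 * l%:R * T%:R)^-1)%:E)%E).
  rewrite !big_nat; apply: lee_sum => q /andP[q1 _].
  under eq_integral do rewrite -sumEFin.
  rewrite ge0_integral_sum //; last first.
    by move=> a; apply/measurable_EFinP; exact: measurable_indic (measurable_arc _ _ _).
  have qR : 1 <= q%:R :> R by rewrite ler1n.
  have q0R : 0 < q%:R :> R by rewrite ltr0n.
  set d := _^-1; have d0 : 0 < d by rewrite invr_gt0 !mulr_gt0 // ltr0n muln_gt0.
  apply: (@le_trans _ _ (\sum_(0 <= a < q.+1) (2 * d)%:E)%E).
    by apply: lee_sum => a _; rewrite integral_indic ?setIT ?torus_arc //; exact: measurable_arc.
  rewrite sumEFin lee_fin sumr_const_nat subn0 -[leLHS]mulr_natr -(@natr1 _ q) /d natrM.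
  have -> : 2 * (8 * l%:R * T%:R * q%:R)^-1 * (q%:R + 1)
     = (2 * l%:R * T%:R)^-1 * ((q%:R + 1) / (2 * q%:R)) :> R by field; rewrite !lt0r_neq0.
  by rewrite ler_piMr ?invr_ge0 ?mulr_ge0 // ler_pdivrMr ?mulr_gt0 //; lra.
rewrite sumEFin lee_fin sumr_const_nat subn1 /= -[leLHS]mulr_natr.
have h : (4 * l %/ T)%:R <= 4 * l%:R / T%:R :> R.
  by rewrite ler_pdivlMr // -natrM -natrM ler_nat leq_trunc_div.
apply: le_trans (ler_wpM2l _ h) _; first by rewrite invr_ge0 !mulr_ge0 ?ler0n.
by rewrite le_eqVlt; apply/orP; left; apply/eqP; field; rewrite !lt0r_neq0.
Qed.

Lemma cmeas_tent_sum A l : cmeas (@tent_sum R A l).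
Proof. by apply: cmeas_sum => i _; apply: cmeasZ; exact: cmeas_expi. Qed.

Variable c : R.
Hypothesis c0 : 0 < c.
Hypothesis tb : forall x A l T, 0 <= x <= 1 -> (0 < l)%N -> (0 < T)%N ->
  ~ major_arc l T x -> modc (tent_sum A l x) ^+ 2 <= c * l%:R ^+ 3 * T%:R.

(** The least level [2 ^ j] at which [x] is off the major arcs gives the bound. If [j > 0], then [x]
    is on a major arc at the preceding level, and the corresponding summand is large enough. *)
Lemma tent_sum_pointwise r A k x : 0 < r -> 0 <= x <= 1 ->
  modc (tent_sum A (2 ^ k) x) `^ r <=
  (c * (2 ^ k)%:R ^+ 3) `^ (r / 2) *
  (1 + \sum_(0 <= j < k.+3) (2 ^ j.+1)%:R `^ (r / 2) * arc_count (2 ^ k) (2 ^ j) x).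
Proof.
move=> r0 x01; set l := (2 ^ k)%N; set P := tent_sum _ _ _ : R[i].
have l0 : (0 < l)%N by rewrite expn_gt0.
have c0' := ltW c0.
have pow : modc P `^ r = (modc P ^+ 2) `^ (r / 2).
  by rewrite -powR_mulrn ?modc_ge0 // -powRrM; congr (_ `^ _); field.
have bound T : (0 < T)%N -> ~ major_arc l T x ->
    modc P `^ r <= (c * l%:R ^+ 3) `^ (r / 2) * T%:R `^ (r / 2).
  move=> T0 nm; rewrite pow -powRM ?mulr_ge0 ?exprn_ge0 //.
  rewrite ge0_ler_powR ?nnegrE ?mulr_ge0 ?exprn_ge0 ?sqr_ge0 ?modc_ge0 ?(ltW r0) //.
  exact: tb.
have summand_ge0 j : 0 <= (2 ^ j.+1)%:R `^ (r / 2) * arc_count l (2 ^ j) x.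
  by rewrite mulr_ge0 ?powR_ge0 ?arc_count_ge0.
pose good j := `[< ~ major_arc l (2 ^ j) x >].
(* At [T = 2 ^ k.+3 = 8 l] the condition [q T <= 4 l] excludes every [q]. *)
have exgood : exists j, good j.
  exists k.+3; apply/asboolP => -[q [a [q0 _ qT _]]].
  have : (2 ^ k.+3 <= 4 * l)%N by rewrite (leq_trans _ qT) // leq_pmull.
  by rewrite !expnS mulnA mulnA leq_pmul2r.
case: (ex_minnP exgood) => j /asboolP jgood jmin.
have jk : (j <= k.+3)%N.
  apply: jmin; apply/asboolP => -[q [a [q0 _ qT _]]].
  have : (2 ^ k.+3 <= 4 * l)%N by rewrite (leq_trans _ qT) // leq_pmull.
  by rewrite !expnS mulnA mulnA leq_pmul2r.
case: j jgood jmin jk => [|j] jgood jmin jk.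
  apply: le_trans (bound _ _ jgood) _ => //.
  by rewrite powR1 ler_wpM2l ?powR_ge0 // lerDl sumr_ge0.
apply: le_trans (bound _ _ jgood) _; first by rewrite expn_gt0.
rewrite ler_wpM2l ?powR_ge0 //.
have mj : major_arc l (2 ^ j) x.
  apply: contrapT => nm; have : good j by apply/asboolP.
  by move=> /jmin; rewrite ltnn.
rewrite (bigD1_seq j) ?iota_uniq ?mem_index_iota //=.
apply: (@le_trans _ _ ((2 ^ j.+1)%:R `^ (r / 2) * arc_count l (2 ^ j) x)).
  by rewrite ler_peMr ?powR_ge0 // major_arc_count // expn_gt0.
rewrite addrCA lerDl addr_ge0 // sumr_ge0 //.
Qed.

Lemma tent_moment r A k : 0 < r ->
  (moment r (tent_sum A (2 ^ k)) <=
   ((c * (2 ^ k)%:R ^+ 3) `^ (r / 2) *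
   (1 + \sum_(0 <= j < k.+3) (2 ^ j.+1)%:R `^ (r / 2) * (2 / (2 ^ j)%:R ^+ 2)))%:E)%E.
Proof.
move=> r0; set d := (_ `^ (r / 2)).
pose g x := d * (1 + \sum_(0 <= j < k.+3) (2 ^ j.+1)%:R `^ (r / 2) * arc_count (2 ^ k) (2 ^ j) x).
have d0 : 0 <= d by exact: powR_ge0.
have t0 j x : 0 <= (2 ^ j.+1)%:R `^ (r / 2) * arc_count (2 ^ k) (2 ^ j) x.
  by rewrite mulr_ge0 ?powR_ge0 ?arc_count_ge0.
have mt j : mR (fun x => (2 ^ j.+1)%:R `^ (r / 2) * arc_count (2 ^ k) (2 ^ j) x).
  by apply: measurable_funM => //; exact: measurable_arc_count.
have ms : mR (fun x => \sum_(0 <= j < k.+3) (2 ^ j.+1)%:R `^ (r / 2) * arc_count (2 ^ k) (2 ^ j) x).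
  by apply: measurable_sum.
have m1 : mR (fun x => 1 +
  \sum_(0 <= j < k.+3) (2 ^ j.+1)%:R `^ (r / 2) * arc_count (2 ^ k) (2 ^ j) x).
  by apply: measurable_funD.
apply: (@le_trans _ _ (\int[mu]_x (g x)%:E)%E).
  apply: ae_ge0_le_integral => //.
  - by move=> x _; rewrite lee_fin powR_ge0.
  - by apply: cmeas_powRE; exact: cmeas_tent_sum.
  - by move=> x _; rewrite lee_fin mulr_ge0 // addr_ge0 // sumr_ge0.
  - by apply/measurable_EFinP; apply: measurable_funM.
  - have a01 := torus_ae01 R; apply: torus_aeS a01 => x x01 _.
    by rewrite lee_fin; exact: tent_sum_pointwise.
rewrite /g; under eq_integral do rewrite EFinM.
rewrite ge0_integralZl_EFin //; last 2 first.
- by move=> x _; rewrite lee_fin addr_ge0 // sumr_ge0.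
- exact/measurable_EFinP.
rewrite EFinM lee_wpmul2l ?lee_fin //.
under eq_integral do rewrite EFinD.
rewrite ge0_integralD //; last 2 first.
- by move=> x _; rewrite lee_fin sumr_ge0.
- exact/measurable_EFinP.
rewrite EFinD leeD //.
  by rewrite (integral_cst _ measurableT 1%E) torusT mule1.
under eq_integral do rewrite -sumEFin.
rewrite ge0_integral_sum //; last 2 first.
- by move=> j; apply/measurable_EFinP; exact: mt.
- by move=> j x _; rewrite lee_fin.
rewrite -sumEFin; apply: lee_sum => j _.
under eq_integral do rewrite EFinM.
rewrite ge0_integralZl_EFin ?powR_ge0 //; last 2 first.
- by move=> x _; rewrite lee_fin arc_count_ge0.
- by apply/measurable_EFinP; exact: measurable_arc_count.
by rewrite EFinM lee_wpmul2l ?lee_fin ?powR_ge0 // integral_arc_count ?expn_gt0.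
Qed.

End TentNorm.

(** * From tents to sharp cut-offs *)

Section SharpSums.
Variable R : realType.
Implicit Types (x r : R) (p : \bar R) (k l A M : nat).

Lemma gt1_ltr_powR (a x y : R) : 1 < a -> x < y -> a `^ x < a `^ y.
Proof.
move=> a1 xy; rewrite /powR gt_eqF ?(lt_trans ltr01 a1) //.
by rewrite ltr_expR ltr_pM2r // ln_gt0.
Qed.

(** [Psi p k] is the order of the norm of a sum of [l = 2 ^ k] unimodular terms over consecutive
    squares: [l^(1/2)] below [4], [l^(1/2) (log l)^(1/4)] at [4], and [l^(1 - 2/p)] above, with
    [k.+1] in place of the logarithm. *)
Definition gam p : R := if (p < 4%:E)%E then 1/2 else 1 - 2 * invp p.
Definition kap p : R := if p == 4%:E then 1/4 else 0.
Definition Psi p k : R := (2 `^ gam p) ^+ k * k.+1%:R `^ kap p.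

Lemma invp_le4 p : (4%:E <= p)%E -> 0 <= invp p <= 1/4.
Proof.
case: p => [r| |]; rewrite /invp ?lee_fin => //.
  by move=> r4; rewrite invr_ge0 (le_trans _ r4) //= div1r lef_pV2 ?posrE //; lra.
by move=> _; apply/andP; split; lra.
Qed.

Lemma gam_gt0 p : 0 < gam p.
Proof.
rewrite /gam; case: (ltP p 4%:E) => [_|h]; first by lra.
by have /andP[_ h'] := invp_le4 h; lra.
Qed.

Lemma kap_ge0 p : 0 <= kap p.
Proof. by rewrite /kap; case: ifP => _; lra. Qed.

Lemma Psi_gt0 p k : 0 < Psi p k.
Proof. by rewrite /Psi mulr_gt0 ?exprn_gt0 ?powR_gt0 ?ltr0n. Qed.

Lemma two_gam_gt1 p : 1 < 2 `^ gam p.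
Proof.
have := @gt0_ltr_powR R _ (gam_gt0 p) 1 2; rewrite powR1; apply; rewrite ?nnegrE //.
by rewrite ltr1n.
Qed.

Lemma PsiS p k : 2 `^ gam p * Psi p k <= Psi p k.+1.
Proof.
rewrite /Psi exprS -!mulrA !ler_wpM2l ?exprn_ge0 ?powR_ge0 //.
by rewrite ge0_ler_powR ?kap_ge0 ?nnegrE // ler_nat.
Qed.

Lemma Psi_mono p k : Psi p k <= Psi p k.+1.
Proof.
by rewrite (le_trans _ (PsiS p k)) // ler_peMl ?(ltW (Psi_gt0 p k)) // ltW ?two_gam_gt1.
Qed.

Lemma Psi_ge1 p k : 1 <= Psi p k.
Proof.
elim: k => [|k IH]; first by rewrite /Psi expr0 mul1r powR1.
by rewrite (le_trans IH) // Psi_mono.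
Qed.

Lemma geometric_sum_le (rho : R) n : 0 <= rho < 1 ->
  \sum_(0 <= j < n) rho ^+ j <= (1 - rho)^-1.
Proof.
move=> /andP[r0 r1]; have d0 : 0 < 1 - rho by lra.
rewrite -[leRHS]mul1r ler_pdivlMr //.
suff -> : (\sum_(0 <= j < n) rho ^+ j) * (1 - rho) = 1 - rho ^+ n.
  by rewrite gerBl exprn_ge0.
elim: n => [|n IH]; first by rewrite big_geq // expr0 mul0r subrr.
by rewrite big_nat_recr //= mulrDl IH exprS; ring.
Qed.

Lemma geometric_sum_gt1 (rho : R) n : 1 < rho ->
  \sum_(0 <= j < n) rho ^+ j <= (rho - 1)^-1 * rho ^+ n.
Proof.
move=> r1; have d0 : 0 < rho - 1 by lra.
rewrite mulrC ler_pdivlMr //.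
suff -> : (\sum_(0 <= j < n) rho ^+ j) * (rho - 1) = rho ^+ n - 1 by lra.
elim: n => [|n IH]; first by rewrite big_geq // expr0 mul0r subrr.
by rewrite big_nat_recr //= mulrDl IH exprS; ring.
Qed.

Lemma nrm_le_unif p (F : R -> R[i]) (B : R) : (0 < p)%E -> cmeas F -> 0 <= B ->
  (forall x, modc (F x) <= B) -> (nrm p F <= B%:E)%E.
Proof.
move=> + mF B0 FB; case: p => [r||//].
  rewrite lte_fin => r0; apply/nrm_leP => //.
  apply: (@le_trans _ _ (\int[@torus R]_x (cst (B `^ r)%:E) x)%E).
    apply: ge0_le_integral => //.
    - by move=> x _; rewrite lee_fin powR_ge0.
    - exact: cmeas_powRE.
    - by move=> x _; rewrite lee_fin ge0_ler_powR ?nnegrE ?modc_ge0 // ltW.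
  by rewrite integral_cst // torusT mule1.
by move=> _; apply/nrmy_leP; apply: torus_aeW.
Qed.

Lemma powR_nat_expn n j (t : R) : (n ^ j)%:R `^ t = (n%:R `^ t) ^+ j.
Proof.
rewrite natrX -powR_mulrn // -powRrM mulrC powRrM powR_mulrn ?powR_ge0 //.
Qed.

(* The weight of the arcs at level [2 ^ j] is [4 ^ (- j)], and there the
   integrand is of size [2 ^ (j r / 2)]; the sum over [j] is convergent, logarithmic
   or dominated by its last term according to the sign of [r / 2 - 2]. *)
Lemma level_sum_bound r : 0 < r -> exists2 C : R, 0 < C & forall k,
  1 + \sum_(0 <= j < k.+3) (2 ^ j.+1)%:R `^ (r / 2) * (2 / (2 ^ j)%:R ^+ 2)
  <= C * (2 ^ k)%:R `^ ((gam r%:E - 1/2) * r) * k.+1%:R `^ (kap r%:E * r).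
Proof.
move=> r0; pose c : R := 2 * 2 `^ (r / 2).
have c0 : 0 < c by rewrite mulr_gt0 // powR_gt0.
pose rho : R := 2 `^ (r / 2 - 2).
have term j : (2 ^ j.+1)%:R `^ (r / 2) * (2 / (2 ^ j)%:R ^+ 2) = c * rho ^+ j.
  rewrite /rho powRB ?pnatr_eq0 ?implybT // powR_mulrn // expr_div_n.
  rewrite powR_nat_expn exprS natrX /c -!exprM [(2 * j)%N]mulnC.
  by field; rewrite expf_neq0 ?pnatr_eq0.
have sumE k : \sum_(0 <= j < k) (2 ^ j.+1)%:R `^ (r / 2) * (2 / (2 ^ j)%:R ^+ 2) =
    c * \sum_(0 <= j < k) rho ^+ j.
  by rewrite mulr_sumr; apply: eq_bigr => j _; rewrite term.
have rho0 : 0 < rho by rewrite powR_gt0.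
have [r4|r4|r4] := ltgtP r 4.
- exists (1 + c * (1 - rho)^-1).
    have rho1 : rho < 1.
      by rewrite -(powRr0 2) /rho gt1_ltr_powR ?ltr1n //; lra.
    by rewrite addr_gt0 // mulr_gt0 // invr_gt0 subr_gt0.
  move=> k; rewrite sumE /gam /kap lte_fin r4 eqe (lt_eqF r4) subrr !mul0r !powRr0 !mulr1.
  rewrite lerD2l ler_wpM2l ?(ltW c0) // geometric_sum_le // ltW //=.
  by rewrite -(powRr0 2) /rho gt1_ltr_powR ?ltr1n //; lra.
- have rho1 : 1 < rho by rewrite -(powRr0 2) /rho gt1_ltr_powR ?ltr1n //; lra.
  exists (1 + c * ((rho - 1)^-1 * rho ^+ 3)).
    by rewrite addr_gt0 // !mulr_gt0 ?exprn_gt0 // invr_gt0 subr_gt0.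
  move=> k; rewrite sumE /gam /kap lte_fin eqe (gt_eqF r4) ltNge (ltW r4) /= mul0r powRr0 mulr1.
  have -> : (1 - 2 * r^-1 - 1 / 2) * r = r / 2 - 2 by field; rewrite gt_eqF.
  rewrite powR_nat_expn -/rho mulrDl mul1r lerD //.
    by rewrite exprn_ege1 // ltW.
  have -> : c * ((rho - 1)^-1 * rho ^+ 3) * rho ^+ k = c * ((rho - 1)^-1 * rho ^+ k.+3).
    by rewrite -(addn3 k) exprD; ring.
  rewrite ler_wpM2l ?(ltW c0) //.
  exact: geometric_sum_gt1.
- exists (1 + c * 3); first by rewrite addr_gt0 // mulr_gt0.
  move=> k; rewrite sumE /gam /kap r4 ltxx eqxx /invp.
  have -> : (1 - 2 * 4^-1 - 1 / 2) * 4 = 0 :> R by field.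
  have -> : 1 / 4 * 4 = 1 :> R by field.
  rewrite powRr0 mulr1 powRr1 //.
  have -> : rho = 1 by rewrite /rho r4 (_ : 4 / 2 - 2 = 0) ?powRr0 //; field.
  under eq_bigr do rewrite expr1n.
  rewrite sumr_const_nat subn0 mulrDl mul1r lerD ?ler1n //.
  by rewrite -mulrA ler_wpM2l ?(ltW c0) // -natrM ler_nat; clear; lia.
Qed.

Lemma tent_nrm p : (0 < p)%E -> exists2 C : R, 0 < C & forall A k,
  (nrm p (tent_sum A (2 ^ k)) <= (C * 2 ^+ k * Psi p k)%:E)%E.
Proof.
case: p => [r|_|//]; last first.
  (* For [p = +oo] the trivial bound suffices: [2 l] terms of weight at most [l], and [Psi] is
     [l]. *)
  exists 2 => // A k.
  apply: nrm_le_unif => //; first exact: cmeas_tent_sum.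
    by rewrite !mulr_ge0 ?exprn_ge0 // ltW ?Psi_gt0.
  move=> x; rewrite /tent_sum (le_trans (modc_sum _ _ _)) //.
  apply: (@le_trans _ _ (\sum_(0 <= i < 2 * 2 ^ k) 2 ^+ k)).
    apply: ler_sum => i _; rewrite modcM modc_expi mulr1 modc_real normr_nat.
    by rewrite -natrX ler_nat tent_le.
  rewrite sumr_const_nat subn0 -[leLHS]mulr_natr natrM natrX mulrC -mulrA.
  rewrite /Psi /gam /kap /= mulr0 subr0 powRr0 powRr1 // mulr1.
  by rewrite mulrA.
rewrite lte_fin => r0; have [C C0 HC] := level_sum_bound r0.
have [c' c'0 tb] := tent_sum_bound R.
exists (c' `^ 2^-1 * C `^ r^-1); first by rewrite mulr_gt0 ?powR_gt0.
move=> A k; apply/nrm_leP => //.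
  by rewrite !mulr_ge0 ?powR_ge0 ?exprn_ge0 // ltW ?Psi_gt0.
apply: le_trans (tent_moment c'0 tb A k r0) _; rewrite lee_fin.
apply: (@le_trans _ _ ((c' * (2 ^ k)%:R ^+ 3) `^ (r / 2) *
   (C * (2 ^ k)%:R `^ ((gam r%:E - 1/2) * r) * k.+1%:R `^ (kap r%:E * r)))).
  by rewrite ler_wpM2l ?powR_ge0.
have e2 : 0 < (2 ^ k)%:R :> R by rewrite ltr0n expn_gt0.
rewrite -(natrX R 2 k) /Psi -powR_nat_expn; set l := (2 ^ k)%:R in e2 *.
set c := k.+1%:R `^ _; set d := k.+1%:R `^ _.
have cd : d `^ r = c by rewrite /d -powRrM.
rewrite le_eqVlt; apply/orP; left; apply/eqP.
have -> : l ^+ 3 = l `^ 3%:R by rewrite powR_mulrn // ltW.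
rewrite !powRM ?powR_ge0 ?mulr_ge0 ?powR_ge0 ?(ltW e2) ?(ltW c'0) ?(ltW C0) //.
rewrite cd -!powRrM mulVf ?gt_eqF // powRr1 ?ltW //.
rewrite (mulrC 2^-1 r).
have e : l `^ r * l `^ (gam r%:E * r) = l `^ (3%:R * (r / 2)) * l `^ ((gam r%:E - 1 / 2) * r).
  by rewrite -!powRD ?(gt_eqF e2) ?implybT //; congr (_ `^ _); field.
transitivity (c' `^ (r / 2) * C * c * (l `^ (3%:R * (r / 2)) * l `^ ((gam r%:E - 1 / 2) * r)));
  first by ring.
by rewrite -e; ring.
Qed.

Definition square_sum (w : nat -> R) A M x : R[i] :=
  \sum_(0 <= i < M) (w i)%:C * expi (((A + i) ^ 2)%:R * x).

Lemma cmeas_square_sum w A M : cmeas (square_sum w A M).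
Proof. by apply: cmeas_sum => i _; apply: cmeasZ; exact: cmeas_expi. Qed.

Definition ramp_down l (i : nat) : R := (l - i)%:R.
Definition ramp_up (i : nat) : R := i%:R.
Definition flat (i : nat) : R := 1.

Lemma square_sum_cat w A M N x :
  square_sum w A (M + N) x =
  square_sum w A M x + square_sum (fun i => w (M + i)%N) (A + M) N x.
Proof.
rewrite /square_sum (@big_cat_nat _ _ _ M) ?leq_addr //=; congr (_ + _).
by rewrite -{1}[M]add0n big_addn addKn; apply: eq_bigr => i _; rewrite addnC addnA.
Qed.

(** For [i < l], [2 l - i] is [2 (l - i)] plus the rising side of the tent; from [l] on it is the
    falling side alone. *)
Lemma ramp_down_double A l x :
  square_sum (ramp_down (2 * l)) A (2 * l) x =
  2%:C * square_sum (ramp_down l) A l x + tent_sum A l x.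
Proof.
have -> : square_sum (ramp_down l) A l x = square_sum (ramp_down l) A (2 * l) x.
  rewrite mul2n -addnn square_sum_cat [X in _ + X]big1 ?addr0 // => i _.
  by rewrite /ramp_down (_ : (l - (l + i))%N = 0%N) ?mul0r //; lia.
rewrite /square_sum /tent_sum mulr_sumr -big_split /=.
rewrite !big_nat; apply: eq_bigr => i /andP[_ il].
rewrite mulrA -mulrDl; congr (_ * _); rewrite -rmorphM -rmorphD /=; congr (_%:C).
by rewrite /ramp_down -natrM -natrD; congr (_%:R); rewrite /tent; move: il; clear; lia.
Qed.

(** Mirror image of the preceding identity: the shorter ramp now fills the second half, hence the
    base point [A + l]. *)
Lemma ramp_up_double A l x :
  square_sum ramp_up A (2 * l) x =
  2%:C * square_sum ramp_up (A + l) l x + tent_sum A l x.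
Proof.
pose w i : R := 2 * (i - l)%:R.
have -> : 2%:C * square_sum ramp_up (A + l) l x = square_sum w A (2 * l) x.
  rewrite mul2n -addnn square_sum_cat [X in X + _]big1_seq ?add0r => [|i].
    rewrite /square_sum mulr_sumr; apply: eq_bigr => i _.
    by rewrite mulrA -rmorphM /= /w addKn.
  rewrite mem_index_iota => /andP[_ /andP[_ il]].
  by rewrite /w (eqP (ltnW il)) mulr0 mul0r.
rewrite /square_sum /tent_sum -big_split /=.
rewrite !big_nat; apply: eq_bigr => i /andP[_ il].
rewrite -mulrDl; congr (_ * _); rewrite -rmorphD /=; congr (_%:C).
by rewrite /ramp_up /w -natrM -natrD; congr (_%:R); rewrite /tent; move: il; clear; lia.
Qed.

Lemma flat_ramps A l x :
  l%:R%:C * square_sum flat A l x =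
  square_sum (ramp_down l) A l x + square_sum ramp_up A l x.
Proof.
rewrite /square_sum mulr_sumr -big_split /= !big_nat; apply: eq_bigr => i /andP[_ il].
rewrite mulrA -mulrDl; congr (_ * _); rewrite -rmorphM -rmorphD /=; congr (_%:C).
by rewrite /flat /ramp_down /ramp_up mulr1 -natrD subnK // ltnW.
Qed.

(** Divided by [2 ^ k], the norm of a ramp of length [2 ^ k] increases by at most [C / 2 * Psi p k]
    under doubling. As [Psi] grows geometrically, the accumulated errors are of the order of the
    last one. *)
Theorem sharp_nrm p : (1 <= p)%E -> exists2 C : R, 0 < C & forall k A M,
  (M < 2 ^ k)%N -> (nrm p (square_sum flat A M) <= (C * Psi p k)%:E)%E.
Proof.
move=> p1; have p0 : (0 < p)%E by rewrite (lt_le_trans _ p1).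
have [C C0 HC] := tent_nrm p0.
set u := 2 `^ gam p; have u1 : 1 < u by exact: two_gam_gt1.
have u1' : 0 < u - 1 by lra.
(* The [1] covers the ramp of length [1]; the other term closes the doubling step, in which [Psi]
   gains the factor [u]. *)
pose D := 1 + C / (u - 1).
have D0 : 0 < D by rewrite addr_gt0 // divr_gt0.
have Pge k := ltW (Psi_gt0 p k).
have step k : (2 * (D * 2 ^+ k * Psi p k) + C * 2 ^+ k * Psi p k
      <= D * 2 ^+ k.+1 * Psi p k.+1)%R.
  apply: (@le_trans _ _ (D * 2 ^+ k.+1 * (u * Psi p k))); last first.
    by rewrite ler_wpM2l ?PsiS // mulr_ge0 ?exprn_ge0 // ltW.
  have : 0 <= 2 ^+ k * Psi p k by rewrite mulr_ge0 ?exprn_ge0.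
  rewrite exprS; set y := 2 ^+ k * Psi p k => y0.
  have -> : 2 * (D * 2 ^+ k * Psi p k) + C * 2 ^+ k * Psi p k = (2 * D + C) * y by rewrite /y; ring.
  have -> : D * (2 * 2 ^+ k) * (u * Psi p k) = 2 * D * u * y by rewrite /y; ring.
  rewrite ler_wpM2r // /D.
  have -> : 2 * (1 + C / (u - 1)) * u = 2 * (1 + C / (u - 1)) + 2 * (u - 1) + 2 * C.
    by field; rewrite gt_eqF.
  by move: (C / (u - 1)) => v; lra.
have down k : forall A, (nrm p (square_sum (ramp_down (2 ^ k)) A (2 ^ k)) <=
  (D * 2 ^+ k * Psi p k)%:E)%E.
  elim: k => [|k IH] A.
    apply: (@le_trans _ _ 1%:E).
      apply: nrm_le_unif => //; first exact: cmeas_square_sum.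
      by move=> x; rewrite /square_sum big_nat1 modcM modc_expi mulr1 modc_real /ramp_down normr1.
    rewrite lee_fin expr0 mulr1 -[leLHS]mulr1 ler_pM ?Psi_ge1 //.
    by rewrite /D lerDl divr_ge0 // ltW.
  rewrite expnS (eq_nrm p (ramp_down_double A (2 ^ k))).
  apply: le_trans (_ : ((2 * (D * 2 ^+ k * Psi p k) + C * 2 ^+ k * Psi p k)%R%:E <= _)%E);
    last by rewrite lee_fin.
  apply: nrmD => //.
  - by apply: cmeasZ; exact: cmeas_square_sum.
  - exact: cmeas_tent_sum.
  - apply: nrmZ => //; first exact: cmeas_square_sum.
    by rewrite !mulr_ge0 ?exprn_ge0 // ltW.
have up k : forall A, (nrm p (square_sum ramp_up A (2 ^ k)) <= (D * 2 ^+ k * Psi p k)%:E)%E.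
  elim: k => [|k IH] A.
    apply: (@le_trans _ _ 1%:E).
      apply: nrm_le_unif => //; first exact: cmeas_square_sum.
      by move=> x; rewrite /square_sum big_nat1 mul0r modc0.
    rewrite lee_fin expr0 mulr1 -[leLHS]mulr1 ler_pM ?Psi_ge1 //.
    by rewrite /D lerDl divr_ge0 // ltW.
  rewrite expnS (eq_nrm p (ramp_up_double A (2 ^ k))).
  apply: le_trans (_ : ((2 * (D * 2 ^+ k * Psi p k) + C * 2 ^+ k * Psi p k)%R%:E <= _)%E);
    last by rewrite lee_fin.
  apply: nrmD => //.
  - by apply: cmeasZ; exact: cmeas_square_sum.
  - exact: cmeas_tent_sum.
  - apply: nrmZ => //; first exact: cmeas_square_sum.
    by rewrite !mulr_ge0 ?exprn_ge0 // ltW.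
have dyadic k A : (nrm p (square_sum flat A (2 ^ k)) <= (2 * D * Psi p k)%:E)%E.
  have e2 : 0 < 2 ^+ k :> R by rewrite exprn_gt0.
  have -> : square_sum flat A (2 ^ k) = fun x => ((2 ^+ k)^-1%:C *
      (square_sum (ramp_down (2 ^ k)) A (2 ^ k) x + square_sum ramp_up A (2 ^ k) x))%R.
    apply/funext => x; rewrite -flat_ramps mulrA -rmorphM /= natrX mulVf ?(gt_eqF e2) //.
    by rewrite mul1r.
  have -> : 2 * D * Psi p k = (2 ^+ k)^-1 * (D * 2 ^+ k * Psi p k + D * 2 ^+ k * Psi p k).
    by field; rewrite gt_eqF.
  apply: nrmZ => //.
  - by apply: cmeasD; exact: cmeas_square_sum.
  - by rewrite addr_ge0 // !mulr_ge0 // ltW.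
  - by apply: nrmD => //; exact: cmeas_square_sum.
(* The solution [E] of [2 D + E = E u]: a general length loses its leading power of two, at cost
   [2 D], and the remainder is treated by induction. *)
exists (2 * D / (u - 1)); first by rewrite divr_gt0 // mulr_gt0.
elim=> [|k IH] A M Mk.
  rewrite (_ : M = 0%N); last by move: Mk; rewrite expn0; clear; lia.
  rewrite (_ : square_sum flat A 0 = fun=> 0); last by apply/funext => x;
    rewrite /square_sum big_geq.
  by rewrite nrm0 // lee_fin mulr_ge0 // divr_ge0 ?mulr_ge0 // ltW.
have [Mk'|Mk'] := ltnP M (2 ^ k).
  apply: le_trans (IH A M Mk') _; rewrite lee_fin ler_wpM2l ?Psi_mono //.
  by rewrite divr_ge0 // ?mulr_ge0 // ltW.
rewrite -(subnKC Mk') (eq_nrm p (square_sum_cat flat A (2 ^ k) (M - 2 ^ k))).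
apply: le_trans (_ : ((2 * D * Psi p k + 2 * D / (u - 1) * Psi p k)%R%:E <= _)%E).
  apply: nrmD => //; try exact: cmeas_square_sum.
  by apply: IH; move: Mk Mk'; rewrite expnS; clear; lia.
rewrite lee_fin -mulrDl.
apply: (@le_trans _ _ (2 * D / (u - 1) * (u * Psi p k))); last first.
  by rewrite ler_wpM2l ?PsiS // divr_ge0 ?mulr_ge0 // ltW.
rewrite mulrA ler_wpM2r //.
rewrite le_eqVlt; apply/orP; left; apply/eqP.
by field; rewrite gt_eqF.
Qed.

End SharpSums.

(** * Restoring the coefficients *)

Section BlockSums.
Variable R : realType.
Implicit Types (x r s : R) (p : \bar R) (k l A B M : nat).

Lemma square_sum_abel (w : nat -> R) A M x :
  square_sum w A M x =
  \sum_(0 <= i < M) (w i - w i.+1)%:C * square_sum (@flat R) A i.+1 x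
  + (w M)%:C * square_sum (@flat R) A M x.
Proof.
have flatE j : square_sum (@flat R) A j x = \sum_(0 <= i < j) expi (((A + i) ^ 2)%:R * x).
  by apply: eq_bigr => i _; rewrite mul1r.
elim: M => [|M IH]; first by rewrite flatE /square_sum !big_geq // mulr0 addr0.
rewrite /square_sum big_nat_recr //= -/(square_sum w A M x) IH.
rewrite [in RHS]big_nat_recr //= -!/(square_sum _ _ _ _) !flatE.
rewrite !big_nat_recr //= rmorphB /=; ring.
Qed.

(** The weights produced by Abel summation are nonnegative and telescope to [w 0]. *)
Lemma square_sum_monotone p (w : nat -> R) A M (C : R) :
  (1 <= p)%E -> (forall i, 0 <= w i) -> (forall i, (i < M)%N -> w i.+1 <= w i) -> 0 <= C ->
  (forall N, (N <= M)%N -> (nrm p (square_sum (@flat R) A N) <= C%:E)%E) ->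
  (nrm p (square_sum w A M) <= (w 0%N * C)%:E)%E.
Proof.
move=> p1 w0 wS C0 HC; have p0 : (0 < p)%E by rewrite (lt_le_trans _ p1).
rewrite (eq_nrm p (square_sum_abel w A M)).
have tele : \sum_(0 <= i < M) (w i - w i.+1) * C + w M * C = w 0%N * C.
  rewrite -mulr_suml -mulrDl; congr (_ * _).
  by rewrite (@telescope_sumr_eq _ 0%N M (fun i => - w i)) // => [|i _]; ring.
rewrite -tele; apply: nrmD => //.
- by apply: cmeas_sum => i _; apply: cmeasZ; exact: cmeas_square_sum.
- by apply: cmeasZ; exact: cmeas_square_sum.
- have -> : (fun x => \sum_(0 <= i < M) (w i - w i.+1)%:C * square_sum (@flat R) A i.+1 x)%R =
    (fun x => \sum_(0 <= i < M | (0 <= i < M)%N)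
      (w i - w i.+1)%:C * square_sum (@flat R) A i.+1 x)%R.
    by apply/funext => x; rewrite big_nat.
  rewrite big_nat; apply: (@nrm_sum R nat (index_iota 0 M) (fun i => (0 <= i < M)%N)
    (fun i x => (w i - w i.+1)%:C * square_sum (@flat R) A i.+1 x)%R) => // i /andP[_ iM].
    by apply: cmeasZ; exact: cmeas_square_sum.
  apply: nrmZ => //; first exact: cmeas_square_sum.
    by rewrite subr_ge0 wS.
  exact: HC.
- by apply: nrmZ => //; [exact: cmeas_square_sum|exact: HC].
Qed.

Definition block_sum s A B x : R[i] :=
  \sum_(A <= n < B) (coef s n)%:C * expi ((n ^ 2)%:R * x).

Lemma cmeas_block_sum s A B : cmeas (block_sum s A B).
Proof. by apply: cmeas_sum => i _; apply: cmeasZ; exact: cmeas_expi. Qed.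

Lemma block_sum_cat s A M B x : (A <= M <= B)%N ->
  block_sum s A B x = block_sum s A M x + block_sum s M B x.
Proof. by move=> /andP[AM MB]; rewrite /block_sum (big_cat_nat AM MB). Qed.

Lemma block_sumE s A B x :
  block_sum s A B x = square_sum (fun i => coef s (A + i)) A (B - A) x.
Proof.
rewrite /block_sum /square_sum -{1}[A]add0n big_addn.
by apply: eq_bigr => i _; rewrite addnC.
Qed.

Lemma coef_ge0 s n : 0 <= coef s n.
Proof. exact: powR_ge0. Qed.

Lemma coef_le s m n : 0 <= s -> (0 < m <= n)%N -> coef s n <= coef s m.
Proof.
move=> s0 /andP[m0 mn]; rewrite /coef !powRN.
rewrite lef_pV2 ?posrE ?powR_gt0 ?ltr0n ?(leq_trans m0) //.
by rewrite ge0_ler_powR ?nnegrE ?mulr_ge0 // ler_nat.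
Qed.

(** The linear factor accommodates the logarithm at [p = 4] when dyadic blocks are summed. *)
Lemma sum_arith_geom (v : R) m : 0 <= v < 1 ->
  \sum_(0 <= j < m) v ^+ j * j.+2%:R <= (1 - v)^-1 ^+ 2 + (1 - v)^-1.
Proof.
move=> /andP[v0 v1]; have d0 : 0 < 1 - v by lra.
have -> : \sum_(0 <= j < m) v ^+ j * j.+2%:R =
   \sum_(0 <= j < m) v ^+ j * j.+1%:R + \sum_(0 <= j < m) v ^+ j.
  by rewrite -big_split; apply: eq_bigr => j _; rewrite -(@natr1 _ j.+1) mulrDr mulr1.
rewrite lerD //; last by rewrite geometric_sum_le // v0.
rewrite exprVn -[leRHS]mul1r ler_pdivlMr ?exprn_gt0 //.
suff -> : (\sum_(0 <= j < m) v ^+ j * j.+1%:R) * (1 - v) ^+ 2 =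
    1 - m.+1%:R * v ^+ m + m%:R * v ^+ m.+1.
  rewrite -(@natr1 _ m) exprS.
  have : 0 <= v ^+ m by rewrite exprn_ge0.
  have : 0 <= m%:R * (v ^+ m * (1 - v)) by rewrite !mulr_ge0 ?exprn_ge0 // ltW.
  move: (m%:R : R) (v ^+ m) => a b; lra.
elim: m => [|m IH]; first by rewrite big_geq // expr0; ring.
rewrite big_nat_recr //= mulrDl IH !exprS -!natr1; ring.
Qed.

(** Successive dyadic blocks have bounds in ratio [v = 2 ^ (gam p - 2 s) < 1], apart from the
    logarithm, so the first block dominates and the bound does not depend on [B]. *)
Theorem block_nrm p s : (1 <= p)%E -> 0 < s -> gam p < 2 * s ->
  exists2 C : R, 0 < C & forall k A B, (2 ^ k <= A)%N ->
    (nrm p (block_sum s A B) <= (C * (2 ^ k)%:R `^ (- (2 * s)) * Psi p k)%:E)%E.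
Proof.
move=> p1 s0 gs; have p0 : (0 < p)%E by rewrite (lt_le_trans _ p1).
have [C C0 HC] := @sharp_nrm R p p1.
set u := 2 `^ gam p; pose v : R := 2 `^ (gam p - 2 * s).
have v0 : 0 < v by rewrite powR_gt0.
have v1 : v < 1 by rewrite -(powRr0 2) gt1_ltr_powR ?ltr1n //; lra.
have u0 : 0 < u by rewrite powR_gt0.
pose b k : R := C * (2 ^ k)%:R `^ (- (2 * s)) * Psi p k.+1.
have b0 k : 0 <= b k by rewrite /b !mulr_ge0 ?powR_ge0 // ltW ?Psi_gt0.
have one k A B : (2 ^ k <= A)%N -> (B <= 2 ^ k.+1)%N ->
    (nrm p (block_sum s A B) <= (b k)%:E)%E.
  move=> kA Bk; rewrite (eq_nrm p (block_sumE s A B)).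
  have A0 : (0 < A)%N by rewrite (leq_trans _ kA) // expn_gt0.
  have P0 := ltW (Psi_gt0 p k.+1).
  apply: le_trans (_ : ((coef s (A + 0) * (C * Psi p k.+1))%R%:E <= _)%E).
    apply: square_sum_monotone => //.
    - by move=> i; exact: coef_ge0.
    - by move=> i _; rewrite coef_le ?(ltW s0) // addn_gt0 A0 /= leq_add2l.
    - by rewrite mulr_ge0 // ltW.
    - move=> N NM; apply: HC; apply: leq_ltn_trans NM _.
      rewrite (leq_ltn_trans (leq_sub2r A Bk)) // ltn_subrL A0 expn_gt0 //.
  rewrite lee_fin /b addn0 mulrA [coef _ _ * C]mulrC ler_wpM2r // ler_wpM2l ?(ltW C0) //.
  by apply: coef_le; rewrite ?(ltW s0) // expn_gt0.
have many m : forall k A B, (2 ^ k <= A)%N -> (B <= 2 ^ (k + m))%N ->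
    (nrm p (block_sum s A B) <= (\sum_(0 <= j < m) b (k + j)%N)%R%:E)%E.
  elim: m => [|m IH] k A B kA Bk.
    rewrite big_geq // (_ : block_sum s A B = fun=> 0) ?nrm0 //.
    apply/funext => x; rewrite /block_sum big_geq //.
    by rewrite addn0 in Bk; exact: leq_trans Bk kA.
  rewrite big_nat_recl // addn0.
  have shift : \sum_(0 <= i < m) b (k + i.+1)%N = \sum_(0 <= i < m) b (k.+1 + i)%N.
    by apply: eq_bigr => i _; rewrite addnS.
  rewrite shift; have [Bs|Bs] := leqP B (2 ^ k.+1).
    apply: le_trans (one k A B kA Bs) _.
    by rewrite lee_fin lerDl sumr_ge0.
  have [As|As] := leqP (2 ^ k.+1) A.
    apply: le_trans (IH k.+1 A B As _) _; first by rewrite addSnnS.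
    by rewrite lee_fin lerDr.
  have cat x := @block_sum_cat s A (2 ^ k.+1) B x.
  rewrite (eq_nrm p (fun x => cat x _)) ?(ltnW As) ?(ltnW Bs) //.
  apply: nrmD => //; try exact: cmeas_block_sum.
    exact: one.
  by apply: IH => //; rewrite addSnnS.
exists (C * u * ((1 - v)^-1 ^+ 2 + (1 - v)^-1)).
  rewrite !mulr_gt0 // addr_gt0 ?exprn_gt0 // invr_gt0; lra.
move=> k A B kA.
(* A crude number of blocks is enough, since the sum of the block bounds is bounded uniformly. *)
have Bk : (B <= 2 ^ (k + B))%N.
  by rewrite (leq_trans (ltnW (ltn_expl B (isT : 1 < 2)%N))) // leq_pexp2l // leq_addl.
apply: le_trans (many B k A B kA Bk) _; rewrite lee_fin.
have bj j : b (k + j)%N <= C * u * ((2 ^ k)%:R `^ (- (2 * s)) * Psi p k) * (v ^+ j * j.+2%:R).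
  rewrite /b /Psi -/u.
  (* [k + j + 2 <= (k + 1) (j + 2)] separates the starting level from the summation index, and
     [kap p <= 1]. *)
  have k1 : (k + j).+2%:R `^ kap p <= k.+1%:R `^ kap p * j.+2%:R.
    apply: (@le_trans _ _ ((k.+1%:R * j.+2%:R) `^ kap p)).
      rewrite ge0_ler_powR ?kap_ge0 ?nnegrE // -natrM ler_nat; clear; nia.
    rewrite powRM // ler_wpM2l ?powR_ge0 // ler1_powR ?ler1n //.
    by rewrite /kap; case: ifP => _; lra.
  have e1 : (2 ^ (k + j))%:R `^ (- (2 * s)) * u ^+ j = (2 ^ k)%:R `^ (- (2 * s)) * v ^+ j.
    rewrite !powR_nat_expn exprD -mulrA -exprMn /u /v -powRD ?pnatr_eq0 ?implybT //.
    by rewrite [- _ + _]addrC.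
  have -> : C * (2 ^ (k + j))%:R `^ (- (2 * s)) * (u ^+ (k + j).+1 * (k + j).+2%:R `^ kap p) =
     C * ((2 ^ (k + j))%:R `^ (- (2 * s)) * u ^+ j) * (u * u ^+ k) * (k + j).+2%:R `^ kap p.
    by rewrite exprS exprD; ring.
  rewrite e1.
  have -> : C * u * ((2 ^ k)%:R `^ (- (2 * s)) * (u ^+ k * k.+1%:R `^ kap p)) * (v ^+ j * j.+2%:R)
    = C * ((2 ^ k)%:R `^ (- (2 * s)) * v ^+ j) * (u * u ^+ k) * (k.+1%:R `^ kap p * j.+2%:R)
      by ring.
  by rewrite ler_wpM2l // !mulr_ge0 ?powR_ge0 ?exprn_ge0 // ltW.
apply: le_trans (ler_sum _ (fun j _ => bj j)) _.
rewrite -mulr_sumr.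
have w0 : 0 <= C * u * ((2 ^ k)%:R `^ (- (2 * s)) * Psi p k).
  by rewrite !mulr_ge0 ?powR_ge0 // ltW ?Psi_gt0.
apply: le_trans (ler_wpM2l w0 (sum_arith_geom B _)) _; first by rewrite ltW.
by rewrite le_eqVlt; apply/orP; left; apply/eqP; ring.
Qed.

End BlockSums.

(** * Fatou's lemma and almost everywhere limits *)

Section Limits.
Variable R : realType.
Implicit Types (x r s B : R) (p : \bar R) (F G : R -> R[i]).

Notation mu := (@torus R).
Notation mR := (measurable_fun [set: measurableTypeR R]).

Lemma limn_einf_le (u : (\bar R)^nat) (b : \bar R) :
  (forall n, (u n <= b)%E) -> (limn_einf u <= b)%E.
Proof.
move=> ub; rewrite limn_einf_lim; apply: lime_le; first exact: is_cvg_einfs.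
apply: nearW => n; apply: le_trans (ub n).
by apply: ereal_inf_lbound; exists n => //=.
Qed.

Lemma measurable_limn_einf (f : nat -> R -> \bar R) : (forall j, mR (f j)) ->
  mR (fun x => limn_einf (f ^~ x)).
Proof.
move=> mf.
have -> : (fun x => limn_einf (f ^~ x)) = (fun x => - limn_esup (fun j => - f j x))%E.
  by apply/funext => x; rewrite -[limn_einf _]oppeK -limn_esupN.
apply: measurableT_comp => //; apply: measurable_fun_limn_esup => j.
exact: measurableT_comp.
Qed.

(** Stated through the real modulus, so that only the topology of [R] is involved. *)
Definition ctends (g : nat -> R[i]) (z : R[i]) : Prop :=
  (fun j => modc (g j - z)) @ \oo --> (0 : R).

Lemma ctends_mod (g : nat -> R[i]) z w : ctends g z ->
  (fun j => modc (g j - w)) @ \oo --> modc (z - w).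
Proof.
move=> gz; apply/cvgrPdist_le => e e0.
move/cvgrPdist_le: gz => /(_ e e0); apply: filterS => j.
rewrite sub0r normrN ger0_norm ?modc_ge0 // => h; apply: le_trans h.
have h1 : modc (g j - w) <= modc (g j - z) + modc (z - w).
  have -> : g j - w = (g j - z) + (z - w) by ring.
  exact: modcD.
have h2 : modc (z - w) <= modc (g j - z) + modc (g j - w).
  have -> : z - w = - (g j - z) + (g j - w) by ring.
  by rewrite (le_trans (modcD _ _)) // modcN.
by rewrite ler_norml; apply/andP; split; lra.
Qed.

(** [G] will be a fixed partial sum, so the conclusion bounds its distance from the limit. *)
Lemma fatou_nrm (g : nat -> R -> R[i]) F G p B : (0 < p)%E -> 0 <= B ->
  (forall j, cmeas (g j)) -> cmeas F -> cmeas G ->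
  (\forall x \ae mu, ctends (g ^~ x) (F x)) ->
  (forall j, (nrm p (fun x => g j x - G x)%R <= B%:E)%E) ->
  (nrm p (fun x => F x - G x)%R <= B%:E)%E.
Proof.
move=> p0 B0 mg mF mG gF gB.
case: p p0 gB => [r||//].
  rewrite lte_fin => r0 gB; apply/nrm_leP => //.
  have gB' j : (moment r (fun x => g j x - G x)%R <= (B `^ r)%:E)%E.
    by apply/nrm_leP.
  apply: (@le_trans _ _ (\int[mu]_x limn_einf (fun j => (modc (g j x - G x) `^ r)%:E))%E).
    apply: ae_ge0_le_integral => //.
    - by move=> x _; rewrite lee_fin powR_ge0.
    - by apply: cmeas_powRE; exact: cmeasB.
    - move=> x _; rewrite limn_einf_lim; apply: lime_ge; first exact: is_cvg_einfs.
      apply: nearW => n; apply: le_ereal_inf_tmp => _ [m _ <-].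
      by rewrite lee_fin powR_ge0.
    - apply: measurable_limn_einf => j; apply: cmeas_powRE; exact: cmeasB.
    - apply: torus_aeS gF => x gx _.
      suff -> : limn_einf (fun j => (modc (g j x - G x) `^ r)%:E) =
        (modc (F x - G x) `^ r)%:E by [].
      apply: (cvg_limn_einf_sup _).1; apply: cvg_EFin; first exact: nearW.
      have h := @ctends_mod (g ^~ x) (F x) (G x) gx.
      (* Continuity of the [r]-th power is deduced from its derivative, available only at positive
         points; the limit [0] is treated by hand. *)
      have [e0|e0] := eqVneq (modc (F x - G x)) 0.
        rewrite e0 in h *; rewrite powR0 ?gt_eqF //.
        apply/cvgrPdist_le => e ep; move/cvgrPdist_le: h => /(_ (e `^ r^-1)).
        rewrite powR_gt0 // => /(_ isT); apply: filterS => j.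
        rewrite !sub0r !normrN !ger0_norm ?powR_ge0 ?modc_ge0 // => hj.
        rewrite -[leRHS]powRr1 ?(ltW ep) // -(mulVf (lt0r_neq0 r0)) powRrM.
        by rewrite ge0_ler_powR ?nnegrE ?modc_ge0 ?powR_ge0 // ltW.
      have ep : 0 < modc (F x - G x) by rewrite lt0r e0 modc_ge0.
      apply: (@continuous_cvg nat R R _ _ (fun j => modc (g j x - G x)) (fun y => y `^ r)
        (modc (F x - G x)) _ h).
      apply: differentiable_continuous; apply/derivable1_diffP.
      by apply: derivable_powR; rewrite in_itv /= ep.
  apply: le_trans (fatou mu measurableT _ _) _.
  - by move=> j; apply: cmeas_powRE; exact: cmeasB.
  - by move=> j x _; rewrite lee_fin powR_ge0.
  exact: limn_einf_le.
move=> _ gB; apply/nrmy_leP.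
have all_j : \forall x \ae mu, forall j, modc (g j x - G x) <= B.
  by apply: ae_foralln => j; apply/nrmy_leP.
apply: torus_aeS (torus_aeI gF all_j) => x [gx gB'].
have h := @ctends_mod (g ^~ x) (F x) (G x) gx.
rewrite -(cvg_lim _ h) //; apply: limr_le; first by apply: cvgP h.
exact: nearW.
Qed.

Lemma ctends_of_summable (g : nat -> R[i]) (K : R) :
  (forall n, \sum_(0 <= j < n) modc (g j.+1 - g j) <= K) ->
  exists z, ctends g z /\ (fun j => complex.Re (g j)) @ \oo --> complex.Re z /\
    (fun j => complex.Im (g j)) @ \oo --> complex.Im z.
Proof.
move=> gK.
have part (f : R[i] -> R) : (forall z w, f (z - w) = f z - f w) ->
    (forall z, `|f z| <= modc z) -> cvgn (fun j => f (g j)).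
  move=> fB fle.
  have -> : (fun j => f (g j)) = (fun n => f (g 0%N) + series (telescope (fun j => f (g j))) n).
    by apply/funext => n; rewrite -(eq_sum_telescope (fun j => f (g j))).
  apply: is_cvgD; first exact: is_cvg_cst.
  apply: normed_cvg.
  pose w n := \sum_(0 <= j < n) `|telescope (fun j => f (g j)) j|.
  suff : cvgn w by [].
  apply: nondecreasing_is_cvgn.
    by apply/nondecreasing_seqP => n; rewrite /w [leRHS]big_nat_recr //= lerDl.
  exists K => _ [n _ <-]; apply: le_trans (gK n).
  by apply: ler_sum => j _; rewrite (_ : telescope _ j = f (g j.+1 - g j)) ?fle // fB.
have cRe := part _ (@ReB R) (@Re_le_modc R).
have ImB z w : complex.Im (z - w) = complex.Im z - complex.Im w :> R.
  by case: z w => [a b] [c d].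
have Im_le z : `|complex.Im z| <= modc z :> R.
  by rewrite -sqrtr_sqr ler_wsqrtr // lerDr sqr_ge0.
have cIm := part _ ImB Im_le.
set a := limn (fun j => complex.Re (g j)) in cRe *.
exists (a +i* limn (fun j => complex.Im (g j))); split; last by [].
rewrite /ctends; apply: (@squeeze_cvgr _ _ _ _ (fun=> 0)
   (fun j => `|complex.Re (g j) - a| + `|complex.Im (g j) - limn (fun j => complex.Im (g j))|)).
- apply: nearW => j; rewrite modc_ge0 /=.
  rewrite [X in modc X](_ : _ = (complex.Re (g j) - a)%:C
      + (complex.Im (g j) - limn (fun j => complex.Im (g j)))%:C * 'i%C); last first.
    by apply/eqP; rewrite eq_complex; case: (g j) => u v /=; apply/andP; split; apply/eqP; ring.
  rewrite (le_trans (modcD _ _)) // modcM !modc_real.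
  by rewrite [modc 'i%C](_ : _ = 1) ?mulr1 // /modc /cmod /= expr0n add0r expr1n sqrtr1.
- exact: cvg_cst.
- rewrite -[X in _ --> X](addr0 0); apply: cvgD.
    rewrite -(normr0 R); apply: cvg_norm; rewrite -(subrr a); apply: cvgB => //; exact: cvg_cst.
  rewrite -(normr0 R); apply: cvg_norm.
  rewrite -(subrr (limn (fun j => complex.Im (g j)))); apply: cvgB => //; exact: cvg_cst.
Qed.

(** The sum of the moduli of the increments has finite integral, hence is finite almost everywhere,
    and there the sequence converges. Upper limits of the two parts define a function that is
    measurable and agrees with the limit where it exists. *)
Lemma ae_limit (g : nat -> R -> R[i]) (b : nat -> R) (K : R) :
  (forall j, cmeas (g j)) ->
  (forall j, (nrm 1 (fun x => g j.+1 x - g j x)%R <= (b j)%:E)%E) ->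
  (forall j, 0 <= b j) -> (forall n, \sum_(0 <= j < n) b j <= K) ->
  exists2 F, cmeas F & \forall x \ae mu, ctends (g ^~ x) (F x).
Proof.
move=> mg gb b0 bK.
pose h x := (\sum_(0 <= j <oo) (modc (g j.+1 x - g j x))%:E)%E.
have md j : mR (fun x => (modc (g j.+1 x - g j x))%:E).
  by apply/measurable_EFinP; apply: cmeas_mod; exact: cmeasB.
have h0 x : (0 <= h x)%E by apply: nneseries_ge0 => j _ _; rewrite lee_fin modc_ge0.
have mh : mR h by apply: ge0_emeasurable_sum => // j x _ _; rewrite lee_fin modc_ge0.
have hint : mu.-integrable setT h.
  apply/integrableP; split => //.
  under eq_integral do rewrite gee0_abs //.
  rewrite integral_nneseries //; last by move=> j x _; rewrite lee_fin modc_ge0.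
  apply: (@le_lt_trans _ _ K%:E); last exact: ltry.
  apply: lime_le.
    by apply: is_cvg_nneseries => j _ _; apply: integral_ge0 => x _; rewrite lee_fin modc_ge0.
  apply: nearW => n; apply: (@le_trans _ _ (\sum_(0 <= j < n) (b j)%:E)%E).
    apply: lee_sum => j _.
    have := (@nrm_leP R 1 (fun x => g j.+1 x - g j x) (b j) ltr01 (b0 j)).1 (gb j).
    rewrite powRr1 // => hj; apply: le_trans hj.
    rewrite le_eqVlt; apply/orP; left; apply/eqP; apply: eq_integral => x _.
    by rewrite powRr1 ?modc_ge0.
  by rewrite sumEFin lee_fin.
have hfin := integrable_ae measurableT hint.
have conv : \forall x \ae mu, exists z, ctends (g ^~ x) z /\
    (fun j => complex.Re (g j x)) @ \oo --> complex.Re z /\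
    (fun j => complex.Im (g j x)) @ \oo --> complex.Im z.
  apply: torus_aeS hfin => x /(_ I) hx.
  apply: (@ctends_of_summable _ (fine (h x))) => n.
  rewrite -lee_fin fineK // -sumEFin; apply: nneseries_lim_ge => j _ _.
  by rewrite lee_fin modc_ge0.
pose fr x := fine (limn_esup (fun j => (complex.Re (g j x))%:E)).
pose fi x := fine (limn_esup (fun j => (complex.Im (g j x))%:E)).
exists (fun x => fr x +i* fi x).
  have fine_lim (u : nat -> R -> R) : (forall j, mR (u j)) ->
      mR (fun x => fine (limn_esup (fun j => (u j x)%:E))).
    move=> mu_; apply: measurableT_comp => //.
    by apply: measurable_fun_limn_esup => j; apply/measurable_EFinP.
  by split; apply: fine_lim => j; case: (mg j).
apply: torus_aeS conv => x [z [gz [gr gi]]].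
suff -> : fr x +i* fi x = z by [].
have lim_esup (u : nat -> R) l : u @ \oo --> l -> fine (limn_esup (fun j => (u j)%:E)) = l.
  move=> ul; rewrite (cvg_limn_einf_sup (l := l%:E) _).2 //.
  by apply: cvg_EFin => //; exact: nearW.
by rewrite /fr /fi (lim_esup _ _ gr) (lim_esup _ _ gi); case: (z).
Qed.

End Limits.

(** * The tail and its upper bound *)

Section TailFunction.
Variable R : realType.
Implicit Types (x r s B : R) (p : \bar R) (F G : R -> R[i]) (X A k : nat).

Notation mu := (@torus R).
Notation mR := (measurable_fun [set: measurableTypeR R]).

(** If [2 ^ j < X] the smaller sum is empty; the maximum covers this case and stays at least
    [2 ^ j], as [block_nrm] requires. *)
Lemma block_sum_incr s X j x :
  block_sum s X (2 ^ j.+1) x - block_sum s X (2 ^ j) x =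
  block_sum s (maxn X (2 ^ j)) (2 ^ j.+1) x.
Proof.
have [Xj|jX] := leqP X (2 ^ j).
  rewrite (block_sum_cat _ _ (M := (2 ^ j)%N)) ?Xj ?leq_pexp2l //; ring.
by rewrite [X in _ - X]/block_sum big_geq ?subr0 // ltnW.
Qed.

Definition decay p s k : R := (2 ^ k)%:R `^ (- (2 * s)) * Psi p k.

Lemma decay_ge0 p s k : 0 <= decay p s k.
Proof. by rewrite mulr_ge0 ?powR_ge0 // ltW ?Psi_gt0. Qed.

Lemma decayE p s k : decay p s k = (2 `^ (gam p - 2 * s)) ^+ k * k.+1%:R `^ kap p.
Proof.
rewrite /decay /Psi mulrA powR_nat_expn -exprMn -powRD ?pnatr_eq0 ?implybT //.
by rewrite [- _ + _]addrC.
Qed.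

Lemma decay_le p s k : gam p < 2 * s ->
  decay p s k <= (2 `^ (gam p - 2 * s)) ^+ k * k.+2%:R.
Proof.
move=> gs; rewrite decayE ler_wpM2l ?exprn_ge0 ?powR_ge0 //.
apply: (@le_trans _ _ k.+1%:R); last by rewrite ler_nat.
rewrite ler1_powR ?ler1n //.
by rewrite /kap; case: ifP => _; lra.
Qed.

Lemma decay_base p s : gam p < 2 * s -> 0 <= 2 `^ (gam p - 2 * s) < 1.
Proof.
move=> gs; rewrite powR_ge0 /=; have := @gt1_ltr_powR R 2 (gam p - 2 * s) 0.
by rewrite powRr0; apply; lra.
Qed.

Lemma decay_sum p s : gam p < 2 * s ->
  exists K, forall n, \sum_(0 <= k < n) decay p s k <= K.
Proof.
move=> gs; set v := 2 `^ (gam p - 2 * s).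
exists ((1 - v)^-1 ^+ 2 + (1 - v)^-1) => n.
apply: le_trans (sum_arith_geom n (decay_base gs)).
by apply: ler_sum => k _; exact: decay_le.
Qed.

Lemma decay_cvg0 p s : gam p < 2 * s -> decay p s @ \oo --> (0 : R).
Proof.
move=> gs; have [K HK] := decay_sum gs.
apply: cvg_series_cvg_0; apply: nondecreasing_is_cvgn.
  apply/nondecreasing_seqP => n.
  by rewrite [leRHS]/series /= big_nat_recr //= lerDl decay_ge0.
by exists K => _ [n _ <-]; exact: HK.
Qed.

(** Free of the exponent, so one function serves every [p]. Only dyadic partial sums are required to
    converge pointwise; norm convergence of all partial sums is [tail_near]. *)
Definition is_tail s X F :=
  cmeas F /\ \forall x \ae mu, ctends (fun j => block_sum s X (2 ^ j) x) (F x).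

Lemma gam1 : gam (1%:E : \bar R) = 1/2.
Proof. by rewrite /gam lte_fin ltr1n. Qed.

Lemma tail_exists s X : 1/4 < s -> exists F, is_tail s X F.
Proof.
move=> s4; have s0 : 0 < s by lra.
have gs : gam (1%:E : \bar R) < 2 * s by rewrite gam1; lra.
have [C C0 HC] := @block_nrm R 1%:E s (lexx _) s0 gs.
have [K HK] := decay_sum gs.
have [F mF lF] : exists2 F, cmeas F &
    \forall x \ae mu, ctends (fun j => block_sum s X (2 ^ j) x) (F x).
  apply: (@ae_limit R (fun j => block_sum s X (2 ^ j)) (fun j => C * decay 1%:E s j) (C * K)).
  - by move=> j; exact: cmeas_block_sum.
  - move=> j; rewrite (eq_nrm _ (@block_sum_incr s X j)) mulrA.
    by apply: HC; exact: leq_maxr.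
  - by move=> j; rewrite mulr_ge0 ?decay_ge0 // ltW.
  - by move=> n; rewrite -mulr_sumr ler_wpM2l // ltW.
by exists F.
Qed.

(** Comparing [|F|] with [B] gives [|F|^r <= B^r + B^(r - 3) |F|^3], whose integral is at most
    [2 B^r] since the torus has mass [1]. This replaces Hoelder's inequality and covers [r < 1]. *)
Lemma nrm_low_exponent r F B : 0 < r -> r <= 3 -> 0 < B -> cmeas F ->
  (nrm 3%:E F <= B%:E)%E -> (nrm r%:E F <= (2 `^ r^-1 * B)%:E)%E.
Proof.
move=> r0 r3 B0 mF /nrm_leP => /(_ (ltr0n _ 3) (ltW B0)) h.
apply/nrm_leP => //; first by rewrite mulr_ge0 ?powR_ge0 // ltW.
rewrite powRM ?powR_ge0 ?(ltW B0) // -powRrM mulVf ?gt_eqF // powRr1 //.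
apply: (@le_trans _ _ (\int[mu]_x ((B `^ r)%:E + (B `^ (r - 3))%:E * (modc (F x) `^ 3)%:E))%E).
  apply: ge0_le_integral => //.
  - by move=> x _; rewrite lee_fin powR_ge0.
  - exact: cmeas_powRE.
  - apply/measurable_EFinP; apply: measurable_funD => //.
    by apply: measurable_funM => //; exact: cmeas_powR.
  - move=> x _; rewrite -EFinM -EFinD lee_fin.
    have m0 := modc_ge0 (F x).
    have [mB|Bm] := leP (modc (F x)) B.
      apply: (@le_trans _ _ (B `^ r)).
        by rewrite ge0_ler_powR ?nnegrE ?(ltW r0) ?(ltW B0).
      by rewrite lerDl mulr_ge0 ?powR_ge0.
    apply: (@le_trans _ _ (B `^ (r - 3) * modc (F x) `^ 3)); last first.
      by rewrite lerDr powR_ge0.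
    have mp : 0 < modc (F x) by rewrite (lt_trans B0).
    have -> : modc (F x) `^ r = modc (F x) `^ (r - 3) * modc (F x) `^ 3.
      by rewrite -powRD ?subrK // (gt_eqF mp) implybT.
    rewrite ler_wpM2r ?powR_ge0 //.
    rewrite -(opprB 3 r) !powRN lef_pV2 ?posrE ?powR_gt0 //.
    by rewrite ge0_ler_powR ?nnegrE ?(ltW B0) ?(ltW Bm) // subr_ge0.
rewrite ge0_integralD //; last 3 first.
- by move=> x _; rewrite lee_fin powR_ge0.
- by move=> x _; rewrite -EFinM lee_fin mulr_ge0 ?powR_ge0.
- apply/measurable_EFinP; apply: measurable_funM => //; exact: cmeas_powR.
rewrite (integral_cst _ measurableT (B `^ r)%:E) torusT mule1.
rewrite ge0_integralZl_EFin ?powR_ge0 //; last 2 first.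
- by move=> x _; rewrite lee_fin powR_ge0.
- exact: cmeas_powRE.
apply: (@le_trans _ _ ((B `^ r)%:E + (B `^ (r - 3))%:E * (B `^ 3)%:E)%E).
  by rewrite leeD2l // lee_wpmul2l ?lee_fin ?powR_ge0.
rewrite -EFinM -EFinD lee_fin -powRD ?(gt_eqF B0) ?implybT // subrK.
by rewrite [leRHS]mulrDl mul1r.
Qed.

Lemma tail_nrm_ge1 p s : (1 <= p)%E -> 0 < s -> gam p < 2 * s ->
  exists2 C : R, 0 < C & forall X F k A, is_tail s X F -> (X <= A)%N -> (2 ^ k <= A)%N ->
    (nrm p (fun x => F x - block_sum s X A x)%R <= (C * decay p s k)%:E)%E.
Proof.
move=> p1 s0 gs; have [C C0 HC] := block_nrm p1 s0 gs.
exists C => // X F k A [mF lF] XA kA.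
apply: (@fatou_nrm R (fun j => block_sum s X (2 ^ (j + A)))).
- by rewrite (lt_le_trans _ p1).
- by rewrite mulr_ge0 ?decay_ge0 // ltW.
- by move=> j; exact: cmeas_block_sum.
- exact: mF.
- exact: cmeas_block_sum.
- apply: torus_aeS lF => x; rewrite /ctends => h.
  by rewrite (cvg_shiftn A (fun j => modc (block_sum s X (2 ^ j) x - F x))).
move=> j; have Aj : (A <= 2 ^ (j + A))%N.
  by rewrite (leq_trans (ltnW (ltn_expl A (isT : 1 < 2)%N))) // leq_pexp2l // leq_addl.
have E x : block_sum s X (2 ^ (j + A)) x - block_sum s X A x = block_sum s A (2 ^ (j + A)) x.
  by rewrite (@block_sum_cat R s X A) ?XA //; ring.
by rewrite (eq_nrm p E) mulrA; exact: HC.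
Qed.

(** Below [3] the bound comes from exponent [3], which has the same [gam] and [kap] and for which
    Minkowski holds. Taking [A = X] bounds the tail itself; letting [A] grow gives convergence of
    the partial sums. *)
Lemma tail_nrm p s : (0 < p)%E -> 0 < s -> gam p < 2 * s ->
  exists2 C : R, 0 < C & forall X F k A, is_tail s X F -> (X <= A)%N -> (2 ^ k <= A)%N ->
    (nrm p (fun x => F x - block_sum s X A x)%R <= (C * decay p s k)%:E)%E.
Proof.
move=> p0 s0 gs; have [p3|p3] := leP 3%:E p.
  by apply: tail_nrm_ge1 => //; apply: le_trans p3; rewrite lee_fin ler1n.
case: p p0 gs p3 => [r||] // r0 gs r3; rewrite lte_fin in r0; rewrite lte_fin in r3.
have g3 : gam (3%:E : \bar R) = gam r%:E.
  rewrite /gam !lte_fin ltr_nat /= ifT //.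
  by rewrite (lt_trans r3) // ltr_nat.
have k3 : kap (3%:E : \bar R) = kap r%:E.
  rewrite /kap !eqe ifF; last by apply/negbTE; rewrite eqr_nat.
  by rewrite ifF // lt_eqF // (lt_trans r3) // ltr_nat.
have D3 k : decay 3%:E s k = decay r%:E s k by rewrite /decay /Psi g3 k3.
have gs3 : gam (3%:E : \bar R) < 2 * s by rewrite g3.
have p13 : (1%:E <= 3%:E :> \bar R)%E by rewrite lee_fin ler1n.
have [C C0 HC] := tail_nrm_ge1 p13 s0 gs3.
exists (2 `^ r^-1 * C); first by rewrite mulr_gt0 // powR_gt0.
move=> X F k A tF XA kA; rewrite -mulrA -D3.
apply: nrm_low_exponent => //; first exact: ltW.
- by rewrite mulr_gt0 // /decay mulr_gt0 ?Psi_gt0 // powR_gt0 // ltr0n expn_gt0.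
- by case: tF => mF _; apply: cmeasB => //; exact: cmeas_block_sum.
- exact: HC.
Qed.

Lemma nrmN p F : nrm p (fun x => - F x) = nrm p F.
Proof. by rewrite !nrmE; apply: eq_Lnorm => x /=; rewrite modcN. Qed.

Lemma tail_near p s X F : (0 < p)%E -> 0 < s -> gam p < 2 * s -> is_tail s X F ->
  forall e, 0 < e -> exists M, forall A, (M <= A)%N ->
    (nrm p (fun x => F x - block_sum s X A x)%R <= e%:E)%E.
Proof.
move=> p0 s0 gs tF e e0; have [C C0 HC] := tail_nrm p0 s0 gs.
have /cvgrPdist_le/(_ (e / C)) := decay_cvg0 gs.
rewrite divr_gt0 // => /(_ isT) [k _ /(_ k (leqnn k))] /=.
rewrite sub0r normrN ger0_norm ?decay_ge0 // ler_pdivlMr // => hk.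
exists (maxn X (2 ^ k)) => A; rewrite geq_max => /andP[XA kA].
apply: le_trans (HC X F k A tF XA kA) _.
by rewrite lee_fin mulrC.
Qed.

Lemma cvge0_le (u : nat -> \bar R) : (forall n, (0 <= u n)%E) ->
  (forall e : R, 0 < e -> exists M, forall n, (M <= n)%N -> (u n <= e%:E)%E) ->
  u @ \oo --> 0%E.
Proof.
move=> u0 ue; apply/fine_cvgP; split.
  have [M HM] := ue 1 ltr01; exists M => // n /= Mn.
  by rewrite ge0_fin_numE // (le_lt_trans (HM n Mn)) // ltry.
apply/cvgrPdist_le => e e0; have [M HM] := ue e e0; exists M => // n /= Mn.
rewrite sub0r normrN ger0_norm ?fine_ge0 // -lee_fin fineK ?HM //.
by rewrite ge0_fin_numE // (le_lt_trans (HM n Mn)) // ltry.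
Qed.

End TailFunction.

(** * Counting solutions of a^2 + b^2 = c^2 + d^2 *)

Section QuadrupleCount.
Variable R : realType.
Implicit Types (X n d u : nat).

Lemma ler_sum_sub (I : eqType) (s t : seq I) (f : I -> R) :
  uniq s -> {subset s <= t} -> (forall i, 0 <= f i) ->
  \sum_(i <- s) f i <= \sum_(i <- t) f i.
Proof.
move=> us st f0; elim: s t us st => [|a s IH] t /=.
  by move=> _ _; rewrite big_nil sumr_ge0.
move=> /andP[as_ us] st; rewrite big_cons [leRHS](big_rem a) ?st ?mem_head //= lerD2l.
apply: IH => // i si; have ai : i != a by apply: contraNneq as_ => <-.
have : i \in t by rewrite st // inE si orbT.
by rewrite (perm_mem (perm_to_rem (st a (mem_head _ _)))) inE (negbTE ai).
Qed.

(** Gauss's divisor identity, over a range that can be shared by many [g] so that sums can be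
    interchanged. *)
Lemma totient_sum_range g N : (0 < g)%N -> (g < N)%N ->
  (\sum_(1 <= d < N | d %| g) totient d)%N = g.
Proof.
move=> g0 gN; rewrite (@big_cat_nat _ _ _ g.+1) //=.
rewrite [X in (_ + X)%N]big1_seq ?addn0; last first.
  move=> i /andP[ig]; rewrite mem_index_iota => /andP[gi _].
  by have := dvdn_leq g0 ig; rewrite leqNgt gi.
rewrite -[RHS](cyclic.sum_totient_dvd g) -(big_mkord (fun d => (d %| g)%N) totient).
by rewrite [RHS]big_ltn_cond // dvd0n eqn0Ngt g0.
Qed.

Lemma sum_inv_sq_multiples n d : (0 < d)%N ->
  \sum_(1 <= m < n.+1) (d %| m)%N%:R * (m%:R ^+ 2)^-1 <= 3 * (d%:R ^+ 2)^-1 :> R.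
Proof.
move=> d0; have dR : 0 < d%:R :> R by rewrite ltr0n.
pose s := [seq m <- index_iota 1 n.+1 | (d %| m)%N].
have -> : \sum_(1 <= m < n.+1) (d %| m)%N%:R * (m%:R ^+ 2)^-1 =
   \sum_(m <- s) (d%:R ^+ 2)^-1 * invsq R (m %/ d).
  rewrite big_filter [RHS]big_mkcond /=; apply: eq_big_seq => m.
  rewrite mem_index_iota => /andP[m0 _]; case: ifP => [dm|_]; last by rewrite mul0r.
  have k0 : (0 < m %/ d)%N by rewrite divn_gt0 // dvdn_leq.
  by rewrite mul1r /invsq (maxn_idPr k0) -{1}(divnK dm) natrM exprMn invfM mulrC.
rewrite -mulr_sumr mulrC ler_wpM2r ?invr_ge0 ?sqr_ge0 //.
apply: le_trans (sum_invsq R n.+1).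
rewrite -(big_map (fun m => m %/ d)%N predT (invsq R)) /=.
apply: ler_sum_sub; last by move=> i; exact: invsq_ge0.
  rewrite map_inj_in_uniq ?filter_uniq ?iota_uniq // => a b.
  rewrite !mem_filter => /andP[da _] /andP[db _] ab.
  by rewrite -(divnK da) -(divnK db) ab.
move=> j /mapP[m]; rewrite mem_filter mem_index_iota => /andP[dm /andP[_ mn]] ->.
by rewrite mem_index_iota /= (leq_ltn_trans (leq_div m d)).
Qed.

(** Write [1 / m] as [m ^ -2] times the sum of [totient d] over the divisors [d] of [m], interchange
    the sums, and sum [m ^ -2] over the multiples of [d]. *)
Lemma harmonic_le_totient n :
  \sum_(1 <= m < n.+1) m%:R^-1 <= 3 * \sum_(1 <= d < n.+1) (totient d)%:R / d%:R ^+ 2 :> R.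
Proof.
have -> : \sum_(1 <= m < n.+1) m%:R^-1 =
  \sum_(1 <= m < n.+1) \sum_(1 <= d < n.+1) (totient d)%:R * ((d %| m)%N%:R * (m%:R ^+ 2)^-1) :> R.
  apply: eq_big_nat => m /andP[m0 mn].
  have mR : m%:R != 0 :> R by rewrite pnatr_eq0 -lt0n.
  transitivity (m%:R * (m%:R ^+ 2)^-1 : R); first by field.
  rewrite -{1}(totient_sum_range m0 mn) natr_sum mulr_suml big_mkcond /=.
  by apply: eq_bigr => d _; case: ifP => _; rewrite ?mul1r ?mul0r ?mulr0.
rewrite exchange_big /= mulr_sumr; apply: ler_sum_nat => d /andP[d0 _].
rewrite -mulr_sumr [leRHS]mulrCA ler_wpM2l ?ler0n //.
exact: sum_inv_sq_multiples.
Qed.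

Lemma ln_le_harmonic n : ln n.+1%:R <= \sum_(1 <= m < n.+1) m%:R^-1 :> R.
Proof.
elim: n => [|n IH]; first by rewrite ln1 big_geq.
rewrite big_nat_recr //= -(@natr1 _ n.+1).
have n0 : 0 < n.+1%:R :> R by rewrite ltr0n.
have -> : n.+1%:R + 1 = n.+1%:R * (1 + n.+1%:R^-1) :> R by field; rewrite gt_eqF.
have i0 : 0 < n.+1%:R^-1 :> R by rewrite invr_gt0.
have p0 : 0 < 1 + n.+1%:R^-1 :> R by rewrite addr_gt0.
rewrite lnM ?posrE //.
by rewrite lerD // le_ln1Dx // (lt_trans _ i0) // oppr_lt0.
Qed.

(** There are at least [X %/ d] multiples, and since [X / d >= 1] its integer part is at least half
    of it. *)
Lemma multiples_count X d : (0 < d <= X)%N ->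
  X%:R / (2 * d%:R) <= \sum_(X.+1 <= u < (2 * X).+1) (d %| u)%N%:R :> R.
Proof.
move=> /andP[d0 dX].
have dR : 0 < d%:R :> R by rewrite ltr0n.
pose s := [seq (d * j)%N | j <- index_iota (X %/ d).+1 ((2 * X) %/ d).+1].
have us : uniq s.
  by rewrite map_inj_uniq ?iota_uniq // => a b /eqP; rewrite eqn_pmul2l // => /eqP.
have sub : {subset s <= [seq u <- index_iota X.+1 (2 * X).+1 | (d %| u)%N]}.
  move=> u /mapP[j]; rewrite mem_index_iota => /andP[j1 j2] ->.
  rewrite mem_filter dvdn_mulr //= mem_index_iota !ltnS.
  rewrite ltn_divLR // in j1; rewrite ltnS leq_divRL // in j2.
  by rewrite mulnC j1 j2.
have sz : (X %/ d <= size s)%N.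
  rewrite size_map size_iota subSS leq_subRL ?leq_div2r ?leq_pmull //.
  by rewrite addnn -muln2 -[leqRHS]/((2 * X) %/ d)%N mulnC leq_divRL // -mulnA leq_mul2l
    leq_trunc_div orbT.
have e : \sum_(X.+1 <= u < (2 * X).+1) (d %| u)%N%:R =
    \sum_(u <- [seq u <- index_iota X.+1 (2 * X).+1 | (d %| u)%N]) 1 :> R.
  rewrite big_filter [RHS]big_mkcond /=.
  by apply: eq_bigr => u _; case: ifP.
rewrite e; apply: le_trans (_ : \sum_(u <- s) 1 <= _); last exact: ler_sum_sub.
rewrite big_const_seq count_predT iter_addr_0.
apply: (@le_trans _ _ (X %/ d)%:R); last by rewrite ler_nat.
rewrite ler_pdivrMr ?mulr_gt0 // -!natrM ler_nat.
have := ltn_ceil X d0; have : (0 < X %/ d)%N by rewrite divn_gt0.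
by move: (X %/ d)%N => m; move: d0; clear; nia.
Qed.

(** Expand [gcdn u v] into totients of the common divisors and keep those [d <= X]; each divides at
    least [X / (2 d)] values of [u], and as many of [v]. The [12] is [2 ^ 2] times the [3] of
    [harmonic_le_totient]. *)
Lemma gcd_sum_ge X : (0 < X)%N ->
  X%:R ^+ 2 / 12 * ln X.+1%:R <=
  \sum_(X.+1 <= u < (2 * X).+1) \sum_(X.+1 <= v < (2 * X).+1) (gcdn u v)%:R :> R.
Proof.
move=> X0.
apply: (@le_trans _ _ (\sum_(1 <= d < X.+1) (totient d)%:R *
   ((\sum_(X.+1 <= u < (2 * X).+1) (d %| u)%N%:R) ^+ 2))).
  apply: (@le_trans _ _ (\sum_(1 <= d < X.+1) (totient d)%:R * (X%:R / (2 * d%:R)) ^+ 2)).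
    have -> : \sum_(1 <= d < X.+1) (totient d)%:R * (X%:R / (2 * d%:R)) ^+ 2 =
      X%:R ^+ 2 / 12 * (3 * \sum_(1 <= d < X.+1) (totient d)%:R / d%:R ^+ 2) :> R.
      rewrite !mulr_sumr; apply: eq_big_nat => d /andP[d0 _].
      by field; rewrite pnatr_eq0 -lt0n.
    rewrite ler_wpM2l ?divr_ge0 ?sqr_ge0 //.
    exact: le_trans (ln_le_harmonic X) (harmonic_le_totient X).
  apply: ler_sum_nat => d dX; rewrite ler_wpM2l ?ler0n // lerXn2r ?nnegrE //.
  - by rewrite sumr_ge0.
  - exact: multiples_count.
have -> : \sum_(1 <= d < X.+1) (totient d)%:R * ((\sum_(X.+1 <= u < (2 * X).+1) (d %| u)%N%:R) ^+ 2)
  = \sum_(X.+1 <= u < (2 * X).+1) \sum_(X.+1 <= v < (2 * X).+1)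
     \sum_(1 <= d < X.+1) (totient d)%:R * ((d %| u)%N%:R * (d %| v)%N%:R) :> R.
  rewrite [RHS](eq_bigr (fun u => \sum_(1 <= d < X.+1) \sum_(X.+1 <= v < (2 * X).+1)
     (totient d)%:R * ((d %| u)%N%:R * (d %| v)%N%:R))); last by move=> u _; rewrite exchange_big.
  rewrite [RHS]exchange_big /=; apply: eq_bigr => d _.
  rewrite expr2 mulr_suml mulr_sumr; apply: eq_bigr => u _.
  by rewrite mulr_sumr mulr_sumr.
apply: ler_sum_nat => u /andP[Xu _]; apply: ler_sum_nat => v _.
have g0 : (0 < gcdn u v)%N by rewrite gcdn_gt0 (leq_trans _ Xu).
set N := maxn X.+1 (gcdn u v).+1.
rewrite -[X in _ <= X%:R](@totient_sum_range _ N g0) ?leq_maxr //.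
rewrite natr_sum [leRHS]big_mkcond /= (@big_cat_nat _ _ _ X.+1 1 N) ?leq_maxl //=.
apply: (@le_trans _ _ (\sum_(1 <= i < X.+1) (if (i %| gcdn u v)%N then (totient i)%:R else 0))).
  apply: ler_sum => d _; rewrite dvdn_gcd.
  by case: (d %| u)%N; case: (d %| v)%N; rewrite ?mulr1 ?mulr0.
by rewrite lerDl sumr_ge0 // => d _; case: ifP.
Qed.

(** If [a u = b v], then [(a + u)^2 - (a - u)^2 = (b + v)^2 - (b - v)^2]. For fixed [u] and [v] the
    solutions [(a, b)] are the multiples of [(v / g, u / g)], so a large gcd means many
    solutions. *)
Definition quad (t : (nat * nat) * nat) : (nat * nat) * (nat * nat) :=
  let: (u, v, k) := t in
  let g := gcdn u v in
  let a := (k * (v %/ g))%N in let b := (k * (u %/ g))%N in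
  ((a + u, b - v), (a - u, b + v))%N.

(** The range of [k] amounts to [4 v <= a < 8 v] and [4 u <= b < 8 u]: no subtraction in [quad] is
    truncated, all four entries lie in [[X, 18 X)], and each pair has [4 * gcdn u v] values of
    [k]. *)
Definition quad_params X : seq ((nat * nat) * nat) :=
  [seq (p, k) | p <- [seq (u, v) | u <- index_iota X.+1 (2 * X).+1,
                                   v <- index_iota X.+1 (2 * X).+1],
                k <- index_iota (4 * gcdn p.1 p.2) (8 * gcdn p.1 p.2)].

Definition quads X := map quad (quad_params X).

Lemma mem_quad_params X u v k : (u, v, k) \in quad_params X ->
  [/\ (X < u <= 2 * X)%N, (X < v <= 2 * X)%N & (4 * gcdn u v <= k < 8 * gcdn u v)%N].
Proof.
move=> /allpairsPdep[p [l [/allpairsPdep[a [b [ai bi ->]]] /= li [-> -> ->]]]].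
by rewrite !mem_index_iota !ltnS in ai bi li *.
Qed.

Lemma quad_bounds X u v k : (X < u <= 2 * X)%N -> (X < v <= 2 * X)%N ->
  (4 * gcdn u v <= k < 8 * gcdn u v)%N ->
  [/\ (4 * v <= k * (v %/ gcdn u v) < 8 * v)%N,
      (4 * u <= k * (u %/ gcdn u v) < 8 * u)%N &
      (k * (v %/ gcdn u v) * u = k * (u %/ gcdn u v) * v)%N].
Proof.
move=> /andP[Xu _] /andP[Xv _] /andP[k4 k8].
have u0 : (0 < u)%N by exact: leq_trans Xu.
have v0 : (0 < v)%N by exact: leq_trans Xv.
have g0 : (0 < gcdn u v)%N by rewrite gcdn_gt0 u0.
have eu := divnK (dvdn_gcdl u v); have ev := divnK (dvdn_gcdr u v).
move: (gcdn u v) (u %/ _)%N (v %/ _)%N eu ev g0 k4 k8 => g a b eu ev g0 k4 k8.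
have a0 : (0 < a)%N by move: u0; rewrite -eu muln_gt0 => /andP[].
have b0 : (0 < b)%N by move: v0; rewrite -ev muln_gt0 => /andP[].
split.
- by rewrite -ev [(b * g)%N]mulnC !mulnA leq_mul2r ltn_mul2r k4 k8 b0 orbT.
- by rewrite -eu [(a * g)%N]mulnC !mulnA leq_mul2r ltn_mul2r k4 k8 a0 orbT.
- by rewrite -eu -ev -!mulnA; congr (_ * _)%N; rewrite mulnCA.
Qed.

Lemma mem_quads X n1 n2 n3 n4 : ((n1, n2), (n3, n4)) \in quads X ->
  [/\ (X <= n1 < 18 * X)%N, (X <= n2 < 18 * X)%N, (X <= n3 < 18 * X)%N,
      (X <= n4 < 18 * X)%N & (n1 ^ 2 + n2 ^ 2 = n3 ^ 2 + n4 ^ 2)%N].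
Proof.
move=> /mapP[[[u v] k] /mem_quad_params[ui vi ki]] /=.
have [B1 B2 B3] := quad_bounds ui vi ki.
move: (k * _)%N (k * _)%N B1 B2 B3 => a b B1 B2 B3 [-> -> -> ->].
move: ui vi B1 B2 B3; clear => /andP[u1 u2] /andP[v1 v2] /andP[a1 a2] /andP[b1 b2] e.
have ua : (u <= a)%N by lia.
have vb : (v <= b)%N by lia.
by split; lia.
Qed.

(** Half-sums and half-differences of the entries recover [a], [u], [b], [v], and then [k]. *)
Lemma quads_uniq X : uniq (quads X).
Proof.
rewrite map_inj_in_uniq.
  apply: allpairs_uniq_dep.
  - apply: allpairs_uniq; try exact: iota_uniq.
    by move=> [a b] [c d] _ _ [-> ->].
  - by move=> p _; exact: iota_uniq.
  by move=> [p k] [p' k'] _ _ [-> ->].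
move=> [[u v] k] [[u' v'] k'] /mem_quad_params[ui vi ki] /mem_quad_params[ui' vi' ki'].
have [B1 B2 _] := quad_bounds ui vi ki.
have [B1' B2' _] := quad_bounds ui' vi' ki'.
rewrite /quad => -[e1 e2 e3 e4].
have [ea eu] : (k * (v %/ gcdn u v) = k' * (v' %/ gcdn u' v') /\ u = u')%N.
  move: B1 B1' ui ui' vi vi' e1 e3; move: (k * _)%N (k' * _)%N => a a'; clear; lia.
have ev : v = v'.
  move: B2 B2' ui ui' vi vi' e2 e4; move: (k * _)%N (k' * _)%N => a a'; clear; lia.
move: ea; rewrite -eu -ev => /eqP; rewrite eqn_pmul2r; first by move=> /eqP ->.
have v0 : (0 < v)%N by case/andP: vi => Xv _; exact: leq_ltn_trans Xv.
by rewrite divn_gt0 ?gcdn_gt0 ?v0 ?orbT // dvdn_leq // dvdn_gcdr.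
Qed.

Lemma size_quads X :
  (size (quads X))%:R = 4 * \sum_(X.+1 <= u < (2 * X).+1)
    \sum_(X.+1 <= v < (2 * X).+1) (gcdn u v)%:R :> R.
Proof.
rewrite size_map -sum1_size natr_sum big_allpairs_dep big_allpairs mulr_sumr.
apply: eq_bigr => u _; rewrite mulr_sumr; apply: eq_bigr => v _ /=.
rewrite sumr_const_nat -natrM; congr (_%:R); move: (gcdn u v); clear; lia.
Qed.

End QuadrupleCount.

(** * Lower bounds for moments of partial sums *)

Section LowerBounds.
Variable R : realType.
Implicit Types (x r s : R) (p : \bar R) (F G : R -> R[i]) (X A B k : nat).

Notation mu := (@torus R).
Notation mR := (measurable_fun [set: measurableTypeR R]).

Lemma moment_natE n F : moment n%:R F = (\int[mu]_x (modc (F x) ^+ n)%:E)%E.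
Proof. by apply: eq_integral => x _; rewrite powR_mulrn ?modc_ge0. Qed.

Lemma block_sum_square_lower s X B : 0 < s -> (0 < X)%N -> (2 * X <= B)%N ->
  ((X%:R * coef s (2 * X) ^+ 2)%:E <= moment 2 (block_sum s X B))%E.
Proof.
move=> s0 X0 XB; rewrite (moment_natE 2) /block_sum.
rewrite (parseval (index_iota X B) (coef s) (fun n => n ^ 2)%N) lee_fin.
have t0 i j : 0 <= coef s i * coef s j * (i ^ 2 == j ^ 2)%N%:R.
  by rewrite !mulr_ge0 ?coef_ge0.
apply: (@le_trans _ _ (\sum_(X <= i < 2 * X)
  \sum_(X <= j < B) coef s i * coef s j * (i ^ 2 == j ^ 2)%N%:R)); last first.
  apply: ler_sum_sub; first exact: iota_uniq.
    by move=> i; rewrite !mem_index_iota => /andP[-> h]; exact: leq_trans h XB.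
  by move=> i; rewrite sumr_ge0.
have -> : X%:R * coef s (2 * X) ^+ 2 = \sum_(X <= i < 2 * X) coef s (2 * X) ^+ 2.
  by rewrite sumr_const_nat mul2n -addnn addnK mulr_natl.
apply: ler_sum_nat => i /andP[Xi iX].
rewrite (bigD1_seq i) ?iota_uniq ?mem_index_iota ?Xi ?(leq_trans iX) //= eqxx mulr1.
have le : coef s (2 * X) <= coef s i.
  by rewrite coef_le ?(ltW s0) // (leq_trans X0 Xi) ltnW.
by rewrite -[leLHS]addr0 lerD ?sumr_ge0 // expr2 ler_pM ?coef_ge0.
Qed.

(** The coefficients are nonnegative, so discarding all coincidences outside [quads X] can only
    lower the moment. *)
Lemma block_sum_fourth_lower s X B : 0 < s -> (0 < X)%N -> (18 * X <= B)%N ->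
  ((X%:R ^+ 2 / 3 * ln X.+1%:R * coef s (18 * X) ^+ 4)%:E <= moment 4 (block_sum s X B))%E.
Proof.
move=> s0 X0 XB; rewrite (moment_natE 4).
pose I := [seq (i, j) | i <- index_iota X B, j <- index_iota X B].
pose c (ij : nat * nat) := coef s ij.1 * coef s ij.2.
pose m (ij : nat * nat) := (ij.1 ^ 2 + ij.2 ^ 2)%N.
have E x : modc (block_sum s X B x) ^+ 4 = modc (\sum_(i <- I) (c i)%:C * expi ((m i)%:R * x)) ^+ 2.
  rewrite -[4%N]/(2 * 2)%N exprM -modcX; congr (modc _ ^+ 2).
  rewrite expr2 /block_sum mulr_suml big_allpairs; apply: eq_bigr => i _.
  rewrite mulr_sumr; apply: eq_bigr => j _.
  by rewrite mulrACA -expiD -mulrDl -natrD -rmorphM.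
under eq_integral do rewrite E.
rewrite parseval lee_fin.
rewrite -(@big_allpairs _ _ _ _ _ I I (fun e => c e.1 * c e.2 * (m e.1 == m e.2)%:R)).
have c0 e : 0 <= c e by rewrite mulr_ge0 ?coef_ge0.
apply: le_trans (ler_sum_sub (quads_uniq X) _ _); last 2 first.
- move=> [[n1 n2] [n3 n4]] /mem_quads[/andP[a1 b1] /andP[a2 b2] /andP[a3 b3] /andP[a4 b4] _].
  have inI a b : (X <= a)%N -> (a < 18 * X)%N -> (X <= b)%N -> (b < 18 * X)%N -> (a, b) \in I.
    move=> h1 h2 h3 h4; apply/allpairsP; exists (a, b); rewrite !mem_index_iota h1 h3 /=.
    by rewrite !(leq_trans _ XB).
  by apply/allpairsP; exists ((n1, n2), (n3, n4)); split => //=; apply: inI.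
- by move=> e; rewrite !mulr_ge0 ?coef_ge0.
apply: (@le_trans _ _ (\sum_(e <- quads X) coef s (18 * X) ^+ 4)); last first.
  rewrite [leLHS]big_seq [leRHS]big_seq; apply: ler_sum => -[[n1 n2] [n3 n4]].
  move=> /mem_quads[/andP[a1 b1] /andP[a2 b2] /andP[a3 b3] /andP[a4 b4] e].
  rewrite /m /= e eqxx mulr1 /c /=.
  have le n : (X <= n)%N -> (n < 18 * X)%N -> coef s (18 * X) <= coef s n.
    by move=> h1 h2; rewrite coef_le ?(ltW s0) // (leq_trans X0 h1) ltnW.
  rewrite (_ : coef s (18 * X) ^+ 4 =
    (coef s (18 * X) * coef s (18 * X)) * (coef s (18 * X) * coef s (18 * X))); last by ring.
  by rewrite !ler_pM ?mulr_ge0 ?coef_ge0 // le.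
rewrite big_const_seq count_predT iter_addr_0 -[leRHS]mulr_natl ler_wpM2r ?exprn_ge0 ?coef_ge0 //.
rewrite size_quads; have := gcd_sum_ge R X0.
by move: (\sum_(_ <= _ < _) _) (X%:R ^+ 2) (ln _) => a b d; lra.
Qed.

(** Its squared modulus is [K] times the Fejer kernel. The coefficient [1%:C] gives it the shape of
    [parseval]. *)
Definition dirichlet K x : R[i] := \sum_(0 <= k < K) 1%:C * expi (k%:R * x).

Lemma cmeas_dirichlet K : cmeas (dirichlet K).
Proof. by apply: cmeas_sum => i _; apply: cmeasZ; exact: cmeas_expi. Qed.

Lemma dirichlet_le K x : modc (dirichlet K x) <= K%:R.
Proof.
rewrite (le_trans (modc_sum _ _ _)) //.
under eq_bigr do rewrite mul1r modc_expi.
by rewrite sumr_const_nat subn0.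
Qed.

Lemma integral_dirichlet K : (\int[mu]_x (modc (dirichlet K x) ^+ 2)%:E = K%:R%:E)%E.
Proof.
rewrite (parseval (index_iota 0 K) (fun=> 1) id); congr (_%:E).
rewrite (_ : K%:R = \sum_(0 <= i < K) 1 :> R); last by rewrite sumr_const_nat subn0.
apply: eq_big_nat => i /andP[_ iK].
rewrite (bigD1_seq i) ?iota_uniq ?mem_index_iota ?iK //= eqxx !mulr1 big1 ?addr0 //.
by move=> j; rewrite eq_sym => /negbTE ->; rewrite mulr0.
Qed.

Lemma shift_count a b K : (a <= b <= a + K)%N ->
  (a + K)%:R - b%:R <= \sum_(0 <= i < K) \sum_(0 <= j < K) (a + i == b + j)%N%:R :> R.
Proof.
move=> /andP[ab bK].
have -> : (a + K)%:R - b%:R = \sum_(0 <= j < a + K - b) 1 :> R.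
  by rewrite sumr_const_nat subn0 natrB.
rewrite exchange_big /= (@big_cat_nat _ _ _ (a + K - b) 0 K) ?leq_subLR ?leq_add2r //=.
rewrite -[leLHS]addr0 lerD //; last by rewrite sumr_ge0 // => i _; rewrite sumr_ge0.
apply: ler_sum_nat => j jk.
rewrite (bigD1_seq (b + j - a)%N) ?iota_uniq //=; last by rewrite mem_index_iota; move: jk;
  clear -ab bK; lia.
have -> : (a + (b + j - a) == b + j)%N by apply/eqP; move: ab; clear; lia.
by rewrite lerDl sumr_ge0.
Qed.

(** For [i, j] in [[X, 2 X)] the squares differ by at most [4 X^2], so with [K = 8 X^2] the equation
    [i^2 + k = j^2 + l] has at least [4 X^2] solutions. Thus all [X^2] pairs contribute, not only
    the diagonal ones. *)
Lemma block_sum_weighted_lower s X B : 0 < s -> (0 < X)%N -> (2 * X <= B)%N ->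
  ((4 * X%:R ^+ 4 * coef s (2 * X) ^+ 2)%:E <=
   \int[mu]_x (modc (block_sum s X B x * dirichlet (8 * X ^ 2) x)%R ^+ 2)%:E)%E.
Proof.
move=> s0 X0 XB; set K := (8 * X ^ 2)%N.
pose I := [seq (n, k) | n <- index_iota X B, k <- index_iota 0 K].
pose c (e : nat * nat) : R := coef s e.1.
pose m (e : nat * nat) := (e.1 ^ 2 + e.2)%N.
have E x : block_sum s X B x * dirichlet K x = \sum_(i <- I) (c i)%:C * expi ((m i)%:R * x).
  rewrite /block_sum mulr_suml big_allpairs; apply: eq_bigr => i _.
  rewrite mulr_sumr; apply: eq_bigr => j _.
  by rewrite mul1r -mulrA -expiD -mulrDl -natrD.
under eq_integral do rewrite E.
rewrite parseval lee_fin big_allpairs.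
have t0 i j : 0 <= c i * c j * (m i == m j)%:R by rewrite !mulr_ge0 ?coef_ge0.
pose N := coef s (2 * X).
have cge n : (X <= n)%N -> (n < 2 * X)%N -> N <= coef s n.
  by move=> h1 h2; rewrite coef_le ?(ltW s0) // (leq_trans X0 h1) ltnW.
apply: (@le_trans _ _ (\sum_(X <= i < 2 * X) \sum_(X <= j < 2 * X) N ^+ 2 * (4 * X%:R ^+ 2))).
  rewrite -/N !sumr_const_nat mul2n -addnn addnK -[leRHS]mulr_natl -[Y in _ <= _ * Y]mulr_natl.
  rewrite le_eqVlt; apply/orP; left; apply/eqP; ring.
have sub : {subset index_iota X (2 * X) <= index_iota X B}.
  by move=> i; rewrite !mem_index_iota => /andP[-> h]; exact: leq_trans h XB.
apply: le_trans (ler_sum_sub (iota_uniq _ _) sub _); last first.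
  by move=> i; apply: sumr_ge0 => k _; apply: sumr_ge0.
apply: ler_sum_nat => i /andP[Xi iX].
rewrite (eq_bigr (fun k => \sum_(X <= j < B)
  \sum_(0 <= l < K) c (i, k) * c (j, l) * (m (i, k) == m (j, l))%:R));
  last by move=> k _; rewrite big_allpairs.
rewrite exchange_big /=.
apply: le_trans (ler_sum_sub (iota_uniq _ _) sub _); last first.
  by move=> j; apply: sumr_ge0 => k _; apply: sumr_ge0.
apply: ler_sum_nat => j /andP[Xj jX].
apply: (@le_trans _ _ (\sum_(0 <= k < K)
  \sum_(0 <= l < K) N ^+ 2 * (i ^ 2 + k == j ^ 2 + l)%N%:R)); last first.
  apply: ler_sum => k _; apply: ler_sum => l _; rewrite /c /m /= ler_wpM2r //.
  by rewrite expr2 ler_pM ?coef_ge0 ?cge.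
have -> : \sum_(0 <= k < K) \sum_(0 <= l < K) N ^+ 2 * (i ^ 2 + k == j ^ 2 + l)%N%:R =
    N ^+ 2 * \sum_(0 <= k < K) \sum_(0 <= l < K) (i ^ 2 + k == j ^ 2 + l)%N%:R.
  by rewrite mulr_sumr; apply: eq_bigr => k _; rewrite mulr_sumr.
rewrite ler_wpM2l ?sqr_ge0 //.
have wlog_ij a b : (X <= a)%N -> (a <= b)%N -> (b < 2 * X)%N ->
    4 * X%:R ^+ 2 <= \sum_(0 <= k < K) \sum_(0 <= l < K) (a ^ 2 + k == b ^ 2 + l)%N%:R :> R.
  move=> Xa ab bX.
  have b2 : (b ^ 2 <= 4 * X ^ 2)%N by rewrite -[4%N]/(2 ^ 2)%N -expnMn leq_exp2r // ltnW.
  have a2 : (a ^ 2 <= b ^ 2)%N by rewrite leq_exp2r.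
  apply: le_trans (@shift_count (a ^ 2) (b ^ 2) K _); last first.
    by rewrite a2 /= /K; move: b2; clear; lia.
  rewrite lerBrDr -natrX -natrM -natrD ler_nat /K; move: b2; clear; lia.
have [ij|/ltnW ji] := leqP i j; first exact: wlog_ij.
rewrite exchange_big /=; under eq_bigr do under eq_bigr do rewrite eq_sym.
exact: wlog_ij.
Qed.

(** [|G|] is at most twice the larger of [|F|] and [|F - G|], which works for every [r > 0]. *)
Lemma moment_transfer r F G : 0 < r -> cmeas F -> cmeas G ->
  (moment r G <= (2 `^ r)%:E * (moment r F + moment r (fun x => F x - G x)%R))%E.
Proof.
move=> r0 mF mG; have mFG : cmeas (fun x => F x - G x) by exact: cmeasB.
rewrite /moment -ge0_integralD //; last 4 first.
- by move=> x _; rewrite lee_fin powR_ge0.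
- exact: cmeas_powRE.
- by move=> x _; rewrite lee_fin powR_ge0.
- exact: cmeas_powRE.
have ms : mR (fun x => ((modc (F x) `^ r)%:E + (modc (F x - G x)%R `^ r)%:E)%E).
  by apply/measurable_EFinP; apply: measurable_funD; exact: cmeas_powR.
rewrite -ge0_integralZl_EFin ?powR_ge0 //; last first.
  by move=> x _; rewrite -EFinD lee_fin addr_ge0 ?powR_ge0.
apply: ge0_le_integral => //.
- by move=> x _; rewrite lee_fin powR_ge0.
- exact: cmeas_powRE.
- by apply: measurable_funeM.
move=> x _; rewrite -EFinD -EFinM lee_fin.
set a := modc (F x); set b := modc (F x - G x).
have a0 : 0 <= a by exact: modc_ge0.
have b0 : 0 <= b by exact: modc_ge0.
have Gab : modc (G x) <= a + b.
  have -> : G x = F x - (F x - G x) by ring.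
  exact: modcB.
have [ab|/ltW ba] := leP a b.
  apply: (@le_trans _ _ ((2 * b) `^ r)).
    rewrite ge0_ler_powR ?nnegrE ?modc_ge0 ?mulr_ge0 ?(ltW r0) //; lra.
  by rewrite powRM // ler_wpM2l ?powR_ge0 // lerDr powR_ge0.
apply: (@le_trans _ _ ((2 * a) `^ r)).
  rewrite ge0_ler_powR ?nnegrE ?modc_ge0 ?mulr_ge0 ?(ltW r0) //; lra.
by rewrite powRM // ler_wpM2l ?powR_ge0 // lerDl powR_ge0.
Qed.

Lemma tail_moment_lower r s X F (B0 : nat) (L : R) : 0 < r -> 0 < s -> gam r%:E < 2 * s ->
  is_tail s X F ->
  (forall B, (B0 <= B)%N -> (L%:E <= moment r (block_sum s X B))%E) ->
  ((2 `^ (- r) * L)%:E <= moment r F)%E.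
Proof.
move=> r0 s0 gs tF HL; have mF := proj1 tF.
apply/lee_addgt0Pr => e e0.
have er : 0 < e `^ r^-1 by rewrite powR_gt0.
have p0 : (0 < r%:E)%E by rewrite lte_fin.
have [M HM] := tail_near p0 s0 gs tF er.
pose A := maxn M B0.
have near := (nrm_leP _ r0 (ltW er)).1 (HM A (leq_maxl _ _)).
rewrite -powRrM mulVf ?gt_eqF // powRr1 ?(ltW e0) // in near.
have := le_trans (HL A (leq_maxr _ _)) (moment_transfer r0 mF (cmeas_block_sum s X A)).
move=> h.
have two0 : 0 < 2 `^ r :> R by rewrite powR_gt0.
rewrite EFinM powRN lee_pdivrMl //.
by apply: le_trans h _; rewrite lee_wpmul2l ?lee_fin ?(ltW two0) // leeD2l.
Qed.

End LowerBounds.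

(** * Lower bounds for the tail in each range of p *)

Section LowerRates.
Variable R : realType.
Implicit Types (x r s : R) (p : \bar R) (F G : R -> R[i]) (X A B k : nat).

Notation mu := (@torus R).
Notation mR := (measurable_fun [set: measurableTypeR R]).

Lemma coef_gt0 s n : (0 < n)%N -> 0 < coef s n.
Proof. by move=> n0; rewrite powR_gt0 // ltr0n. Qed.

Lemma integral_scale (c : R) (g : R -> R) : 0 <= c -> mR g -> (forall x, 0 <= g x) ->
  (\int[mu]_x (c%:E * (g x)%:E) = c%:E * \int[mu]_x (g x)%:E)%E.
Proof.
move=> c0 mg g0; apply: ge0_integralZl_EFin => //.
  by move=> x _; rewrite lee_fin.
exact/measurable_EFinP.
Qed.

Lemma integral_add (g h : R -> R) : mR g -> mR h ->
  (forall x, 0 <= g x) -> (forall x, 0 <= h x) ->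
  (\int[mu]_x ((g x)%:E + (h x)%:E) = \int[mu]_x (g x)%:E + \int[mu]_x (h x)%:E)%E.
Proof.
move=> mg mh g0 h0; apply: ge0_integralD => //; try exact/measurable_EFinP;
  by move=> x _; rewrite lee_fin.
Qed.

Lemma le_integral_torus (g h : R -> R) : mR g -> mR h -> (forall x, 0 <= g x) ->
  (\forall x \ae mu, g x <= h x) -> (forall x, 0 <= h x) ->
  (\int[mu]_x (g x)%:E <= \int[mu]_x (h x)%:E)%E.
Proof.
move=> mg mh g0 gh h0; apply: ae_ge0_le_integral => //; try exact/measurable_EFinP;
  try by move=> x _; rewrite lee_fin.
by apply: torus_aeS gh => x ghx _; rewrite lee_fin.
Qed.

Lemma coefM s m X : coef s (m * X) = m%:R `^ (- (2 * s)) * X%:R `^ (- (2 * s)).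
Proof. by rewrite /coef natrM powRM. Qed.

(* Interpolation without Hoelder: split according to whether [|z| <= t]. *)
Lemma sqr_le_powR (z t r : R) : 0 < t -> 0 <= z -> 2 <= r ->
  z ^+ 2 <= t ^+ 2 + t `^ (2 - r) * z `^ r.
Proof.
move=> t0 z0 r2; have [zt|tz] := leP z t.
  by rewrite (le_trans (_ : _ <= t ^+ 2)) ?lerXn2r ?nnegrE ?(ltW t0) // lerDl mulr_ge0 ?powR_ge0.
have zp : 0 < z by exact: lt_trans tz.
rewrite (le_trans (_ : _ <= t `^ (2 - r) * z `^ r)) ?lerDr ?sqr_ge0 //.
have -> : z ^+ 2 = z `^ (2 - r) * z `^ r.
  by rewrite -powRD ?subrK ?powR_mulrn // (gt_eqF zp) implybT.
rewrite ler_wpM2r ?powR_ge0 // -(opprB r 2) !powRN lef_pV2 ?posrE ?powR_gt0 //.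
by rewrite ge0_ler_powR ?nnegrE ?(ltW t0) ?(ltW tz) // subr_ge0.
Qed.

(** Counterpart for [r <= 2]: the large values are now charged to the third power. *)
Lemma sqr_le_powR_cube (z t r : R) : 0 < t -> 0 <= z -> r <= 2 -> 0 < r ->
  z ^+ 2 <= t `^ (2 - r) * z `^ r + t^-1 * z ^+ 3.
Proof.
move=> t0 z0 r2 r0; have [zt|tz] := leP z t.
  rewrite (le_trans (_ : _ <= t `^ (2 - r) * z `^ r)) //; last first.
    by rewrite lerDl mulr_ge0 ?exprn_ge0 // invr_ge0 ltW.
  move: z0; rewrite le_eqVlt => /predU1P[<-|zp].
    by rewrite expr0n mulr_ge0 ?powR_ge0.
  have -> : z ^+ 2 = z `^ (2 - r) * z `^ r.
    by rewrite -powRD ?subrK ?powR_mulrn ?(ltW zp) // (gt_eqF zp) implybT.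
  rewrite ler_wpM2r ?powR_ge0 //.
  by rewrite ge0_ler_powR ?nnegrE ?(ltW t0) ?(ltW zp) // subr_ge0.
rewrite (le_trans (_ : _ <= t^-1 * z ^+ 3)) ?lerDr ?mulr_ge0 ?powR_ge0 //.
by rewrite [z ^+ 3]exprS mulrA ler_peMl ?sqr_ge0 // ler_pdivlMl // mulr1 ltW.
Qed.

(** [|F|^2] is split at height [t]: the constant part meets the total mass [K] of the weight, the
    other part its maximum [K^2]. *)
Lemma weighted_upper r F (t : R) K : 0 < t -> 2 <= r -> cmeas F ->
  (\int[mu]_x (modc (F x * dirichlet K x)%R ^+ 2)%:E <=
   (t ^+ 2 * K%:R)%:E + (t `^ (2 - r) * K%:R ^+ 2)%:E * moment r F)%E.
Proof.
move=> t0 r2 mF.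
have mD2 : mR (fun x => modc (dirichlet K x) ^+ 2).
  by apply: measurable_funX; apply: cmeas_mod; exact: cmeas_dirichlet.
have mF2 : mR (fun x => modc (F x) ^+ 2) by apply: measurable_funX; exact: cmeas_mod.
have mFr := cmeas_powR r mF.
have a0 : 0 <= t `^ (2 - r) * K%:R ^+ 2 by rewrite mulr_ge0 ?powR_ge0 ?sqr_ge0.
have FD x : modc (F x * dirichlet K x) ^+ 2 = modc (F x) ^+ 2 * modc (dirichlet K x) ^+ 2.
  by rewrite modcM exprMn.
under eq_integral do rewrite FD.
rewrite EFinM -integral_dirichlet -!integral_scale ?sqr_ge0 //; last 2 first.
- by move=> x; exact: powR_ge0.
- by move=> x; exact: sqr_ge0.
under [X in (_ <= X + _)%E]eq_integral do rewrite -EFinM.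
under [X in (_ <= _ + X)%E]eq_integral do rewrite -EFinM.
rewrite -integral_add; last 4 first.
- exact: measurable_funM.
- exact: measurable_funM.
- by move=> x; rewrite mulr_ge0 ?sqr_ge0.
- by move=> x; rewrite mulr_ge0 ?powR_ge0.
under [leRHS]eq_integral do rewrite -EFinD.
apply: le_integral_torus.
- exact: measurable_funM.
- by apply: measurable_funD; exact: measurable_funM.
- by move=> x; rewrite mulr_ge0 ?sqr_ge0.
- apply: torus_aeW => x.
  apply: le_trans (ler_wpM2r (sqr_ge0 _) (sqr_le_powR t0 (modc_ge0 (F x)) r2)) _.
  rewrite mulrDl lerD2l [leRHS]mulrAC ler_wpM2l ?mulr_ge0 ?powR_ge0 //.
  by rewrite lerXn2r ?nnegrE ?modc_ge0 // dirichlet_le.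
- by move=> x; rewrite addr_ge0 //; [rewrite mulr_ge0 ?sqr_ge0|rewrite mulr_ge0 ?powR_ge0].
Qed.

Lemma lower_gt4 r s : 4 < r -> 1/2 - r^-1 < s -> exists2 c : R, 0 < c &
  forall X F, (0 < X)%N -> is_tail s X F ->
  ((c * X%:R `^ (1 - 2 * r^-1 - 2 * s))%:E <= nrm r%:E F)%E.
Proof.
move=> r4 sr; have r0 : 0 < r by lra.
have s0 : 0 < s.
  apply: le_lt_trans sr; rewrite subr_ge0 div1r lef_pV2 ?posrE //; lra.
have gr : gam r%:E = 1 - 2 * r^-1.
  by rewrite /gam lte_fin ltNge (ltW r4).
have gs : gam r%:E < 2 * s by rewrite gr; lra.
pose c : R := 2 `^ (- (2 * s)) / 4 * 8 `^ (- r^-1).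
exists c; first by rewrite !mulr_gt0 ?powR_gt0 ?invr_gt0.
move=> X F X0 tF; pose y : R := X%:R; have y0 : 0 < y by rewrite ltr0n.
pose K : R := 8 * y ^+ 2; have K0 : 0 < K by rewrite mulr_gt0 ?exprn_gt0.
(* This height turns the lower bound of [block_sum_weighted_lower] into [2 t^2 K], twice the first
   term of [weighted_upper]; the remaining half forces the [r]-th moment up to [t^r / K]. *)
pose t : R := coef s (2 * X) * y / 2.
have t0 : 0 < t by rewrite divr_gt0 // mulr_gt0 // coef_gt0 // muln_gt0 X0.
have HL B : (2 * X <= B)%N -> ((t `^ r / K)%:E <= moment r (block_sum s X B))%E.
  move=> XB.
  have := le_trans (block_sum_weighted_lower s0 X0 XB)
    (weighted_upper (8 * X ^ 2) t0 (_ : 2 <= r) (cmeas_block_sum s X B)).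
  move=> /(_ _); have r2 : 2 <= r by lra.
  move=> /(_ r2).
  have -> : (8 * X ^ 2)%:R = K :> R by rewrite natrM natrX.
  case E : (moment r (block_sum s X B)) (moment_ge0 r (block_sum s X B)) => [v||] //;
    last by move=> _ _; rewrite leey.
  rewrite lee_fin => v0; rewrite -EFinM -EFinD !lee_fin.
  have -> : 4 * X%:R ^+ 4 * coef s (2 * X) ^+ 2 = 2 * (t ^+ 2 * K).
    by rewrite /t /K -/y; field.
  have e1 : t `^ (2 - r) = t ^+ 2 / t `^ r.
    by rewrite powRB ?powR_mulrn ?(ltW t0) // (gt_eqF t0) implybT.
  have tr0 : 0 < t `^ r by rewrite powR_gt0.
  rewrite e1 => h.
  have h2 : t ^+ 2 * K <= t ^+ 2 / t `^ r * K ^+ 2 * v by lra.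
  rewrite ler_pdivrMr //.
  have t2K : 0 < t ^+ 2 * K / t `^ r by rewrite divr_gt0 // mulr_gt0 ?exprn_gt0.
  rewrite -(ler_pM2l t2K).
  have -> : t ^+ 2 * K / t `^ r * t `^ r = t ^+ 2 * K by field; rewrite gt_eqF.
  by rewrite (le_trans h2) // le_eqVlt; apply/orP; left; apply/eqP; ring.
have ML := tail_moment_lower r0 s0 gs tF HL.
apply/nrm_geP => //; first by rewrite mulr_ge0 ?powR_ge0 // !mulr_ge0 ?powR_ge0.
apply: le_trans ML; rewrite lee_fin.
have -> : c * X%:R `^ (1 - 2 * r^-1 - 2 * s) = 2^-1 * t * K `^ (- r^-1).
  rewrite /t coefM /K /c -/y powRM ?exprn_ge0 // ?(ltW y0) //.
  have -> : (y ^+ 2) `^ (- r^-1) = y `^ (- (2 * r^-1)).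
    by rewrite -powR_mulrn ?(ltW y0) // -powRrM mulrN.
  have -> : y `^ (1 - 2 * r^-1 - 2 * s) = y * y `^ (- (2 * r^-1)) * y `^ (- (2 * s)).
    by rewrite -{2}(powRr1 (ltW y0)) -!powRD ?(gt_eqF y0) ?implybT.
  by field.
have Kr : (K `^ (- r^-1)) `^ r = K^-1.
  by rewrite -powRrM mulNr mulVf ?gt_eqF // powR_inv1 // ltW.
have i2 : 0 <= 2^-1 :> R by [].
have t2 : 0 <= 2^-1 * t by rewrite mulr_ge0 // ltW.
rewrite (powRM r t2 (powR_ge0 _ _)) Kr (powRM r i2 (ltW t0)).
by rewrite powRN -(powR_inv1 (_ : 0 <= 2)) // -powRrM mulN1r powRN mulrA.
Qed.

(** An essential bound needs no splitting: the weighted second moment is at most its square times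
    [K]. The partial sum obeys the bound of the tail up to an arbitrary [e]. *)
Lemma lower_infty s : 1/2 < s -> exists2 c : R, 0 < c &
  forall X F, (0 < X)%N -> is_tail s X F ->
  ((c * X%:R `^ (1 - 2 * s))%:E <= nrm +oo F)%E.
Proof.
move=> s2; have s0 : 0 < s by lra.
have gs : gam (+oo%E : \bar R) < 2 * s by rewrite /gam /=; lra.
exists (2 `^ (- (2 * s)) / 2); first by rewrite divr_gt0 ?powR_gt0.
move=> X F X0 tF; pose y : R := X%:R; have y0 : 0 < y by rewrite ltr0n.
pose t : R := coef s (2 * X) * y / 2.
have t0 : 0 < t by rewrite divr_gt0 // mulr_gt0 // coef_gt0 // muln_gt0 X0.
have -> : 2 `^ (- (2 * s)) / 2 * X%:R `^ (1 - 2 * s) = t.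
  rewrite /t coefM -/y powRD ?(gt_eqF y0) ?implybT // powRr1 ?(ltW y0) //.
  by field.
apply/lee_addgt0Pr => e e0.
have [M HM] := tail_near (ltry 0) s0 gs tF e0.
pose A := maxn M (2 * X).
have near := (nrmy_leP _ _).1 (HM A (leq_maxl _ _)).
case E : (nrm +oo F) (nrm_ge0 +oo F) => [b||] // b0; last by rewrite addye ?leey.
have Fb : \forall x \ae mu, modc (F x) <= b by apply/nrmy_leP; rewrite E.
have be : 0 <= b + e by rewrite addr_ge0 // ?ltW // -lee_fin.
have Tb : \forall x \ae mu, modc (block_sum s X A x) <= b + e.
  apply: torus_aeS (torus_aeI Fb near) => x [h1 h2].
  have -> : block_sum s X A x = F x - (F x - block_sum s X A x) by ring.
  by rewrite (le_trans (modcB _ _)) // lerD.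
rewrite -EFinD lee_fin.
have := block_sum_weighted_lower s0 X0 (leq_maxr M (2 * X)); rewrite -/A.
set K := (8 * X ^ 2)%N => h.
have KR : K%:R = 8 * y ^+ 2 :> R by rewrite natrM natrX.
have K0 : 0 < K%:R :> R by rewrite KR mulr_gt0 ?exprn_gt0.
have up : (\int[mu]_x (modc (block_sum s X A x * dirichlet K x)%R ^+ 2)%:E <=
  ((b + e) ^+ 2 * K%:R)%:E)%E.
  have mD2 : mR (fun x => modc (dirichlet K x) ^+ 2).
    by apply: measurable_funX; apply: cmeas_mod; exact: cmeas_dirichlet.
  have mF2 : mR (fun x => modc (block_sum s X A x) ^+ 2).
    by apply: measurable_funX; apply: cmeas_mod; exact: cmeas_block_sum.
  have FD x : modc (block_sum s X A x * dirichlet K x) ^+ 2 =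
      modc (block_sum s X A x) ^+ 2 * modc (dirichlet K x) ^+ 2 by rewrite modcM exprMn.
  under eq_integral do rewrite FD.
  rewrite EFinM -integral_dirichlet -integral_scale ?sqr_ge0 //; last by move=> x; exact: sqr_ge0.
  under [leRHS]eq_integral do rewrite -EFinM.
  apply: le_integral_torus.
  - exact: measurable_funM.
  - exact: measurable_funM.
  - by move=> x; rewrite mulr_ge0 ?sqr_ge0.
  - apply: torus_aeS Tb => x h1.
    by rewrite ler_wpM2r ?sqr_ge0 // lerXn2r ?nnegrE ?modc_ge0.
  - by move=> x; rewrite mulr_ge0 ?sqr_ge0.
have := le_trans h up; rewrite lee_fin.
have -> : 4 * X%:R ^+ 4 * coef s (2 * X) ^+ 2 = 2 * t ^+ 2 * K%:R.
  by rewrite KR /t -/y; field.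
rewrite ler_pM2r // => h2.
rewrite -(@ler_pXn2r _ 2) ?nnegrE ?(ltW t0) //.
by have := sqr_ge0 t; lra.
Qed.

Lemma lower_4 s : 1/4 < s -> exists2 c : R, 0 < c &
  forall X F, (0 < X)%N -> is_tail s X F ->
  ((c * X%:R `^ (1/2 - 2 * s) * (ln X.+1%:R) `^ (1/4))%:E <= nrm 4%:E F)%E.
Proof.
move=> s4; have s0 : 0 < s by lra.
have gs : gam (4%:E : \bar R) < 2 * s by rewrite /gam lte_fin ltxx /=; lra.
pose d : R := 2 `^ (- 4) * (3^-1 * (18 `^ (- (2 * s))) ^+ 4).
have d0 : 0 < d by rewrite !mulr_gt0 ?exprn_gt0 ?powR_gt0 ?invr_gt0 ?ltr0n.
exists (d `^ 4^-1); first by rewrite powR_gt0.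
move=> X F X0 tF; pose y : R := X%:R; have y0 : 0 < y by rewrite ltr0n.
have l0 : 0 <= ln X.+1%:R :> R by rewrite ln_ge0 // ler1n.
have r0 : 0 < 4 :> R by [].
have HL := tail_moment_lower r0 s0 gs tF (fun B => @block_sum_fourth_lower R s X B s0 X0).
apply/nrm_geP => //; first by rewrite !mulr_ge0 ?powR_ge0.
apply: le_trans HL; rewrite lee_fin le_eqVlt; apply/orP; left; apply/eqP.
have n4 : 4 != 0 :> R by rewrite pnatr_eq0.
have E1 : (d `^ 4^-1) `^ 4 = d by rewrite -powRrM mulVf // powRr1 // ltW.
have E2 : ((ln X.+1%:R) `^ (1/4)) `^ 4 = ln X.+1%:R :> R.
  by rewrite -powRrM div1r mulVf // powRr1.
have E3 : (y `^ (1/2 - 2 * s)) `^ 4 = y ^+ 2 * (y `^ (- (2 * s))) ^+ 4.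
  rewrite -!powR_mulrn ?powR_ge0 ?(ltW y0) // -!powRrM -powRD ?(gt_eqF y0) ?implybT //.
  by congr (_ `^ _); field.
rewrite (powRM 4 (mulr_ge0 (powR_ge0 _ _) (powR_ge0 _ _)) (powR_ge0 _ _)).
rewrite (powRM 4 (powR_ge0 _ _) (powR_ge0 _ _)) E1 E2 E3 coefM -/y /d.
move: (2 `^ (-4)) (18 `^ _) (y `^ _) (ln _) => a b c l.
by rewrite -/(y ^+ 2); field.
Qed.

Lemma lower_lt4 r s : 0 < r -> r < 4 -> 1/4 < s -> exists2 c : R, 0 < c &
  forall X F, (0 < X)%N -> is_tail s X F ->
  ((c * X%:R `^ (1/2 - 2 * s))%:E <= nrm r%:E F)%E.
Proof.
move=> r0 r4 s4; have s0 : 0 < s by lra.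
have gsr q : q < 4 -> gam (q%:E : \bar R) = 1/2 by move=> q4; rewrite /gam lte_fin q4.
have gs2 : gam (2%:E : \bar R) < 2 * s by rewrite gsr ?ltr_nat //; lra.
have gs3 : gam (3%:E : \bar R) < 2 * s by rewrite gsr ?ltr_nat //; lra.
have p3 : (0 < 3%:E :> \bar R)%E by rewrite lte_fin.
have [C C0 HC] := tail_nrm p3 s0 gs3.
pose c2 : R := 2 `^ (- 2) * (2 `^ (- (2 * s))) ^+ 2.
have c20 : 0 < c2 by rewrite mulr_gt0 ?exprn_gt0 ?powR_gt0.
pose c3 : R := (C * 2 `^ (2 * s - 1/2)) ^+ 3.
have c30 : 0 < c3 by rewrite exprn_gt0 // mulr_gt0 ?powR_gt0.
have core X F : (0 < X)%N -> is_tail s X F -> let Y : R := X%:R `^ (1/2 - 2 * s) in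
   ((c2 * Y ^+ 2)%:E <= moment 2 F)%E /\ (moment 3 F <= (c3 * Y ^+ 3)%:E)%E.
  move=> X0 tF Y; pose y : R := X%:R; have y0 : 0 < y by rewrite ltr0n.
  split.
    have r2 : 0 < 2 :> R by [].
    have := tail_moment_lower r2 s0 gs2 tF (fun B => @block_sum_square_lower R s X B s0 X0).
    apply: le_trans; rewrite lee_fin coefM -/y /c2 /Y -/y le_eqVlt; apply/orP; left; apply/eqP.
    have -> : (y `^ (1/2 - 2 * s)) ^+ 2 = y * (y `^ (- (2 * s))) ^+ 2.
      rewrite -!powR_mulrn ?powR_ge0 // -{2}(powRr1 (ltW y0)) -!powRrM -powRD ?(gt_eqF y0)
        ?implybT //.
      by congr (_ `^ _); field.
    ring.
  have k1 : (2 ^ trunc_log 2 X <= X)%N by exact: trunc_logP.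
  have k2 : (X < 2 ^ (trunc_log 2 X).+1)%N by exact: trunc_log_ltn.
  have := HC X F (trunc_log 2 X) X tF (leqnn X) k1.
  have b0 (x : R) : block_sum s X X x = 0 by rewrite /block_sum big_geq.
  have -> : (fun x => F x - block_sum s X X x) = F by apply/funext => x; rewrite b0 subr0.
  set k := trunc_log 2 X in k1 k2 *.
  have D : decay 3%:E s k <= 2 `^ (2 * s - 1/2) * Y.
    rewrite decayE /kap eqe eqr_nat /= powRr0 mulr1 gsr ?ltr_nat // -powR_nat_expn /Y.
    have e2 : 0 < (2 ^ k)%:R :> R by rewrite ltr0n expn_gt0.
    have -> : 1 / 2 - 2 * s = - (2 * s - 1 / 2) by ring.
    rewrite !powRN -[leRHS]invrK lef_pV2 ?posrE ?invr_gt0 ?divr_gt0 ?mulr_gt0 ?powR_gt0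
      ?invr_gt0 //.
    rewrite invfM invrK mulrC ler_pdivrMr ?powR_gt0 // mulrC -powRM //.
    rewrite ge0_ler_powR ?nnegrE //; last by rewrite -natrM ler_nat; move: k2; rewrite expnS;
      clear; lia.
    lra.
  move=> /(nrm_leP _ (ltr0n _ 3) _).1.
  have dd : 0 <= C * decay 3%:E s k by rewrite mulr_ge0 ?decay_ge0 // ltW.
  move=> /(_ dd) h; apply: le_trans h _; rewrite lee_fin powR_mulrn // /c3 -exprMn.
  by rewrite lerXn2r ?nnegrE // ?mulr_ge0 ?powR_ge0 ?(ltW C0) // -mulrA ler_wpM2l ?(ltW C0).
(* At height [t = q Y] the unwanted term is at most half of the lower bound [c2 Y^2] for the second
   moment: it is [t^2] when [2 <= r], and the third moment over [t] otherwise. *)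
pose q : R := if 2 <= r then Num.sqrt (c2 / 2) else 2 * c3 / c2.
have q0 : 0 < q by rewrite /q; case: ifP => _; rewrite ?sqrtr_gt0 ?divr_gt0 ?mulr_gt0.
pose c : R := (c2 / 2 * q `^ (r - 2)) `^ r^-1.
exists c; first by rewrite powR_gt0 // mulr_gt0 ?powR_gt0 // divr_gt0.
move=> X F X0 tF; have [L2 U3] := core X F X0 tF.
have mF := proj1 tF; have mFr := cmeas_powR r mF.
have m2 : mR (fun x => modc (F x) ^+ 2) by apply: measurable_funX; exact: cmeas_mod.
have Y0 : 0 < X%:R `^ (1/2 - 2 * s) :> R by rewrite powR_gt0 // ltr0n.
move: (X%:R `^ (1/2 - 2 * s)) L2 U3 Y0 => Y L2 U3 Y0.
pose t := q * Y; have t0 : 0 < t by rewrite mulr_gt0.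
apply/nrm_geP => //; first by rewrite mulr_ge0 ?powR_ge0 // ltW.
have target v : c2 * Y ^+ 2 / 2 <= t `^ (2 - r) * v -> (c * Y) `^ r <= v.
  move=> h; rewrite powRM ?powR_ge0 ?(ltW Y0) // /c -powRrM mulVf ?gt_eqF // powRr1; last first.
    by rewrite mulr_ge0 ?powR_ge0 // divr_ge0 // ltW.
  rewrite -(ler_pM2l (powR_gt0 (2 - r) t0)); apply: le_trans h.
  rewrite /t powRM ?(ltW q0) ?(ltW Y0) //.
  have eq_q : q `^ (2 - r) * q `^ (r - 2) = 1.
    rewrite -powRD ?(gt_eqF q0) ?implybT //.
    by rewrite (_ : 2 - r + (r - 2) = 0) ?powRr0 //; ring.
  have eq_Y : Y `^ (2 - r) * Y `^ r = Y ^+ 2.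
    by rewrite -powRD ?(gt_eqF Y0) ?implybT // subrK powR_mulrn // ltW.
  have -> : q `^ (2 - r) * Y `^ (2 - r) * (c2 / 2 * q `^ (r - 2) * Y `^ r) =
     (c2 / 2) * (q `^ (2 - r) * q `^ (r - 2)) * (Y `^ (2 - r) * Y `^ r) by ring.
  by rewrite eq_q eq_Y mulr1 mulrAC.
have [r2|r2] := leP 2 r.
  have up : (moment 2 F <= (t ^+ 2)%:E + (t `^ (2 - r))%:E * moment r F)%E.
    rewrite (moment_natE 2) -(mule1 (t ^+ 2)%:E) -(torusT R) -(integral_cst _ measurableT
      (t ^+ 2)%:E).
    rewrite /moment -integral_scale ?powR_ge0 //; [|by move=> x; exact: powR_ge0].
    under [X in (_ <= _ + X)%E]eq_integral do rewrite -EFinM.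
    have mc : mR (fun x => t `^ (2 - r) * modc (F x) `^ r) by exact: measurable_funM.
    rewrite -integral_add => [||//||]; last 3 first.
    - exact: measurable_cst.
    - by move=> x; exact: sqr_ge0.
    - by move=> x; rewrite mulr_ge0 ?powR_ge0.
    under [leRHS]eq_integral do rewrite -EFinD.
    apply: le_integral_torus.
    - exact: m2.
    - exact: measurable_funD.
    - by move=> x; exact: sqr_ge0.
    - by apply: torus_aeW => x; rewrite sqr_le_powR ?modc_ge0.
    - by move=> x; rewrite addr_ge0 ?sqr_ge0 // mulr_ge0 ?powR_ge0.
  have := le_trans L2 up.
  case: (moment r F) (moment_ge0 r F) => [v||] // v0; last by move=> _; rewrite leey.
  rewrite -EFinM -EFinD !lee_fin => h; apply: target; move: h.
  have -> : t ^+ 2 = c2 / 2 * Y ^+ 2.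
    by rewrite /t exprMn /q r2 sqr_sqrtr // divr_ge0 // ltW.
  by move: (Y ^+ 2) (t `^ (2 - r)) => Y2 tr; lra.
have up : (moment 2 F <= (t `^ (2 - r))%:E * moment r F + (t^-1)%:E * moment 3 F)%E.
  rewrite (moment_natE 2) (moment_natE 3) /moment.
  have m3 : mR (fun x => modc (F x) ^+ 3) by apply: measurable_funX; exact: cmeas_mod.
  have t1 : 0 <= t^-1 by rewrite invr_ge0 ltW.
  have z3 x : 0 <= modc (F x) ^+ 3 by rewrite exprn_ge0 ?modc_ge0.
  rewrite -!integral_scale ?powR_ge0 //; [|by move=> x; exact: powR_ge0].
  under [X in (_ <= X + _)%E]eq_integral do rewrite -EFinM.
  under [X in (_ <= _ + X)%E]eq_integral do rewrite -EFinM.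
  have mc : mR (fun x => t `^ (2 - r) * modc (F x) `^ r) by exact: measurable_funM.
  have mc3 : mR (fun x => t^-1 * modc (F x) ^+ 3) by exact: measurable_funM.
  rewrite -integral_add => [|//|//||]; last 2 first.
  - by move=> x; rewrite mulr_ge0 ?powR_ge0.
  - by move=> x; rewrite mulr_ge0.
  under [leRHS]eq_integral do rewrite -EFinD.
  apply: le_integral_torus.
  - exact: m2.
  - exact: measurable_funD.
  - by move=> x; exact: sqr_ge0.
  - by apply: torus_aeW => x; rewrite sqr_le_powR_cube ?modc_ge0 // ltW.
  - by move=> x; rewrite addr_ge0 // mulr_ge0 ?powR_ge0.
have up3 : ((t^-1)%:E * moment 3 F <= (c2 / 2 * Y ^+ 2)%:E)%E.
  apply: (@le_trans _ _ ((t^-1)%:E * (c3 * Y ^+ 3)%:E)%E).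
    by rewrite lee_wpmul2l // lee_fin invr_ge0 ltW.
  rewrite -EFinM lee_fin le_eqVlt; apply/orP; left; apply/eqP.
  rewrite /t /q leNgt r2 /=.
  by field; rewrite !lt0r_neq0.
have := le_trans L2 (le_trans up (leeD (lexx _) up3)).
case: (moment r F) (moment_ge0 r F) => [v||] // v0; last by move=> _; rewrite leey.
rewrite -EFinM -EFinD !lee_fin => h; apply: target; move: h.
by move: (Y ^+ 2) (t `^ (2 - r)) => Y2 tr; lra.
Qed.

End LowerRates.

(** * From X back to N *)

Section Rates.
Variable R : realType.
Implicit Types (x r s : R) (p : \bar R) (F G : R -> R[i]) (N X A B k : nat).

(** Minimality gives [(X - 1)^2 < N], and [X <= 2 (X - 1)] unless [X = 1]. *)
Lemma sqrt_ceil N : (0 < N)%N -> exists X, [/\ (0 < X)%N,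
  forall n, (N <= n ^ 2)%N = (X <= n)%N, (N <= X ^ 2)%N & (X ^ 2 <= 4 * N)%N].
Proof.
move=> N0; have ex : exists n, (N <= n ^ 2)%N by exists N; rewrite leq_pmulr.
case: (ex_minnP ex) => X NX Xmin; exists X.
have X0 : (0 < X)%N by case: X NX {Xmin} => //; rewrite leqNgt N0.
split=> // [n|].
  apply/idP/idP; first exact: Xmin.
  by move=> Xn; rewrite (leq_trans NX) // leq_exp2r.
have : ((X.-1) ^ 2 < N)%N.
  by rewrite ltnNge; apply/negP => /Xmin; rewrite leqNgt ltn_predL X0.
case: X X0 {NX Xmin} => // X _ /= h.
have [->|X1] := posnP X; first by lia.
have : (X.+1 ^ 2 <= (2 * X) ^ 2)%N by rewrite leq_exp2r //; lia.
by rewrite expnMn; move: h; clear; lia.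
Qed.

Lemma tail_block s N X M x : (0 < X)%N -> (forall n, (N <= n ^ 2)%N = (X <= n)%N) ->
  tailRe s N M x = complex.Re (block_sum s X M.+1 x) /\
  tailIm s N M x = complex.Im (block_sum s X M.+1 x).
Proof.
move=> X0 NX.
have wid (G : nat -> R) : \sum_(1 <= n < M.+1 | (N <= n ^ 2)%N) G n =
    \sum_(X <= n < M.+1) G n.
  by rewrite [RHS](big_nat_widenl X 1) //; apply: eq_bigl => n; rewrite NX.
split; rewrite /tailRe /tailIm wid /block_sum.
  rewrite (raddf_sum (@complex.Re R : {additive R[i] -> R})).
  by apply: eq_bigr => n _ /=; rewrite mul0r subr0 mulrA.
rewrite (raddf_sum (@complex.Im R : {additive R[i] -> R})).
by apply: eq_bigr => n _ /=; rewrite mul0r addr0 mulrA.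
Qed.

(** [gam p / 2] is [1/4] or [1/2 - 1/p], both values agreeing at [4], and [kap] vanishes
    elsewhere. *)
Lemma rateE p s N : rate p s N = N%:R `^ (gam p / 2 - s) * ln N%:R `^ kap p.
Proof.
rewrite /rate /gam /kap; case: ltgtP => // [p4|p4|->]; last 2 first.
- by rewrite powRr0 mulr1; congr (_ `^ _); field.
- by congr (_ * _); congr (_ `^ _); rewrite /invp; field.
by rewrite powRr0 mulr1; congr (_ `^ _); field.
Qed.

Lemma lower_X p s : (0 < p)%E -> 1/4 < s -> gam p < 2 * s -> exists2 c : R, 0 < c &
  forall X F, (0 < X)%N -> is_tail s X F ->
  ((c * X%:R `^ (gam p - 2 * s) * ln X.+1%:R `^ kap p)%:E <= nrm p F)%E.
Proof.
move=> p0 s4; rewrite /gam /kap; case: (ltgtP p 4%:E) => [p4|p4|->] gs.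
- case: p p0 p4 => [r||] //; rewrite !lte_fin => r0 r4.
  have [c c0 hc] := lower_lt4 r0 r4 s4; exists c => // X F X0 tF.
  by rewrite powRr0 mulr1; exact: hc.
- case: p p0 p4 gs => [r||] // _; rewrite /invp => r4 gs.
    rewrite lte_fin in r4.
    have sr : 1/2 - r^-1 < s by lra.
    have [c c0 hc] := lower_gt4 r4 sr; exists c => // X F X0 tF.
    by rewrite powRr0 mulr1; exact: hc.
  have s2 : 1/2 < s by lra.
  have [c c0 hc] := lower_infty s2; exists c => // X F X0 tF.
  by rewrite powRr0 mulr1 mulr0 subr0; exact: hc.
have [c c0 hc] := lower_4 s4; exists c => // X F X0 tF.
have -> : 1 - 2 * invp 4%:E = 1/2 :> R by rewrite /invp; field.
exact: hc.
Qed.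

Lemma rate_lower p s : (0 < p)%E -> 1/4 < s -> gam p < 2 * s -> exists2 c : R, 0 < c &
  forall N X F, (0 < N)%N -> (N <= X ^ 2)%N -> (X ^ 2 <= 4 * N)%N -> is_tail s X F ->
  ((c * rate p s N)%:E <= nrm p F)%E.
Proof.
move=> p0 s4 gs; have [c c0 hc] := lower_X p0 s4 gs.
pose e := s - gam p / 2; have e0 : 0 <= e by rewrite /e; lra.
(* The [4] is from [X^2 <= 4 N], the [2^-1] from [ln N <= 2 ln (X + 1)]. *)
exists (c * 4 `^ (- e) * 2^-1 `^ kap p); first by rewrite !mulr_gt0 ?powR_gt0.
move=> N X F N0 NX XN tF.
have X0 : (0 < X)%N by case: X NX {XN tF} => //; rewrite leqNgt N0.
apply: le_trans (hc X F X0 tF); rewrite lee_fin rateE.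
have xR : 0 < X%:R :> R by rewrite ltr0n.
have nR : 0 < N%:R :> R by rewrite ltr0n.
have lN : 0 <= ln N%:R :> R by rewrite ln_ge0 // ler1n.
have hX : 4 `^ (- e) * N%:R `^ (- e) <= X%:R `^ (gam p - 2 * s).
  have -> : X%:R `^ (gam p - 2 * s) = (X%:R ^+ 2) `^ (- e) :> R.
    rewrite -powR_mulrn ?(ltW xR) // -powRrM; congr (_ `^ _).
    by rewrite /e; field.
  rewrite -powRM ?(ltW nR) // !powRN lef_pV2 ?posrE ?powR_gt0 ?mulr_gt0 ?exprn_gt0 //.
  by rewrite ge0_ler_powR ?nnegrE ?mulr_ge0 ?exprn_ge0 // -natrX -natrM ler_nat.
have hl : 2^-1 `^ kap p * ln N%:R `^ kap p <= ln X.+1%:R `^ kap p.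
  rewrite -powRM //; apply: ge0_ler_powR; rewrite ?kap_ge0 ?nnegrE //.
  - by rewrite mulr_ge0.
  - by rewrite ln_ge0 // ler1n.
  rewrite ler_pdivrMl //.
  have -> : 2 * ln X.+1%:R = ln (X.+1%:R ^+ 2) :> R by rewrite lnXn ?ltr0n // mulr_natl.
  rewrite ler_ln ?posrE ?exprn_gt0 ?ltr0n // -natrX ler_nat (leq_trans NX) //.
  by rewrite leq_exp2r.
have -> : gam p / 2 - s = - e by rewrite /e; ring.
have -> : c * 4 `^ (- e) * 2^-1 `^ kap p * (N%:R `^ (- e) * ln N%:R `^ kap p) =
  c * (4 `^ (- e) * N%:R `^ (- e)) * (2^-1 `^ kap p * ln N%:R `^ kap p) by ring.
by rewrite ler_pM ?mulr_ge0 ?powR_ge0 ?(ltW c0) // ler_wpM2l ?(ltW c0).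
Qed.

Lemma rate_upper p s : (0 < p)%E -> 0 < s -> gam p < 2 * s -> exists2 C : R, 0 < C &
  forall N X F, 1 <= ln N%:R :> R -> (0 < X)%N -> (N <= X ^ 2)%N -> (X ^ 2 <= 4 * N)%N ->
  is_tail s X F -> (nrm p F <= (C * rate p s N)%:E)%E.
Proof.
move=> p0 s0 gs; have [C C0 HC] := tail_nrm p0 s0 gs.
pose e := s - gam p / 2; have e0 : 0 <= e by rewrite /e; lra.
have l2 : 0 < ln 2 :> R by rewrite ln_gt0 // ltr1n.
(* From [2 ^ (2 k) <= X^2 <= 4 N] follows [k + 1 <= 2 + ln N / (2 ln 2)], and [1 <= ln N] absorbs
   the [2]. *)
pose D : R := 2 + (2 * ln 2)^-1.
have D0 : 0 < D by rewrite addr_gt0 // invr_gt0 mulr_gt0.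
exists (C * 4 `^ e * D `^ kap p); first by rewrite !mulr_gt0 ?powR_gt0.
move=> N X F lN X0 NX XN tF.
have N0 : (0 < N)%N.
  by case: N lN {NX XN} => //; rewrite ln0 // ler10.
have nR : 0 < N%:R :> R by rewrite ltr0n.
set k := trunc_log 2 X.
have k1 : (2 ^ k <= X)%N by exact: trunc_logP.
have k2 : (X < 2 ^ k.+1)%N by exact: trunc_log_ltn.
have := HC X F k X tF (leqnn X) k1.
have b0 (x : R) : block_sum s X X x = 0 by rewrite /block_sum big_geq.
have -> : (fun x => F x - block_sum s X X x) = F by apply/funext => x; rewrite b0 subr0.
move=> h; apply: le_trans h _; rewrite lee_fin rateE decayE -powR_nat_expn.
have e2 : 0 < (2 ^ k)%:R :> R by rewrite ltr0n expn_gt0.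
have h1 : (2 ^ k)%:R `^ (gam p - 2 * s) <= 4 `^ e * N%:R `^ (- e).
  have -> : (2 ^ k)%:R `^ (gam p - 2 * s) = ((2 ^ k)%:R ^+ 2) `^ (- e) :> R.
    rewrite -powR_mulrn ?(ltW e2) // -powRrM; congr (_ `^ _).
    by rewrite /e; field.
  rewrite !powRN ler_pdivlMr ?powR_gt0 // mulrC ler_pdivrMr ?powR_gt0 ?exprn_gt0 //.
  rewrite -powRM ?exprn_ge0 // ge0_ler_powR ?nnegrE ?mulr_ge0 ?exprn_ge0 //.
  rewrite -natrX -natrM ler_nat (leq_trans NX) //.
  by rewrite -[4%N]/(2 ^ 2)%N -expnMn leq_exp2r // -expnS ltnW.
have h2 : k.+1%:R `^ kap p <= D `^ kap p * ln N%:R `^ kap p.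
  have lN0 : 0 <= ln N%:R :> R by exact: le_trans lN.
  rewrite -powRM ?(ltW D0) //; apply: ge0_ler_powR; rewrite ?kap_ge0 ?nnegrE //.
    by rewrite mulr_ge0 // ltW.
  have : ln ((2 ^ k.*2)%:R) <= ln (2 ^ 2 * N)%:R :> R.
    rewrite ler_ln ?posrE ?ltr0n ?muln_gt0 ?expn_gt0 // ler_nat.
    by rewrite -muln2 expnM (leq_trans _ XN) // leq_exp2r.
  have lnX2 j : ln (2 ^ j)%:R = j%:R * ln 2 :> R by rewrite natrX lnXn ?ltr0n // mulr_natl.
  rewrite (natrM _ (2 ^ 2) N) lnM ?posrE ?ltr0n ?expn_gt0 // !lnX2 -muln2 (natrM _ k 2) => h.
  have h' : k%:R <= 1 + (2 * ln 2)^-1 * ln N%:R :> R.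
    rewrite -(ler_pM2l (_ : 0 < 2 * ln 2)) ?mulr_gt0 //.
    have -> : 2 * ln 2 * (1 + (2 * ln 2)^-1 * ln N%:R) = 2 * ln 2 + ln N%:R :> R.
      by field; rewrite gt_eqF.
    by move: h; lra.
  rewrite -natr1 /D mulrDl.
  by move: h' lN; move: ((2 * ln 2)^-1 * ln N%:R) => z; lra.
have -> : gam p / 2 - s = - e by rewrite /e; ring.
have -> : C * 4 `^ e * D `^ kap p * (N%:R `^ (- e) * ln N%:R `^ kap p) =
  C * ((4 `^ e * N%:R `^ (- e)) * (D `^ kap p * ln N%:R `^ kap p)) by ring.
by rewrite ler_wpM2l ?(ltW C0) // ler_pM ?powR_ge0.
Qed.

End Rates.

(** * The two-sided estimate *)

Theorem theorem5p1 (R : realType) (p : \bar R) (s : R) :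
  (0 < p)%E ->
  ((p <= 4%:E)%E -> 1/4 < s) ->
  ((4%:E < p)%E -> 1/2 - invp p < s) ->
  exists C : R, 0 < C /\
  exists N0 : nat, forall N : nat, (N0 <= N)%N ->
  exists fr fi : R -> R,
    measurable_fun setT fr /\ measurable_fun setT fi /\
    ((fun M => LpT p (fun x => tailRe s N M x - fr x) (fun x => tailIm s N M x - fi x))
       @ \oo --> 0%E) /\
    ((C^-1 * rate p s N)%:E <= LpT p fr fi)%E /\
    (LpT p fr fi <= (C * rate p s N)%:E)%E.
Proof.
move=> p0 sle sgt.
(* For [p > 4] the threshold [1/2 - 1/p] is at least [1/4], so the tail exists in every case. *)
have [s4 gs] : 1/4 < s /\ gam p < 2 * s.
  have [p4|p4] := leP p 4%:E.
    have s4 := sle p4; split=> //; rewrite /gam.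
    move: p4; rewrite le_eqVlt => /predU1P[->|->]; last by lra.
    by rewrite ltxx /invp; lra.
  have sp := sgt p4; have /andP[_ h] := invp_le4 (ltW p4).
  by rewrite /gam (lt_gtF p4); split; lra.
have s0 : 0 < s by lra.
have [c c0 lower] := rate_lower p0 s4 gs.
have [C C0 upper] := rate_upper p0 s0 gs.
have CC : 0 < C + c^-1 by rewrite addr_gt0 // invr_gt0.
exists (C + c^-1); split=> //.
(* Beyond Euler's number [1 <= ln N], as [rate_upper] requires. *)
exists (Num.truncn (expR 1 : R)).+1 => N N0N.
have N0 : (0 < N)%N by exact: leq_trans N0N.
have lnN : 1 <= ln N%:R :> R.
  rewrite -[leLHS]expRK ler_ln ?posrE ?expR_gt0 ?ltr0n //.
  by rewrite (le_trans (ltW (truncnS_gt _))) // ler_nat.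
have [X [X0 NX NleX XleN]] := sqrt_ceil N0.
have [F tF] := tail_exists X s4.
have [mFr mFi] := proj1 tF.
exists (fun x => complex.Re (F x)), (fun x => complex.Im (F x)).
have rate0 : 0 <= rate p s N by rewrite rateE mulr_ge0 ?powR_ge0.
do 2 split=> //; split; last split.
- apply: cvge0_le => [M|e e0]; first exact: Lnorm_ge0.
  have [M0 HM] := tail_near p0 s0 gs tF e0; exists M0 => M MM.
  (* The partial sums include [n = M], while [block_sum] excludes its upper end; the sign is
     reversed to match [F] minus the partial sum. *)
  apply: le_trans (HM M.+1 (leqW MM)); rewrite -nrmN.
  rewrite le_eqVlt; apply/orP; left; apply/eqP; congr (LpT p _ _); apply/funext => x.
    by rewrite (tail_block s M x X0 NX).1 -ReB; congr complex.Re; ring.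
  rewrite (tail_block s M x X0 NX).2.
  by case: (F x) (block_sum _ _ _ _) => [a b] [a' b'] /=; ring.
- apply: le_trans (lower N X F N0 NleX XleN tF); rewrite lee_fin ler_wpM2r //.
  by rewrite -[leRHS]invrK lef_pV2 ?posrE ?invr_gt0 // lerDr ltW.
- apply: le_trans (upper N X F lnN X0 NleX XleN tF) _.
  by rewrite lee_fin ler_wpM2r // lerDl invr_ge0 ltW.
Qed.
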